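(* Let $q$ be a power of a prime $p$, let $n\geq 2$, and let $X=\{F=0\}\subset\mathbb{P}^n$ be a Frobenius nonclassical hypersurface over $\mathbb{F}_q$ of degree $d\geq 2$ which is smooth at each of its $\mathbb{F}_q$-points. Then (i) $d\geq p+1$, and (ii) $d\geq \sqrt{q}+1$ provided that $X$ is reduced. Moreover, in the case that $X$ is a reduced curve (i.e. $n=2$ and $X$ reduced) or $X$ is a smooth surface (i.e. $n=3$ and $X$ smooth), the equality $d=\sqrt{q}+1$ holds only if $X$ is Hermitian.
   Context: A hypersurface $X=\{F=0\}\subset\mathbb{P}^n$ over $\mathbb{F}_q$ is given by a nonzero homogeneous polynomial $F\in\mathbb{F}_q[x_0,\dots,x_n]$ (not necessarily reduced); $X$ is reduced if $F$ is squarefree. $X$ is called Frobenius nonclassical (over $\mathbb{F}_q$) if the $q$-th Frobenius map $[x_0:\dots:x_n]\mapsto[x_0^q:\dots:x_n^q]$ sends every $\overline{\mathbb{F}_q}$-point $P\in X$ into the embedded tangent space $T_PX=\{\sum_i x_i\frac{\partial F}{\partial x_i}(P)=0\}$; equivalently, $F$ divides $F_{1,0}:=\sum_{i=0}^n x_i^q\frac{\partial F}{\partial x_i}$. For $q$ a square, a Hermitian variety is a hypersurface defined by $\overline{\mathbf{x}}\cdot H\cdot \mathbf{x}^t$, where $\mathbf{x}=(x_0,\dots,x_n)$, $\overline{a}=a^{\sqrt q}$ applied entrywise, and $H$ is a nonzero matrix over $\mathbb{F}_q$ with $\overline{H}^t=H$; equivalently, a hypersurface projectively equivalent over $\mathbb{F}_q$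 to $\sum_{i=0}^r x_i^{\sqrt q+1}=0$ for some $0\leq r\leq n$. *)

(* Defs.v *)
From HB Require Import structures.
From mathcomp Require Import all_boot all_order all_algebra.
From mathcomp Require Import mpoly.
Set Implicit Arguments.
Unset Strict Implicit.
Unset Printing Implicit Defensive.
Import Order.TTheory GRing.Theory.
Local Open Scope ring_scope.

Definition mdvd (K : fieldType) (N : nat) (F G : {mpoly K[N]}) : Prop :=
  exists H : {mpoly K[N]}, G = F * H.

Definition F10 (K : fieldType) (n q : nat) (F : {mpoly K[n.+1]}) : {mpoly K[n.+1]} :=
  \sum_(i < n.+1) 'X_i ^+ q * mderiv i F.

Definition frobenius_nonclassical (K : fieldType) (n q : nat) (F : {mpoly K[n.+1]}) : Prop :=
  mdvd F (F10 q F).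

Definition smooth_at_rational_points (K : fieldType) (n : nat) (F : {mpoly K[n.+1]}) : Prop :=
  forall v : 'I_n.+1 -> K, (exists i, v i != 0) -> meval v F = 0 ->
    exists i, meval v (mderiv i F) != 0.

(* X is smooth: no singular point over any extension field L of K (in
   particular over an algebraic closure). *)
Definition smooth_hypersurface (K : fieldType) (n : nat) (F : {mpoly K[n.+1]}) : Prop :=
  forall (L : fieldType) (f : {rmorphism K -> L}) (v : 'I_n.+1 -> L),
    (exists i, v i != 0) -> meval v (map_mpoly f F) = 0 ->
    exists i, meval v (map_mpoly f (mderiv i F)) != 0.

Definition reduced (K : fieldType) (n : nat) (F : {mpoly K[n.+1]}) : Prop :=
  forall G : {mpoly K[n.+1]}, mdvd (G ^+ 2) F -> (msize G <= 1)%N.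

Definition hermitian_std (K : fieldType) (n s r : nat) : {mpoly K[n.+1]} :=
  \sum_(i < n.+1 | (i <= r)%N) 'X_i ^+ s.+1.

Definition lin_subst (K : fieldType) (n : nat) (A : 'M[K]_n.+1) : (n.+1).-tuple {mpoly K[n.+1]} :=
  [tuple \sum_(j < n.+1) A i j *: 'X_j | i < n.+1].

(* X = {F = 0} is Hermitian (with s = sqrt q): projectively equivalent over
   K to {x_0^{s+1}+...+x_r^{s+1} = 0} for some 0 <= r <= n, i.e. after an
   invertible linear change of coordinates F becomes a nonzero scalar
   multiple of the standard Hermitian polynomial. *)
Definition is_hermitian_hypersurface (K : fieldType) (n s : nat) (F : {mpoly K[n.+1]}) : Prop :=
  exists (A : 'M[K]_n.+1) (c : K) (r : nat),
    [/\ A \in unitmx, c != 0, (r <= n)%N &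
        F \mPo lin_subst A = c *: hermitian_std K n s r].

(* Main.v *)
(** Write [frob F = \sum_i x_i^q F_i = F G]. Restricting to a rational line, [f(X) = F(a + X b)]
    and [g(X) = G(a + X b)] satisfy [g f = d f + (X^q - X) f']. Hence [G(P) = d - j] in [K] when
    [f] has order [j] at [P], and [f] divides [f'] on a line without rational zeros.

    (i) If [d <= p], the congruence of orders at a smooth rational point [P] forces [F] to vanish
    on all of [T_P]; so [F = l M] with [l] linear, and [M] has a rational zero on [l = 0], which is
    singular on [F].

    (ii) Some tangent hyperplane [T_P] is not contained in [F = 0]. A plane section through [P]
    and a rational point of [T_P] off [F] then has an irreducible Frobenius nonclassical component
    [C] through [P] which is not a line, of degree [e <= d], and it suffices to show
    [q <= (e - 1)^2] for such a plane curve. Let [nu l] be the number of rational points of [C]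
    on the line [l], and [e - nu l] its defect. Eliminating one variable between [C] and its
    derivative in the direction of a rational point off [C] gives [N >= e q - e (e - 1) + nu l];
    this produces a line with [nu l = e], then the smoothness of [C] at rational points, then a
    bound on the sum of the defects. At most [q - 1] lines are external, since each of them
    divides [G]. Counting [\sum_l (e - nu l) nu l] in two ways yields the inequality.

    Equality. If [q = s^2] and [e = s + 1], the counting is tight: each line meets [C] in [1] or
    [s + 1] rational points, and each rational point off [C] is on exactly [s + 1] tangents. For
    such a point [Q] the form [F_QQ], of degree [s - 1], is divisible by these [s + 1] tangents,
    so it vanishes. This leads to the vanishing of all second derivatives, to [C | G], and to
    [C^(s-1)] being constant off [C]. Through plane sections the same holds for surfaces. Then
    [G] is a multiple of [F^(s-1)], so [frob E = E^s] for a multiple [E] of [F]; this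
    forces [E = \sum h_ij x_i x_j^s] with [h] Hermitian, and [h] can be diagonalised because the
    norm of [K] over its subfield of order [s] is surjective. *)

Require Import Defs.
From HB Require Import structures.
From mathcomp Require Import all_boot all_order all_algebra all_fingroup all_field.
From mathcomp Require Import mpoly.
From mathcomp Require Import zify ring.
From Stdlib Require Classical_Prop.
Import GRing.Theory.
Local Open Scope ring_scope.
Set Implicit Arguments.
Unset Strict Implicit.
Unset Printing Implicit Defensive.


(** * Morphisms and derivations of multivariate polynomials *)

(** Almost all arguments stay over [K]. A form of degree at most q that vanishes at every rational
    point is zero ([homog_vanish]); this replaces the Nullstellensatz, so divisibility by a linear
    form, the vanishing of second derivatives and the final formula for [G] are checked on values.
    Hence the constant care that degrees do not exceed q. An algebraic closure enters only in
    [no_linear_factor_smooth]. The identity on lines fixes the values of [G]: d off [F], and d - 1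
    at a smooth rational point of [F]. A plane section is known to be smooth only at the chosen
    point [P]. That suffices to make its component [C] through [P] nonclassical, but the smoothness
    of [C] elsewhere has to be recovered by counting ([curve_smooth]). Intersection multiplicities
    are avoided: a lower bound for the order of a Sylvester determinant at each rational value of
    the parameter is enough, and it comes from a corank. That the determinant is nonzero needs [C]
    to be prime and not just irreducible, whence the factoriality of polynomial rings. *)

Section MpolyMorphisms.
Variables (n : nat) (R : comNzRingType).
Implicit Types F G : {mpoly R[n]}.

Lemma mpoly_ring_ind (P : {mpoly R[n]} -> Prop) :
  (forall c, P c%:MP) -> (forall i, P 'X_i) ->
  (forall F G, P F -> P G -> P (F + G)) ->
  (forall F G, P F -> P G -> P (F * G)) -> forall F, P F.
Proof.
move=> PC PX PD PM F; rewrite (mpolyE F).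
elim/big_rec: _ => [|m G _ PG]; first by rewrite -mpolyC0.
apply: (PD) PG; rewrite -mul_mpolyC; apply: (PM) => //; rewrite mpolyXE_id.
elim/big_rec: _ => [|i G' _ PG']; first by rewrite -mpolyC1.
apply: (PM) PG'; elim: (m i) => [|j IH]; first by rewrite expr0 -mpolyC1.
by rewrite exprS; apply: (PM).
Qed.

(** Evaluation, restriction to a line, linear substitution and dehomogenisation are ring morphisms,
    so identities between them are checked on constants and variables only. *)
Lemma mpoly_rmorph_ext (S : nzRingType) (f g : {rmorphism {mpoly R[n]} -> S}) :
  (forall c, f c%:MP = g c%:MP) -> (forall i, f 'X_i = g 'X_i) -> f =1 g.
Proof.
move=> eC eX; apply: mpoly_ring_ind => // F G eF eG.
  by rewrite !rmorphD eF eG.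
by rewrite !rmorphM eF eG.
Qed.

(** [D] lives on the target and only has to kill the images of constants, so this serves
    restrictions to lines, linear substitutions and dehomogenised curves alike. *)
Lemma mpoly_chain_rule (S : comNzRingType) (f : {rmorphism {mpoly R[n]} -> S})
    (D : {additive S -> S}) :
  (forall x y, D (x * y) = D x * y + x * D y) -> (forall c, D (f c%:MP) = 0) ->
  forall F, D (f F) = \sum_i f F^`M(i) * D (f 'X_i).
Proof.
move=> DM DC; apply: mpoly_ring_ind => [c|i|F G eF eG|F G eF eG].
- by rewrite DC big1 // => i _; rewrite mderivC rmorph0 mul0r.
- rewrite (bigD1 i) //= big1 ?addr0 => [|j ne_ji].
    by rewrite mderivX mnm1E eqxx scale1r -[X in 'X_[X - _]]add0m addmK mpolyX0 rmorph1 mul1r.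
  by rewrite mderivX mnm1E eq_sym (negPf ne_ji) scale0r rmorph0 mul0r.
- rewrite rmorphD raddfD /= eF eG -big_split; apply: eq_bigr => i _.
  by rewrite mderivD rmorphD mulrDl.
- rewrite rmorphM DM eF eG mulr_suml mulr_sumr -big_split /=.
  apply: eq_bigr => i _; rewrite mderivM rmorphD !rmorphM /=; ring.
Qed.

Lemma rmorph_mpolyE (S : comNzRingType) (f : {rmorphism {mpoly R[n]} -> S}) F :
  f F = \sum_(m <- msupp F) f (F@_m)%:MP * \prod_i f 'X_i ^+ m i.
Proof.
rewrite {1}(mpolyE F) rmorph_sum; apply: eq_bigr => m _.
rewrite -mul_mpolyC rmorphM; congr (_ * _); rewrite mpolyXE_id rmorph_prod.
by apply: eq_bigr => i _; rewrite rmorphXn.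
Qed.

Lemma prod_expr_mdeg (S : comNzRingType) (c : S) (m : 'X_{1..n}) :
  \prod_(i < n) c ^+ m i = c ^+ mdeg m.
Proof. by rewrite mdegE -prodrXr. Qed.

Lemma dhomog_mdeg d F m : F \is d.-homog -> m \in msupp F -> mdeg m = d.
Proof. by move=> /dhomogP h /h. Qed.

Lemma homog_rmorph_scale (S : comNzRingType) (f g : {rmorphism {mpoly R[n]} -> S})
    (c : S) (d : nat) F :
  F \is d.-homog -> (forall a, f a%:MP = g a%:MP) ->
  (forall i, f 'X_i = c * g 'X_i) -> f F = c ^+ d * g F.
Proof.
move=> hF eC eX; rewrite !(rmorph_mpolyE _ F) mulr_sumr !big_seq.
apply: eq_bigr => m mF; rewrite eC.
under eq_bigr => i _ do rewrite eX exprMn.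
by rewrite big_split /= prod_expr_mdeg (dhomog_mdeg hF mF); ring.
Qed.

Lemma dhomog_mderiv d F i : F \is d.-homog -> F^`M(i) \is d.-1.-homog.
Proof.
move=> hF; apply/dhomogP => m; rewrite mcoeff_msupp mcoeff_mderiv => nz.
have : (m + U_(i))%MM \in msupp F.
  by rewrite mcoeff_msupp; apply: contraNneq nz => ->; rewrite mul0rn.
by move/(dhomog_mdeg hF) => /=; rewrite mdegD mdeg1 addn1 => <-.
Qed.

Lemma mpoly_Euler d F : F \is d.-homog -> \sum_i 'X_i * F^`M(i) = F *+ d.
Proof.
move=> hF; rewrite {2}(mpolyE F) -sumrMnl.
under eq_bigr => i _ do rewrite {1}(mpolyE F) raddf_sum mulr_sumr.
rewrite exchange_big !big_seq; apply: eq_bigr => m mF /=.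
rewrite -(dhomog_mdeg hF mF) mdegE -sumrMnr; apply: eq_bigr => i _.
rewrite mderivZ -scalerAr mderivX -scalerAr.
have [->|mi] := posnP (m i); first by rewrite mulr0n scale0r scaler0.
rewrite -mpolyXD addmC submK ?scaler_nat -?scalerMnr //.
by apply/mnm_lepP => j; rewrite mnm1E; case: eqP => // <-.
Qed.

End MpolyMorphisms.

(** * Evaluation, directional derivatives and restriction to a line *)

Section Forms.
Variable K : finFieldType.
Local Notation q := #|K|.

Definition ev n (F : {mpoly K[n]}) (v : 'rV[K]_n) : K := F.@[v 0].

Definition mder n (v : 'rV[K]_n) (F : {mpoly K[n]}) : {mpoly K[n]} :=
  \sum_i v 0 i *: F^`M(i).

Definition lin n (l : 'rV[K]_n) : {mpoly K[n]} := \sum_i l 0 i *: 'X_i.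

Definition dot n (l v : 'rV[K]_n) : K := \sum_i l 0 i * v 0 i.

(* [lsub B F] is the form [x |-> F (x *m B)] in [m] variables. *)
Definition lsub m n (B : 'M[K]_(m, n)) (F : {mpoly K[n]}) : {mpoly K[m]} :=
  mmap (@mpolyC m K) (fun i => \sum_j B j i *: 'X_j) F.
HB.instance Definition _ m n (B : 'M[K]_(m, n)) :=
  GRing.RMorphism.copy (lsub B) (mmap (@mpolyC m K) (fun i => \sum_j B j i *: 'X_j)).

(* [lp a b F] is the univariate polynomial [F (a + X b)]. *)
Definition lp n (a b : 'rV[K]_n) (F : {mpoly K[n]}) : {poly K} :=
  mmap (@polyC K) (fun i => (a 0 i)%:P + b 0 i *: 'X) F.
HB.instance Definition _ n (a b : 'rV[K]_n) :=
  GRing.RMorphism.copy (lp a b) (mmap (@polyC K) (fun i => (a 0 i)%:P + b 0 i *: 'X)).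

(** The polynomial [F10] of the statement, with q the cardinality of [K]. *)
Definition frob n (F : {mpoly K[n]}) : {mpoly K[n]} := \sum_i 'X_i ^+ q * F^`M(i).

Definition grad n (F : {mpoly K[n]}) (v : 'rV[K]_n) : 'rV[K]_n := \row_i ev F^`M(i) v.

Section Basics.
Variable n : nat.
Implicit Types (F G : {mpoly K[n]}) (a b v l : 'rV[K]_n).

Lemma evM F G v : ev (F * G) v = ev F v * ev G v. Proof. exact: rmorphM. Qed.
Lemma evD F G v : ev (F + G) v = ev F v + ev G v. Proof. exact: rmorphD. Qed.
Lemma evB F G v : ev (F - G) v = ev F v - ev G v. Proof. exact: rmorphB. Qed.
Lemma evXn F k v : ev (F ^+ k) v = ev F v ^+ k. Proof. exact: rmorphXn. Qed.
Lemma evZ c F v : ev (c *: F) v = c * ev F v. Proof. exact: mevalZ. Qed.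
Lemma ev0 v : ev (0 : {mpoly K[n]}) v = 0. Proof. exact: rmorph0. Qed.

Lemma evX i v : ev 'X_i v = v 0 i. Proof. exact: mevalXU. Qed.
Lemma evC c v : ev (c%:MP : {mpoly K[n]}) v = c. Proof. exact: mevalC. Qed.

Lemma ev_sum I r (P : pred I) (f : I -> {mpoly K[n]}) v :
  ev (\sum_(i <- r | P i) f i) v = \sum_(i <- r | P i) ev (f i) v.
Proof. exact: raddf_sum. Qed.

Lemma lpC a b c : lp a b c%:MP = c%:P. Proof. exact: mmapC. Qed.
Lemma lpX a b i : lp a b 'X_i = (a 0 i)%:P + b 0 i *: 'X.
Proof. by rewrite /lp mmapX mmap1U. Qed.
Lemma lpZ a b c F : lp a b (c *: F) = c *: lp a b F.
Proof. by rewrite -mul_mpolyC rmorphM /= lpC mul_polyC. Qed.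

Lemma horner_lp a b F t : (lp a b F).[t] = ev F (a + t *: b).
Proof.
apply: (mpoly_rmorph_ext (f := horner_eval t \o lp a b)
                         (g := meval ((a + t *: b) 0))) => [c|i] /=.
  by rewrite /horner_eval lpC hornerC mevalC.
by rewrite /horner_eval lpX mevalXU !mxE !hornerE mulrC.
Qed.

Lemma deriv_lp a b F : (lp a b F)^`() = lp a b (mder b F).
Proof.
rewrite (mpoly_chain_rule (f := lp a b) (D := deriv)) => [|x y|c]; last 2 first.
- exact: derivM.
- by rewrite /= lpC derivC.
rewrite rmorph_sum; apply: eq_bigr => i _ /=.
rewrite lpX derivD derivC add0r derivZ derivX lpZ.
by rewrite -mul_polyC mulr1 mulrC mul_polyC.
Qed.

Lemma lp_coef0 a b F : (lp a b F)`_0 = ev F a.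
Proof. by rewrite -horner_coef0 horner_lp scale0r addr0. Qed.

Lemma lp_coef1 a b F : (lp a b F)`_1 = ev (mder b F) a.
Proof. by rewrite -(lp_coef0 a b) -deriv_lp coef_deriv mulr1n. Qed.

Lemma ev_homogZ d F c v : F \is d.-homog -> ev F (c *: v) = c ^+ d * ev F v.
Proof.
move=> hF; apply: (homog_rmorph_scale (f := meval ((c *: v) 0)) (g := meval (v 0))) hF _ _.
  by move=> x; rewrite /= !mevalC.
by move=> i; rewrite /= !mevalXU mxE.
Qed.

Lemma ev_homog0 d F : (0 < d)%N -> F \is d.-homog -> ev F 0 = 0.
Proof. by move=> d0 hF; rewrite -(scale0r 0) (ev_homogZ _ _ hF) expr0n gtn_eqF // mul0r. Qed.

(** The bounds [e i] need not be attained: the coefficient at their sum is the product of the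
    coefficients at the bounds, even if some of these vanish. *)
Lemma size_coef_prod_top (I : Type) (r : seq I) (f : I -> {poly K}) (e : I -> nat) :
  (forall i, size (f i) <= (e i).+1)%N ->
  (size (\prod_(i <- r) f i)%R <= (\sum_(i <- r) e i).+1)%N /\
  (\prod_(i <- r) f i)`_(\sum_(i <- r) e i)%N = \prod_(i <- r) (f i)`_(e i).
Proof.
move=> sf; elim: r => [|i r [IH1 IH2]]; first by rewrite !big_nil size_poly1 coef1.
rewrite !big_cons; set P := \prod_(j <- r) _ in IH1 IH2 *.
set E := (\sum_(j <- r) _)%N in IH1 IH2 *; split.
  apply: leq_trans (size_polyMleq _ _) _; have := sf i; lia.
rewrite coefM (bigD1 (inord (e i) : 'I_(e i + E).+1)) //= inordK ?ltnS ?leq_addr //.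
rewrite addnC addnK IH2 [X in _ + X]big1 ?addr0 // => j nej.
have [lt|le] := ltnP (e i) j; first by rewrite nth_default ?mul0r //; apply: leq_trans (sf i) _.
rewrite [P`__]nth_default ?mulr0 //; apply: leq_trans IH1 _.
have : (j : nat) != e i by apply: contraNneq nej => ej; apply/eqP/val_inj; rewrite /= inordK ?ltnS ?leq_addl.
move: (ltn_ord j) le; lia.
Qed.

Lemma size_coef_exp_top (f : {poly K}) k :
  (size f <= 2)%N -> (size (f ^+ k)%R <= k.+1)%N /\ (f ^+ k)`_k = f`_1 ^+ k.
Proof.
move=> sf; have := @size_coef_prod_top _ (index_iota 0 k) (fun=> f) (fun=> 1%N) (fun=> sf).
by rewrite !big_const_seq !count_predT !size_iota subn0 !iter_addn_0 mul1n !iter_mulr_1 .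
Qed.

(** [b] is the point at infinity of the parametrised line, so the coefficient at the formal degree
    [d] is the value of [F] there; it may be zero. *)
Lemma lp_top d a b F : F \is d.-homog ->
  (size (lp a b F) <= d.+1)%N /\ (lp a b F)`_d = ev F b.
Proof.
move=> hF; rewrite rmorph_mpolyE.
have H (m : 'X_{1..n}) : m \in msupp F ->
  (size (lp a b (F@_m)%:MP * \prod_i lp a b 'X_i ^+ m i)%R <= d.+1)%N /\
  (lp a b (F@_m)%:MP * \prod_i lp a b 'X_i ^+ m i)`_d = F@_m * \prod_i b 0 i ^+ m i.
  move=> mF; rewrite lpC mul_polyC.
  have sX i : (size (lp a b 'X_i) <= 2)%N.
    rewrite lpX; apply: leq_trans (size_polyD _ _) _; rewrite geq_max.
    rewrite (leq_trans (size_polyC_leq1 _)) //=.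
    by apply: leq_trans (size_scale_leq _ _) _; rewrite size_polyX.
  have [s1 s2] := @size_coef_prod_top _ (index_enum 'I_n) (fun i => lp a b 'X_i ^+ m i) m
    (fun i => (size_coef_exp_top (m i) (sX i)).1).
  rewrite -mdegE (dhomog_mdeg hF mF) in s1 s2.
  split; first exact: leq_trans (size_scale_leq _ _) _.
  rewrite coefZ s2; congr (_ * _); apply: eq_bigr => i _.
  rewrite (size_coef_exp_top (m i) (sX i)).2 lpX coefD coefC /= add0r coefZ coefX mulr1 //.
split.
  rewrite big_seq; apply: (big_ind (fun p : {poly K} => size p <= d.+1)%N) => [||m /H []//].
    by rewrite size_poly0.
  by move=> x y sx sy; apply: leq_trans (size_polyD _ _) _; rewrite geq_max sx.
rewrite /ev mevalE coef_sum !big_seq; apply: eq_bigr => m mF; exact: (H m mF).2.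
Qed.

Lemma ev_mder v F a : ev (mder v F) a = dot (grad F a) v.
Proof.
rewrite /mder ev_sum; apply: eq_bigr => i _; by rewrite evZ mxE mulrC.
Qed.

Lemma mderM v F G : mder v (F * G) = mder v F * G + F * mder v G.
Proof.
rewrite /mder mulr_suml mulr_sumr -big_split; apply: eq_bigr => i _ /=.
by rewrite mderivM scalerDr scalerAl scalerAr.
Qed.

Lemma dhomog_mder d v F : F \is d.-homog -> mder v F \is d.-1.-homog.
Proof. by move=> hF; apply: rpred_sum => i _; apply: rpredZ; apply: dhomog_mderiv. Qed.

Lemma mder_linear F c u v : mder (c *: u + v) F = c *: mder u F + mder v F.
Proof.
rewrite /mder scaler_sumr -big_split; apply: eq_bigr => i _ /=.
by rewrite !mxE scalerDl scalerA.
Qed.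

Lemma mderZ F c u : mder (c *: u) F = c *: mder u F.
Proof. by rewrite /mder scaler_sumr; apply: eq_bigr => i _; rewrite mxE scalerA. Qed.

Lemma mderD F u v : mder (u + v) F = mder u F + mder v F.
Proof. by rewrite -[u]scale1r mder_linear !scale1r. Qed.

Lemma mder_delta F i : mder (delta_mx 0 i) F = F^`M(i).
Proof.
rewrite /mder (bigD1 i) //= big1 => [|j /negPf nj]; rewrite mxE ?eqxx.
  by rewrite scale1r addr0.
by rewrite nj scale0r.
Qed.

Lemma ev_Euler d F v : F \is d.-homog -> ev (mder v F) v = ev F v *+ d.
Proof.
move=> hF; rewrite -[RHS](rmorphMn (meval (v 0))) -(mpoly_Euler hF) /mder ev_sum rmorph_sum.
by apply: eq_bigr => i _ /=; rewrite evZ rmorphM /= mevalXU.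
Qed.

Lemma lp_Euler d a b F : F \is d.-homog ->
  lp a b F *+ d = lp a b (mder a F) + 'X * (lp a b F)^`().
Proof.
move=> hF; rewrite -rmorphMn -(mpoly_Euler hF) deriv_lp /mder !rmorph_sum mulr_sumr -big_split.
apply: eq_bigr => i _ /=; rewrite rmorphM /= lpX !lpZ mulrDl mul_polyC; congr (_ + _).
by rewrite -!scalerAl scalerAr.
Qed.

Lemma ev_lin l v : ev (lin l) v = dot l v.
Proof. by rewrite /lin ev_sum; apply: eq_bigr => i _; rewrite evZ evX. Qed.

Lemma dhomog_lin l : lin l \is 1.-homog.
Proof. by apply: rpred_sum => i _; apply: rpredZ; rewrite dhomogX /= mdeg1. Qed.

Lemma mderivXU i j : 'X_i^`M(j) = (i == j)%:R :> {mpoly K[n]}.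
Proof.
rewrite mderivX mnm1E; case: eqP => [->|_]; last by rewrite scale0r.
by rewrite -[X in 'X_[X - _]]add0m addmK mpolyX0 scale1r.
Qed.

Lemma mderiv_lin l i : (lin l)^`M(i) = (l 0 i)%:MP.
Proof.
rewrite /lin raddf_sum (bigD1 i) //= big1 ?addr0 => [|j /negPf nj]; rewrite mderivZ mderivXU ?eqxx.
  by rewrite alg_mpolyC.
by rewrite nj scaler0.
Qed.

Lemma lin_eq0 l : (lin l == 0) = (l == 0).
Proof.
apply/eqP/eqP => [l0|->]; last by rewrite /lin big1 // => i _; rewrite mxE scale0r.
by apply/rowP => i; have /eqP := mderiv_lin l i; rewrite l0 mderiv0 eq_sym mpolyC_eq0 mxE => /eqP.
Qed.

Lemma pchar_mpolyP p : p \in [pchar K] -> p \in [pchar {mpoly K[n]}].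
Proof.
case/andP=> pp /eqP p0; apply/andP; split=> //.
by rewrite -mpolyC_nat p0 mpolyC0.
Qed.

Lemma pchar_polyP p : p \in [pchar K] -> p \in [pchar {poly K}].
Proof. by move=> pK; rewrite (pchar_poly K). Qed.

End Basics.
End Forms.

(** * Linear substitutions, vanishing forms and linear divisors *)

Section UnivariateView.
Variables (n : nat) (R : comNzRingType).
Implicit Types F : {mpoly R[n.+1]}.
Local Notation widen := (widen_ord (leqnSn n)).

Lemma ord_max_or_widen (i : 'I_n.+1) : i = ord_max \/ exists j, i = widen j.
Proof.
case: (unliftP ord_max i) => [j ->|->]; [right; exists j|by left].
by apply/val_inj; rewrite /= /bump leqNgt ltn_ord.
Qed.

Lemma muniXmax : muni 'X_ord_max = 'X :> {poly {mpoly R[n]}}.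
Proof.
rewrite /muni mmapX mmap1U; case: splitP => // j /= e.
by have := ltn_ord j; rewrite -e ltnn.
Qed.

Lemma muniXwiden i : muni 'X_(widen i) = ('X_i)%:P :> {poly {mpoly R[n]}}.
Proof.
rewrite /muni mmapX mmap1U; case: splitP => j /= e.
  by congr (('X__)%:P); apply/val_inj.
by have := ltn_ord i; rewrite e ltnNge leq_addr.
Qed.

(** The inverse of [muni], through which irreducibility and primality pass between [n.+1] variables
    and polynomials over the ring in [n] variables. *)
Definition unmuni (P : {poly {mpoly R[n]}}) : {mpoly R[n.+1]} :=
  (map_poly (@mwiden n R) P).['X_ord_max].

Lemma mwidenXU i : mwiden 'X_i = 'X_(widen i) :> {mpoly R[n.+1]}.
Proof. by rewrite mwidenX mnmwiden1. Qed.

Lemma muniK : cancel (@muni n R) unmuni.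
Proof.
pose g := horner_eval ('X_ord_max : {mpoly R[n.+1]}) \o map_poly (@mwiden n R) \o @muni n R.
apply: (mpoly_rmorph_ext (f := g) (g := idfun)) => [c|i]; rewrite /g /= /horner_eval.
  by rewrite muniC map_polyC hornerC /= mwidenC.
case: (ord_max_or_widen i) => [->|[j ->]].
  by rewrite muniXmax map_polyX hornerX.
by rewrite muniXwiden map_polyC hornerC /= mwidenXU.
Qed.

Lemma unmuniK : cancel unmuni (@muni n R).
Proof.
pose f1 : {rmorphism {mpoly R[n]} -> {poly {mpoly R[n]}}} := @muni n R \o @mwiden n R.
pose f2 : {rmorphism {mpoly R[n]} -> {poly {mpoly R[n]}}} := @polyC {mpoly R[n]}.
have mw : f1 =1 f2.
  apply: mpoly_rmorph_ext => [a|i] /=.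
    by rewrite mwidenC muniC.
  by rewrite mwidenXU muniXwiden.
move=> P; rewrite /unmuni -horner_map /= muniXmax -map_poly_comp /=.
rewrite (eq_map_poly (g := @polyC _)) => [|c]; last exact: mw.
by rewrite -[RHS]comp_polyXr.
Qed.

Lemma unmuniM : {morph unmuni : x y / x * y}.
Proof. by move=> x y; rewrite /unmuni rmorphM hornerM. Qed.

Lemma mcoeff_muni F k m :
  (muni F)`_k@_m = F@_[multinom (if unlift ord_max i is Some j then m j else k) | i < n.+1].
Proof.
set M := [multinom _ | i < _]; rewrite muniE coef_sum raddf_sum /=.
transitivity (\sum_(m0 <- msupp F) F@_m0 * (m0 == M)%:R).
  apply: eq_bigr => m0 _; rewrite coefZ coefXn mulr_natr mcoeffMn mcoeffZ mcoeffX.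
  rewrite -mulrnAr -mulrnA mulnb; congr (_ * _).
  suff -> : (([multinom m0 (widen i) | i < n] == m)%MM && (k == m0 ord_max)) = (m0 == M) by [].
  apply/andP/eqP => [[/eqP e1 /eqP e2]|->].
    apply/mnmP => i; rewrite mnmE; case: unliftP => [j|] ->; last by rewrite e2.
    rewrite -e1 mnmE; congr (m0 _); apply/val_inj; rewrite /= /bump leqNgt ltn_ord //.
  split; last by rewrite mnmE unlift_none.
  apply/eqP/mnmP => i; rewrite !mnmE.
  have -> : widen i = lift ord_max i by apply/val_inj; rewrite /= /bump leqNgt ltn_ord.
  by rewrite liftK.
have [MF|nMF] := boolP (M \in msupp F).
  rewrite (bigD1_seq M) ?msupp_uniq //= eqxx mulr1 big1 ?addr0 // => m0 /negPf ->.
  by rewrite mulr0.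
rewrite memN_msupp_eq0 // big_seq big1 // => m0 m0F; case: eqP => [e|_]; last by rewrite mulr0.
by rewrite -e m0F in nMF.
Qed.

Lemma meval_muni (w : 'I_n.+1 -> R) F :
  F.@[w] = (map_poly (meval (w \o widen)) (muni F)).[w ord_max].
Proof.
pose g := horner_eval (w ord_max) \o map_poly (meval (w \o widen)) \o @muni n R.
apply: (mpoly_rmorph_ext (f := meval w) (g := g)) => [c|i]; rewrite /g /= /horner_eval.
  by rewrite muniC map_polyC hornerC /= !mevalC.
case: (ord_max_or_widen i) => [->|[j ->]].
  by rewrite muniXmax map_polyX hornerX mevalXU.
by rewrite muniXwiden map_polyC hornerC /= !mevalXU.
Qed.

End UnivariateView.

(** * Factors of forms are forms *)

Section HomogeneousFactors.
Variables (n : nat) (K : fieldType).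
Implicit Types A B : {mpoly K[n]}.

(** One of the factors vanishes at 0 as long as d > 0, so an [X] can be cancelled from it. Besides
    the factors of a form, this serves the restriction of a curve to a tangent. *)
Lemma poly_factor_monomial (R : idomainType) d (c : R) (P Q : {poly R}) : c != 0 ->
  P * Q = c%:P * 'X^d -> exists e c', (e <= d)%N /\ P = c'%:P * 'X^e.
Proof.
move=> c0; elim: d P Q => [|d IH] P Q.
  rewrite expr0 mulr1 => e.
  have PQ0 : P * Q != 0 by rewrite e polyC_eq0.
  move: (PQ0); rewrite mulf_eq0 negb_or => /andP[P0 Q0].
  have := size_mul P0 Q0; rewrite e size_polyC c0 => s1.
  exists 0%N, P`_0; split=> //; rewrite expr0 mulr1; apply: size1_polyC.
  have : (0 < size Q)%N by rewrite size_poly_gt0.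
  have : (0 < size P)%N by rewrite size_poly_gt0.
  by move: s1; rewrite /=; lia.
move=> e; have X0 : 'X != 0 :> {poly R} by rewrite polyX_eq0.
have /eqP := congr1 (fun p => p.[0]) e.
rewrite !hornerE expr0n mulr0 mulf_eq0 => /orP[]/factor_theorem[P' eP];
  rewrite subr0 in eP.
  have /IH[e' [c' [le eP']]] : P' * Q = c%:P * 'X^d.
    by apply: (mulIf X0); rewrite -[RHS]mulrA -exprSr -e eP; ring.
  by exists e'.+1, c'; split=> //; rewrite eP eP' -mulrA -exprSr.
have /IH[e' [c' [le eP']]] : P * P' = c%:P * 'X^d by apply: (mulIf X0); rewrite -[RHS]mulrA -exprSr -e eP; ring.
by exists e', c'; split=> //; apply: leqW.
Qed.

(* The substitution [x_i |-> T x_i] turns a form into a monomial in [T]. *)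
Lemma dhomog_factorl d A B : A * B != 0 -> A * B \is d.-homog ->
  exists2 e, (e <= d)%N & A \is e.-homog.
Proof.
move=> AB0 hAB.
pose f : {rmorphism {mpoly K[n]} -> {poly {mpoly K[n]}}} := mmap (polyC \o @mpolyC n K) (fun i => ('X_i)%:P * 'X : {poly {mpoly K[n]}}).
have fC c : f c%:MP = (c%:MP)%:P by rewrite /f /= mmapC.
have fX i : f 'X_i = ('X_i)%:P * 'X by rewrite /f /= mmapX mmap1U.
have eAB : f A * f B = (A * B)%:P * 'X^d.
  rewrite -rmorphM (homog_rmorph_scale (f := f) (g := @polyC _) (c := 'X) hAB) => [|c|i].
  - by rewrite mulrC.
  - exact: fC.
  - by rewrite fX mulrC.
have [e [c [le eA]]] := poly_factor_monomial AB0 eAB.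
exists e => //; apply/dhomogP => m mA /=; apply: contraTeq mA => ne.
have fcoef k : (f A)`_k@_m = A@_m * (mdeg m == k)%:R.
  rewrite (rmorph_mpolyE f) coef_sum raddf_sum.
  transitivity (\sum_(m0 <- msupp A) A@_m0 * (m0 == m)%:R * (mdeg m == k)%:R).
    apply: eq_bigr => m0 _; rewrite fC.
    under eq_bigr => i _ do rewrite fX exprMn -rmorphXn.
    rewrite big_split /= prod_expr_mdeg -rmorph_prod /= -mpolyXE_id.
    rewrite mulrA -polyCM coefCM coefXn mul_mpolyC mulr_natr mcoeffMn mcoeffZ mcoeffX.
    rewrite mulr_natr [k == _]eq_sym; have [->|_] := eqVneq m0 m; rewrite ?mulr0 ?mul0rn //.
  rewrite -mulr_suml; congr (_ * _).
  have [mA|nA] := boolP (m \in msupp A).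
    rewrite (bigD1_seq m) ?msupp_uniq //= eqxx mulr1 big1 ?addr0 // => m0 /negPf ->.
    by rewrite mulr0.
  rewrite memN_msupp_eq0 // big_seq big1 // => m0 m0F; case: eqP => [e0|_]; last by rewrite mulr0.
  by rewrite -e0 m0F in nA.
have := fcoef (mdeg m); rewrite eqxx mulr1 eA coefCM coefXn (negPf ne) mulr0 mcoeff0 => e0.
by rewrite mcoeff_msupp -e0 eqxx.
Qed.

Lemma dhomog_factor d A B : A * B != 0 -> A * B \is d.-homog ->
  exists e, [/\ (e <= d)%N, A \is e.-homog & B \is (d - e).-homog].
Proof.
move=> AB0 hAB; have [e le hA] := dhomog_factorl AB0 hAB.
rewrite mulrC in AB0 hAB; have [e' le' hB] := dhomog_factorl AB0 hAB.
exists e; split=> //; rewrite -(dhomog_uniq AB0 (dhomogM hB hA) hAB).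
by rewrite /= addnK.
Qed.

End HomogeneousFactors.

Section FrobeniusNonclassical.
Variable K : finFieldType.
Local Notation q := #|K|.

Lemma card_field_gt1 : (1 < q)%N. Proof. exact: finNzRing_gt1. Qed.

Lemma card_field_pchar p : p \in [pchar K] -> q = (p ^ logn p q)%N.
Proof. by move=> pK; have := card_pprimeChar pK. Qed.

Lemma pchar_dvd_card p : p \in [pchar K] -> (p %| q)%N.
Proof.
move=> pK; have := card_field_gt1; rewrite (card_field_pchar pK).
by case: (logn p _) => // k _; rewrite expnS dvdn_mulr.
Qed.

Lemma pchar_root p (c : K) : p \in [pchar K] -> exists x, x ^+ p = c.
Proof.
move=> pK; exists (c ^+ (q %/ p)); rewrite -exprM divnK ?expf_card //.
exact: pchar_dvd_card.
Qed.

Lemma exprqD (S : comNzRingType) p : p \in [pchar K] -> p \in [pchar S] ->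
  {morph (fun x : S => x ^+ q) : x y / x + y}.
Proof.
move=> pK pS x y; apply: exprDn_pchar; rewrite (card_field_pchar pK) pnatX.
by rewrite pnatE ?pS //; case/andP: pK.
Qed.

Lemma exprq_sum (S : comNzRingType) p I (r : seq I) (f : I -> S) :
  p \in [pchar K] -> p \in [pchar S] ->
  (\sum_(i <- r) f i) ^+ q = \sum_(i <- r) f i ^+ q.
Proof.
move=> pK pS; apply: (big_morph _ (exprqD pK pS)).
by rewrite expr0n gtn_eqF // ltnW // card_field_gt1.
Qed.

Section LinearSubstitution.
Variables (m n : nat).
Implicit Types (B : 'M[K]_(m, n)) (F : {mpoly K[n]}).

Lemma lsubC B c : lsub B c%:MP = c%:MP. Proof. exact: mmapC. Qed.
Lemma lsubX B i : lsub B 'X_i = \sum_j B j i *: 'X_j.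
Proof. by rewrite /lsub mmapX mmap1U. Qed.
Lemma lsubZ B c F : lsub B (c *: F) = c *: lsub B F.
Proof. by rewrite -mul_mpolyC rmorphM /= lsubC mul_mpolyC. Qed.

Lemma ev_lsub B F v : ev (lsub B F) v = ev F (v *m B).
Proof.
apply: (mpoly_rmorph_ext (f := meval (v 0) \o lsub B) (g := meval ((v *m B) 0))) => [c|i] /=.
  by rewrite lsubC !mevalC.
rewrite lsubX raddf_sum mevalXU mxE; apply: eq_bigr => j _ /=.
by rewrite mevalZ mevalXU mulrC.
Qed.

Lemma lsub_homog B d F : F \is d.-homog -> lsub B F \is d.-homog.
Proof.
move=> hF; rewrite rmorph_mpolyE big_seq; apply: rpred_sum => mm mF.
rewrite /= lsubC mul_mpolyC; apply: rpredZ; rewrite -(dhomog_mdeg hF mF) mdegE.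
apply: (big_ind2 (fun (F : {mpoly K[m]}) d => F \is d.-homog)).
- exact: dhomog1.
- by move=> *; apply: dhomogM.
move=> i _; rewrite -[X in X.-homog]mul1n; apply: dhomogMn.
by rewrite /= lsubX; apply: rpred_sum => j _; apply: rpredZ; rewrite dhomogX /= mdeg1.
Qed.

Lemma mderiv_lsub B F j : (lsub B F)^`M(j) = lsub B (mder (row j B) F).
Proof.
rewrite (mpoly_chain_rule (f := lsub B) (D := mderiv j)) => [|x y|c]; last 2 first.
- exact: mderivM.
- by rewrite /= lsubC mderivC.
rewrite rmorph_sum; apply: eq_bigr => i _ /=.
have -> : lsub B 'X_i = lin (\row_k B k i).
  by rewrite lsubX; apply: eq_bigr => k _; rewrite mxE.
by rewrite mderiv_lin mulrC mul_mpolyC lsubZ !mxE.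
Qed.

Lemma mder_lsub B F v : mder v (lsub B F) = lsub B (mder (v *m B) F).
Proof.
rewrite {1}/mder; under eq_bigr => j _ do rewrite mderiv_lsub -lsubZ -mderZ.
rewrite -rmorph_sum; congr (lsub _ _); rewrite mulmx_sum_row.
elim/big_rec2: _ => [|i x y _ ->]; last by rewrite mderD.
by rewrite /mder big1 // => i _; rewrite mxE scale0r.
Qed.

(** The entries of [B] are fixed by the q-th power. As [B] need not be square, the nonclassical
    property passes to rational sections as well as to new coordinates. *)
Lemma frob_lsub B F : frob (lsub B F) = lsub B (frob F).
Proof.
have [p pp pK] := finPcharP K.
rewrite /frob rmorph_sum /=.
under eq_bigr => j _ do rewrite mderiv_lsub /mder rmorph_sum mulr_sumr.
rewrite exchange_big; apply: eq_bigr => i _ /=.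
rewrite rmorphM rmorphXn /= lsubX (exprq_sum _ _ pK (pchar_mpolyP m pK)) mulr_suml.
by apply: eq_bigr => j _; rewrite lsubZ mxE exprZn expf_card -scalerAr scalerAl.
Qed.

End LinearSubstitution.

Lemma lsub_comp r m n (A : 'M[K]_(r, m)) (B : 'M[K]_(m, n)) (F : {mpoly K[n]}) :
  lsub A (lsub B F) = lsub (A *m B) F.
Proof.
apply: (mpoly_rmorph_ext (f := lsub A \o lsub B) (g := lsub (A *m B))) => [c|i] /=.
  by rewrite !lsubC.
rewrite !lsubX rmorph_sum /=; under eq_bigr => j _ do rewrite lsubZ lsubX scaler_sumr.
rewrite exchange_big; apply: eq_bigr => j _ /=; rewrite mxE scaler_suml.
by apply: eq_bigr => k _; rewrite scalerA mulrC.
Qed.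

Lemma lsub1 n (F : {mpoly K[n]}) : lsub 1%:M F = F.
Proof.
apply: (mpoly_rmorph_ext (f := lsub 1%:M) (g := idfun)) => [c|i] /=; first exact: lsubC.
rewrite lsubX (bigD1 i) //= big1 ?addr0 => [|j /negPf nj]; rewrite mxE ?eqxx ?scale1r //.
by rewrite nj scale0r.
Qed.

Section Vanishing.

Lemma mpoly_small_exponents_eq0 n (F : {mpoly K[n]}) :
  (forall m i, m \in msupp F -> (m i < q)%N) -> (forall v, F.@[v] = 0) -> F = 0.
Proof.
elim: n F => [|n IH] F sF F0.
  rewrite (nvar0_mpolyC F); have := F0 (fun=> 0).
  by rewrite {1}(nvar0_mpolyC F) mevalC => ->.
apply: (can_inj (@muniK n K)); rewrite muni0; apply/polyP => k; rewrite coef0.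
apply: IH => [m i|v].
  rewrite mcoeff_msupp mcoeff_muni -mcoeff_msupp => /(sF _ (lift ord_max i)).
  by rewrite mnmE liftK.
rewrite -coef_map; apply/eqP; apply: contraTT isT => nz.
pose P := map_poly (meval v) (muni F).
have P0 : P != 0 by apply: contraNneq nz => Pz; rewrite [map_poly _ _](_ : _ = P) // Pz coef0.
have rP : all (root P) (enum K).
  apply/allP => t _; apply/rootP.
  have := meval_muni (fun i => if unlift ord_max i is Some j then v j else t) F.
  rewrite F0 unlift_none => ->; rewrite /P; congr (_.[_]).
  apply: eq_map_poly => c; apply: meval_eq => i /=.
  have -> : widen_ord (leqnSn n) i = lift ord_max i.
    by apply/val_inj; rewrite /= /bump leqNgt ltn_ord.
  by rewrite liftK.
have := max_poly_roots P0 rP (enum_uniq _); rewrite -cardE ltnNge => /negP[].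
apply: leq_trans (size_poly _ _) _; apply/leq_sizeP => j qj; apply/mpolyP => m.
rewrite mcoeff_muni mcoeff0; apply: memN_msupp_eq0.
by apply/negP => /(sF _ ord_max); rewrite mnmE unlift_none ltnNge qj.
Qed.

(** All exponents are below q, except when d = q for the monomials [x_i^q]; the coefficient of such
    a monomial is the value at a coordinate vector. *)
Lemma homog_vanish n d (F : {mpoly K[n]}) : F \is d.-homog -> (d <= q)%N ->
  (forall v, ev F v = 0) -> F = 0.
Proof.
move=> hF dq F0; apply: mpoly_small_exponents_eq0 => [m i mF|v]; last first.
  have := F0 (\row_i v i); rewrite /ev => <-; apply: meval_eq => i; by rewrite mxE.
have md := dhomog_mdeg hF mF.
have mi : (m i <= d)%N by rewrite -md mdegE (bigD1 i) //= leq_addr.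
rewrite ltn_neqAle (leq_trans mi dq) andbT; apply/eqP => miq.
have mE (m' : 'X_{1..n}) : mdeg m' = d -> m' i = d -> m' = (U_(i) *+ d)%MM.
  move=> md' mi'; apply/mnmP => j; rewrite mulmnE mnm1E.
  have [<-|nij] := eqVneq i j; first by rewrite mi' mul1n.
  move: md'; rewrite mdegE (bigD1 i) //= (bigD1 j) 1?eq_sym //= mi'; lia.
have mid : m i = d by lia.
have /eqP := F0 (delta_mx 0 i); rewrite /ev mevalE (bigD1_seq m) ?msupp_uniq //=.
rewrite [X in _ + X]big_seq_cond [X in _ + X]big1 ?addr0 => [|m' /andP[m'F ne]].
  rewrite (bigD1 i) //= mxE !eqxx expr1n mul1r big1 ?mulr1 => [|j /negPf nj].
    by apply/negP; rewrite -mcoeff_msupp.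
  by rewrite (mE m) // mulmnE mnm1E eq_sym nj mul0n expr0.
have [j jm] : exists2 j, j != i & m' j != 0%N.
  apply/exists_inP; apply: contraNT ne; rewrite negb_exists_in => /forall_inP z.
  rewrite (mE m) // (mE m') //; first exact: dhomog_mdeg hF m'F.
  rewrite -(dhomog_mdeg hF m'F) mdegE (bigD1 i) //= big1 ?addn0 // => j /z.
  by rewrite negbK => /eqP.
by move=> mj; rewrite (bigD1 j) //= mxE (negPf jm) andbF expr0n (negPf mj) mul0r mulr0.
Qed.

End Vanishing.

Section LinearDivisors.
Variable n : nat.
Implicit Types (F G : {mpoly K[n]}) (l v : 'rV[K]_n).

Lemma dotDr l u v : dot l (u + v) = dot l u + dot l v.
Proof. by rewrite /dot -big_split; apply: eq_bigr => i _; rewrite mxE mulrDr. Qed.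

Lemma dotZr l c v : dot l (c *: v) = c * dot l v.
Proof. by rewrite /dot mulr_sumr; apply: eq_bigr => i _; rewrite mxE mulrCA. Qed.

Lemma dotC l v : dot l v = dot v l.
Proof. by apply: eq_bigr => i _; rewrite mulrC. Qed.

Lemma dot_mx l v : dot l v = (v *m l^T) 0 0.
Proof. by rewrite mxE; apply: eq_bigr => i _; rewrite mxE mulrC. Qed.

Lemma row_neq0P v : reflect (exists i, v 0 i != 0) (v != 0).
Proof.
apply: (iffP idP) => [v0|[i vi]]; last by apply: contraNneq vi => ->; rewrite mxE.
by apply/existsP; apply: contraNT v0 => /existsPn z; apply/eqP/rowP => i; rewrite mxE; apply/eqP/negbNE/z.
Qed.

(** [A] projects onto the hyperplane along a coordinate axis not contained in it. Each variable
    differs from its image by a multiple of [lin l], and this property is stable under sums and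
    products. *)
Lemma lin_projection l : l != 0 -> exists A : 'M[K]_n,
  [/\ forall v, dot l (v *m A) = 0, forall v, dot l v = 0 -> v *m A = v &
      forall F, exists M, F - lsub A F = lin l * M].
Proof.
case/row_neq0P=> i0 li0.
pose A : 'M[K]_n := \matrix_(i, j) ((i == j)%:R - (l 0 i / l 0 i0) *+ (j == i0)).
have vA v : v *m A = v - (dot l v / l 0 i0) *: delta_mx 0 i0.
  apply/rowP => j; rewrite !mxE eqxx /=.
  under eq_bigr => i _ do rewrite mxE mulrBr.
  rewrite sumrB; congr (_ - _).
    by rewrite (bigD1 j) //= eqxx mulr1 big1 ?addr0 // => i /negPf ->; rewrite mulr0.
  rewrite -mulr_natr mulr_suml mulr_suml; apply: eq_bigr => i _.
  by rewrite -mulr_natr [v 0 i * _]mulrC; ring.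
have lA v : dot l (v *m A) = 0.
  rewrite vA -scaleNr dotDr dotZr [dot l (delta_mx _ _)](bigD1 i0) //= big1 => [|j /negPf nj].
    by rewrite mxE !eqxx mulr1 addr0 mulNr divfK // subrr.
  by rewrite mxE nj andbF mulr0.
exists A; split=> //.
  by move=> v lv; rewrite vA lv mul0r scale0r subr0.
apply: mpoly_ring_ind => [c|i|F G [M eM] [M' eM']|F G [M eM] [M' eM']].
- by exists 0; rewrite lsubC subrr mulr0.
- exists ((l 0 i0)^-1 *+ (i == i0))%:MP.
  rewrite lsubX mulrC mul_mpolyC /lin scaler_sumr {1}[LHS](_ : _ = \sum_j ((j == i)%:R - A j i) *: 'X_j).
    apply: eq_bigr => j _; rewrite mxE opprD opprK addNKr scalerA; congr (_ *: _).
    by case: (i == i0); rewrite ?mulr1n ?mulr0n; ring.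
  under [RHS]eq_bigr => j _ do rewrite scalerBl.
  rewrite sumrB; congr (_ - _); rewrite (bigD1 i) //= eqxx scale1r big1 ?addr0 // => j /negPf ->.
  by rewrite scale0r.
- by exists (M + M'); rewrite rmorphD mulrDr -eM -eM' /=; ring.
- exists (M * G + lsub A F * M'); rewrite rmorphM mulrDr.
  have -> : lin l * (M * G) = (lin l * M) * G by ring.
  have -> : lin l * (lsub A F * M') = lsub A F * (lin l * M') by ring.
  by rewrite -eM -eM' /=; ring.
Qed.

Lemma lin_dvd_homog l d F : l != 0 -> F \is d.-homog -> (d <= q)%N ->
  (forall v, dot l v = 0 -> ev F v = 0) -> mdvd (lin l) F.
Proof.
move=> l0 hF dq F0; have [A [A1 A2 A3]] := lin_projection l0.
have z : lsub A F = 0.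
  by apply: homog_vanish (lsub_homog A hF) dq _ => v; rewrite ev_lsub F0.
by have [M] := A3 F; rewrite z subr0; exists M.
Qed.

(** The kernel of the substitution of [lin_projection] consists of multiples of [lin l], and its
    target is an integral domain. *)
Lemma lin_prime l F G : l != 0 -> mdvd (lin l) (F * G) -> mdvd (lin l) F \/ mdvd (lin l) G.
Proof.
move=> l0 [M eM]; have [A [A1 A2 A3]] := lin_projection l0.
have : lsub A F * lsub A G = 0.
  rewrite -rmorphM eM rmorphM /=; suff -> : lsub A (lin l) = 0 by rewrite mul0r.
  apply: homog_vanish (lsub_homog A (dhomog_lin l)) (ltnW card_field_gt1) _ => v.
  by rewrite ev_lsub ev_lin A1.
move/eqP; rewrite mulf_eq0 => /orP[]/eqP z.
  by left; have [M'] := A3 F; rewrite z subr0; exists M'.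
by right; have [M'] := A3 G; rewrite z subr0; exists M'.
Qed.

End LinearDivisors.
End FrobeniusNonclassical.

(** * Restriction to lines, and the bound [p < d] *)

Section LineIdentity.
Variable K : finFieldType.
Local Notation q := #|K|.

(** As a_i and b_i are fixed by the q-th power, [x_i^q] restricts to a_i + b_i X^q; Euler's relation
    [lp_Euler] then replaces the derivative along [a] by d f - X f'. *)
Lemma lp_frob n d a b (F : {mpoly K[n]}) : F \is d.-homog ->
  lp a b (frob F) = lp a b F *+ d + ('X^q - 'X) * (lp a b F)^`().
Proof.
move=> hF; have [p pp pK] := finPcharP K; rewrite (lp_Euler a b hF) deriv_lp.
rewrite [RHS](_ : _ = lp a b (mder a F) + 'X^q * lp a b (mder b F)); last by ring.
rewrite /frob /mder !rmorph_sum mulr_sumr -big_split; apply: eq_bigr => i _ /=.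
rewrite rmorphM rmorphXn /= lpX !lpZ (exprqD pK (pchar_polyP pK)) /= exprZn -rmorphXn /= !expf_card.
by rewrite mulrDl mul_polyC -scalerAl scalerAr.
Qed.

Lemma line_divides n d a b (F G : {mpoly K[n]}) : F \is d.-homog -> frob F = F * G ->
  (lp a b F %| ('X^q - 'X) * (lp a b F)^`())%R.
Proof.
move=> hF FG; have := lp_frob a b hF; rewrite FG rmorphM /= => e.
have -> : ('X^q - 'X) * (lp a b F)^`() = lp a b F * (lp a b G - d%:R).
  by rewrite mulrBr e -mulr_natr; ring.
exact: dvdp_mulr.
Qed.

Lemma line_order n d a b (F G : {mpoly K[n]}) j : F \is d.-homog -> frob F = F * G ->
  (forall i, (i < j)%N -> (lp a b F)`_i = 0) -> (lp a b F)`_j != 0 ->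
  ev G a + j%:R = d%:R.
Proof.
move=> hF FG z nz; have := lp_frob a b hF; rewrite FG rmorphM /=.
set f := lp a b F in z nz *; set g := lp a b G => e.
apply: (mulIf nz); have := congr1 (fun h : {poly K} => h`_j) e.
rewrite mulrBl coefD coefMn coefB coefM big_ord_recr /= subnn big1 ?add0r => [|i _]; last first.
  by rewrite z ?mul0r.
have -> : g`_0 = ev G a by rewrite lp_coef0.
have -> : ('X * f^`())`_j = f`_j *+ j.
  by rewrite coefXM; case: (j) => // i; rewrite coef_deriv.
(* f' has order at least j - 1 and q > 1, so X^q f' starts beyond degree j. *)
have -> : ('X^q * f^`())`_j = 0.
  rewrite coefXnM; case: ltnP => // qj; rewrite coef_deriv z ?mul0rn //.
  by have := card_field_gt1 K; lia.
rewrite sub0r mulrDl !mulr_natl mulrC => ->; exact: subrK.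
Qed.

Lemma ev_cofactor_off n d a (F G : {mpoly K[n]}) : F \is d.-homog -> frob F = F * G ->
  ev F a != 0 -> ev G a = d%:R.
Proof.
move=> hF FG nz; rewrite -(line_order (a := a) (b := 0) (j := 0) hF FG) ?addr0 //.
by rewrite lp_coef0.
Qed.

Lemma ev_cofactor_on n d a (F G : {mpoly K[n]}) : F \is d.-homog -> frob F = F * G ->
  ev F a = 0 -> grad F a != 0 -> ev G a + 1 = d%:R.
Proof.
move=> hF FG F0 /row_neq0P[i gi].
apply: (line_order (a := a) (b := delta_mx 0 i) (j := 1) hF FG); first by case; rewrite ?lp_coef0.
by rewrite lp_coef1 mder_delta; move: gi; rewrite mxE.
Qed.

Lemma coprimep_card_poly (f : {poly K}) : (forall t, ~~ root f t) -> coprimep f ('X^q - 'X).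
Proof.
move=> nr; rewrite finField_genPoly.
by elim/big_rec: _ => [|x P _ IH]; rewrite ?coprimep1 // coprimepMr coprimep_XsubC nr.
Qed.

Lemma line_no_zero n d a b (F G : {mpoly K[n]}) : F \is d.-homog -> frob F = F * G ->
  (forall t, ev F (a + t *: b) != 0) -> (lp a b F)^`() = 0.
Proof.
move=> hF FG Fab.
have f0 : lp a b F != 0.
  by apply: contraNneq (Fab 0) => z; rewrite -horner_lp z horner0.
have : (lp a b F %| (lp a b F)^`()).
  have /Gauss_dvdpr <- : coprimep (lp a b F) ('X^q - 'X).
    by apply: coprimep_card_poly => t; rewrite rootE horner_lp.
  exact: line_divides hF FG.
apply: contraTeq => nz; apply/negP => /(dvdp_leq nz).
by rewrite leqNgt lt_size_deriv.
Qed.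

Lemma line_no_zero_deg n d a b (F G : {mpoly K[n]}) : F \is d.-homog -> frob F = F * G ->
  ev F b != 0 -> (forall t, ev F (a + t *: b) != 0) -> d%:R = 0 :> K.
Proof.
move=> hF FG Fb Fab; have z := line_no_zero hF FG Fab.
case: d hF => // d hF; have := congr1 (fun h : {poly K} => h`_d) z.
rewrite coef_deriv coef0 (lp_top a b hF).2 -[ev F b *+ _]mulr_natr => /eqP.
by rewrite mulf_eq0 (negPf Fb) => /eqP.
Qed.

Definition indep n (a b : 'rV[K]_n) := forall c1 c2, c1 *: a + c2 *: b = 0 -> c1 = 0 /\ c2 = 0.

Lemma indep_neq0 n (a b : 'rV[K]_n) c1 c2 : indep a b -> (c1 != 0) || (c2 != 0) ->
  c1 *: a + c2 *: b != 0.
Proof. by move=> i h; apply/eqP => /i[z1 z2]; move: h; rewrite z1 z2 eqxx. Qed.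

(** Without a zero, f' = 0 and p divides d, so d = p and f = f_p X^p + f_0; but every element of a
    finite field has a p-th root. *)
Lemma line_has_zero_small n d a b p (F G : {mpoly K[n]}) : p \in [pchar K] ->
  F \is d.-homog -> frob F = F * G -> (0 < d)%N -> (d <= p)%N -> indep a b ->
  exists c1 c2, c1 *: a + c2 *: b != 0 /\ ev F (c1 *: a + c2 *: b) = 0.
Proof.
move=> pK hF FG d0 dp iab; have [Fb|Fb] := eqVneq (ev F b) 0.
  by exists 0, 1; rewrite scale0r scale1r add0r; split=> //; have := indep_neq0 (c1 := 0) (c2 := 1) iab; rewrite scale0r add0r scale1r; apply; rewrite oner_eq0 orbT.
have [/existsP[t /eqP Ft]|/existsPn nt] := boolP [exists t, ev F (a + t *: b) == 0].
  exists 1, t; rewrite scale1r; split=> //; have := indep_neq0 (c1 := 1) (c2 := t) iab.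
  by rewrite scale1r; apply; rewrite oner_eq0.
have z := line_no_zero hF FG nt; have dK := line_no_zero_deg hF FG Fb nt.
have ed : d = p.
  apply/eqP; rewrite eqn_leq dp dvdn_leq //.
  by rewrite (dvdn_pcharf pK) dK.
have pp := pcharf_prime pK.
have [sf fd] := lp_top a b hF; set f := lp a b F in z sf fd.
have [t ht] : exists t, t ^+ p = - (f`_0 / f`_p) by apply: pchar_root.
rewrite -ed in ht; have/eqP[] := nt t; rewrite -horner_lp -/f (@horner_coef_wide _ d.+1) //.
rewrite big_ord_recr /= (bigD1 (Ordinal d0)) //= expr0 mulr1 ht big1 ?addr0 => [|i ne].
  by rewrite mulrN mulrC divfK ?subrr // fd.
have i0 : (0 < i)%N by rewrite lt0n; apply: contraNneq ne => i0; apply/eqP/val_inj.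
have := congr1 (fun h : {poly K} => h`_i.-1) z; rewrite coef_deriv coef0 prednK //.
move/eqP; rewrite -mulr_natr mulf_eq0 -(dvdn_pcharf pK) => /orP[/eqP->|]; first by rewrite mul0r.
by move/(dvdn_leq i0); rewrite leqNgt -ed ltn_ord.
Qed.

Lemma kernel_indep n (l : 'rV[K]_n) : (2 < n)%N ->
  exists a b, [/\ indep a b, dot l a = 0 & dot l b = 0].
Proof.
move=> n3; pose M := kermx l^T; have rM : (2 <= \rank M)%N.
  by rewrite mxrank_ker; have := rank_leq_col l^T; lia.
have i0 : (0 < \rank M)%N by lia.
pose u0 := delta_mx 0 (Ordinal i0) : 'rV[K]_(\rank M).
pose u1 := delta_mx 0 (Ordinal rM) : 'rV[K]_(\rank M).
have ker (u : 'rV[K]_(\rank M)) : dot l (u *m row_base M) = 0.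
  have /sub_kermxP : (u *m row_base M <= M)%MS.
    by rewrite (submx_trans (submxMl _ _)) // eq_row_base.
  by rewrite dot_mx => ->; rewrite mxE.
exists (u0 *m row_base M), (u1 *m row_base M); split=> // c1 c2.
rewrite !scalemxAl -mulmxDl => /eqP; rewrite mulmx_free_eq0 ?row_base_free // => /eqP/rowP z.
by split; [have := z (Ordinal i0) | have := z (Ordinal rM)]; rewrite !mxE -!val_eqE /= ?mulr1 ?mulr0 ?addr0 ?add0r.
Qed.

Definition smooth_rational n (F : {mpoly K[n]}) :=
  forall v : 'rV[K]_n, v != 0 -> ev F v = 0 -> grad F v != 0.

Lemma frob_linM n l (M : {mpoly K[n]}) : frob (lin l * M) = lin l * frob M + lin l ^+ q * M.
Proof.
have [p pp pK] := finPcharP K.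
have -> : lin l ^+ q = \sum_i l 0 i *: 'X_i ^+ q.
  rewrite /lin (exprq_sum _ _ pK (pchar_mpolyP n pK)); apply: eq_bigr => i _.
  by rewrite exprZn expf_card.
rewrite /frob mulr_sumr [X in _ + X]mulr_suml -big_split; apply: eq_bigr => i _ /=.
by rewrite mderivM mderiv_lin -mul_mpolyC; ring.
Qed.

(** The residual factor is again nonclassical: a linear form with rational coefficients has
    [frob (lin l)] equal to its q-th power, which is divisible by it. *)
Lemma frob_lin_cofactor n l (M G : {mpoly K[n]}) : l != 0 -> frob (lin l * M) = lin l * M * G ->
  frob M = M * (G - lin l ^+ q.-1).
Proof.
move=> l0; rewrite frob_linM => e.
have L0 : lin l != 0 by rewrite lin_eq0.
have q0 : q = q.-1.+1 by rewrite prednK // ltnW // card_field_gt1.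
apply: (mulfI L0); rewrite mulrCA mulrBr; apply/eqP; rewrite -subr_eq0.
have -> : lin l * frob M = lin l * M * G - lin l ^+ q * M by rewrite -e; ring.
by rewrite {1}q0 exprS; apply/eqP; ring.
Qed.

Lemma grad_linM_singular n l (M : {mpoly K[n]}) v :
  dot l v = 0 -> ev M v = 0 -> grad (lin l * M) v = 0.
Proof.
move=> lv Mv; apply/rowP => i; rewrite !mxE mderivM evD !evM ev_lin lv Mv.
by rewrite mulr0 mul0r addr0.
Qed.

Lemma not_smooth_of_common_zero n l (M : {mpoly K[n]}) v : smooth_rational (lin l * M) ->
  v != 0 -> dot l v = 0 -> ev M v = 0 -> False.
Proof.
move=> sm v0 lv Mv; have := sm v v0; rewrite grad_linM_singular // eqxx.
by rewrite evM Mv mulr0 => /(_ erefl).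
Qed.

Lemma dhomog_lin_cofactor n l d (M : {mpoly K[n]}) : M != 0 -> l != 0 ->
  lin l * M \is d.-homog -> M \is d.-1.-homog.
Proof.
move=> M0 l0 h; have LM0 : lin l * M != 0 by rewrite mulf_neq0 // lin_eq0.
have [e [le hl hM]] := dhomog_factor LM0 h.
have e1 : e = 1%N by apply: dhomog_uniq hl (dhomog_lin l); rewrite lin_eq0.
by move: hM; rewrite e1 subn1.
Qed.

Theorem degree_gt_char n d p (F G : {mpoly K[n]}) : p \in [pchar K] -> (2 < n)%N ->
  (2 <= d)%N -> F != 0 -> F \is d.-homog -> frob F = F * G -> smooth_rational F -> (p < d)%N.
Proof.
move=> pK n3 d2 F0 hF FG sm; rewrite ltnNge; apply/negP => dp.
have [a [b [iab _ _]]] := kernel_indep 0 n3.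
have [c1 [c2 [P0 FP]]] := line_has_zero_small pK hF FG (ltnW d2) dp iab.
set P := _ + _ in P0 FP; have gP := sm P P0 FP.
have dq : (d <= q)%N.
  apply: leq_trans dp _; apply: dvdn_leq (pchar_dvd_card pK).
  by rewrite ltnW // card_field_gt1.
have GP := ev_cofactor_on hF FG FP gP.
(* Along a tangent direction the order j is at least 2, and G(P) = d - 1 = d - j makes it congruent
   to 1 modulo p. So j > p >= d, which is impossible unless the restriction is zero. *)
have van v : dot (grad F P) v = 0 -> ev F v = 0.
  move=> gv; rewrite -(lp_top P v hF).2; have [->|f0] := eqVneq (lp P v F) 0; first by rewrite coef0.
  have ex : exists j, (lp P v F)`_j != 0 by exists (size (lp P v F)).-1; rewrite -lead_coefE lead_coef_eq0.
  case: (ex_minnP ex) => j fj jmin.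
  have jz i : (i < j)%N -> (lp P v F)`_i = 0.
    by move=> ij; apply/eqP; apply: contraLR ij => /jmin; rewrite -leqNgt.
  have := line_order hF FG jz fj; rewrite -GP => /addrI e.
  have j1 : (1 < j)%N.
    by case: j fj {jmin jz e} => [|[|//]]; rewrite ?lp_coef0 ?FP ?lp_coef1 ?ev_mder ?gv eqxx.
  have : (p %| j - 1)%N by rewrite (dvdn_pcharf pK) natrB 1?ltnW // e subrr.
  have j10 : (0 < j - 1)%N by rewrite subn_gt0.
  move/(dvdn_leq j10) => h.
  have jd : (j <= d)%N.
    rewrite -ltnS; apply: leq_trans (lp_top P v hF).1; rewrite ltnNge; apply: contraNN fj.
    by move/leq_sizeP => /(_ j (leqnn _)) ->.
  by exfalso; move: h jd dp; lia.
have [M eM] := lin_dvd_homog gP hF dq van.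
rewrite eM in F0 hF FG sm.
have M0 : M != 0 by apply: contraNneq F0 => ->; rewrite mulr0.
have hM := dhomog_lin_cofactor M0 gP hF.
have [u [v [iuv lu lv]]] := kernel_indep (grad F P) n3.
have d1 : (0 < d.-1)%N by lia.
have d1p : (d.-1 <= p)%N by lia.
(* [M] is nonclassical of degree d - 1 <= p, so it too has a zero on each rational line, here one
   inside the hyperplane. *)
have [k1 [k2 [w0 Mw]]] := line_has_zero_small pK hM (frob_lin_cofactor gP FG) d1 d1p iuv.
apply: (not_smooth_of_common_zero sm w0 _ Mw).
by rewrite dotDr !dotZr lu lv !mulr0 addr0.
Qed.

End LineIdentity.

(** * Irreducible polynomials are prime *)

Section Factoriality.

Definition rdvd (R : comNzRingType) (a b : R) := exists c, b = a * c.

Definition rprime (R : idomainType) (a : R) :=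
  [/\ a != 0, a \isn't a GRing.unit &
      forall b c, rdvd a (b * c) -> rdvd a b \/ rdvd a c].

Definition rirr (R : idomainType) (a : R) :=
  [/\ a != 0, a \isn't a GRing.unit &
      forall b c, a = b * c -> b \is a GRing.unit \/ c \is a GRing.unit].

(** The factors are required to be prime and not just irreducible, which builds in uniqueness and
    lets them be cancelled one by one in [rdvd_cancel]. *)
Definition factorial_ring (R : idomainType) :=
  forall a : R, a != 0 -> exists (s : seq R) (u : R),
    [/\ u \is a GRing.unit, forall x, x \in s -> rprime x & a = u * \prod_(x <- s) x].

Section PolyOverFactorial.
Variable R : idomainType.
Implicit Types (f g h w : {poly R}) (a b c : R).

Lemma rdvd_polyCP c f : rdvd c%:P f <-> forall i, rdvd c f`_i.
Proof.
split=> [[g ->] i|df]; first by exists g`_i; rewrite coefCM.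
elim/poly_ind: f df => [|f a IH] df; first by exists 0; rewrite mulr0.
have [i|g eg] := IH; first by have := df i.+1; rewrite coefD coefMX coefC /= addr0.
have [b eb] : rdvd c a by have := df 0%N; rewrite coefD coefMX coefC /= add0r.
by exists (g * 'X + b%:P); rewrite eg eb mulrDr polyCM mulrA.
Qed.

(** [c] divides the product of the leading coefficients, hence one of them; removing that leading
    term keeps the product divisible and lowers the total size. *)
Lemma rdvd_polyC_Gauss c f g : rprime c ->
  rdvd c%:P (f * g) -> rdvd c%:P f \/ rdvd c%:P g.
Proof.
case=> c0 cu cp; have [N] := ubnP (size f + size g)%N; elim: N f g => // N IH f g.
have [->|f0] := eqVneq f 0; first by left; exists 0; rewrite mulr0.
have [->|g0] := eqVneq g 0; first by right; exists 0; rewrite mulr0.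
wlog dl : f g f0 g0 / rdvd c (lead_coef f) => [wl|].
  move=> sN dfg; have : rdvd c (lead_coef f * lead_coef g).
    rewrite -lead_coefM lead_coefE; exact: (rdvd_polyCP _ _).1.
  case/cp => [df|dg]; first exact: wl.
  rewrite addnC in sN; rewrite mulrC in dfg.
  by case: (wl g f); auto.
move=> sN [k ek]; pose f' := f - lead_coef f *: 'X^((size f).-1).
have sf' : (size f' < size f)%N.
  rewrite (polySpred f0) ltnS; apply/leq_sizeP => j; rewrite leq_eqVlt => /orP[/eqP<-|lt].
    by rewrite coefB coefZ coefXn eqxx mulr1 lead_coefE subrr.
  rewrite coefB coefZ coefXn gtn_eqF // mulr0 subr0 nth_default //.
  by rewrite (polySpred f0).
have [b eb] := dl.
have : rdvd c%:P (f' * g).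
  exists (k - b *: 'X^((size f).-1) * g); rewrite mulrBl ek eb mulrBr -!mul_polyC polyCM; ring.
case/IH => [|[k' ek']|]; first by move: sN sf'; lia.
  left; exists (k' + b *: 'X^((size f).-1)); rewrite mulrDr -ek' /f' eb -!mul_polyC polyCM; ring.
by right.
Qed.

Hypothesis facR : factorial_ring R.

(* The prime factors of [c] are distributed between [w] and [k]. *)
Lemma rdvd_cancel c f w k : c != 0 -> c%:P * f = w * k ->
  exists w1 k1 e, [/\ e != 0, w = e%:P * w1 & f = w1 * k1].
Proof.
move=> c0; have [s [u [uu ps ec]]] := facR c0; rewrite {}ec polyCM => e.
pose f' := u%:P * f; have {e} : (\prod_(x <- s) x)%:P * f' = w * k.
  by rewrite -e /f'; ring.
have ef : f = u^-1%:P * f' by rewrite /f' mulrA -polyCM mulVr // mul1r.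
suff H : (\prod_(x <- s) x)%:P * f' = w * k ->
  exists w1 k1 e, [/\ e != 0, w = e%:P * w1 & f' = w1 * k1].
  move/H=> [w1 [k1 [e [e0 -> ef']]]]; exists w1, (u^-1%:P * k1), e; split=> //.
  by rewrite ef ef'; ring.
clear ef; move: f' => {}f; elim: s w k ps => [|x s IH] w k ps.
  by rewrite big_nil mul1r => ->; exists w, k, 1; rewrite oner_eq0 mul1r.
have px := ps x (mem_head _ _); have [x0 _ _] := px.
have x0' : x%:P != 0 by rewrite polyC_eq0.
have ps' y : y \in s -> rprime y by move=> ys; apply: ps; rewrite inE ys orbT.
rewrite big_cons polyCM -mulrA => e.
have : rdvd x%:P (w * k) by rewrite -e; exists ((\prod_(x <- s) x)%:P * f).
case/(rdvd_polyC_Gauss px) => [[w' ew]|[k' ek]].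
  have [|w1 [k1 [e' [e0 ew' ef]]]] := IH w' k ps'.
    by apply: (mulfI x0'); rewrite e ew; ring.
  exists w1, k1, (x * e'); split=> //; first by rewrite mulf_neq0.
  by rewrite ew ew' polyCM mulrA.
have [|w1 [k1 [e' [e0 ew' ef]]]] := IH w k' ps'.
  by apply: (mulfI x0'); rewrite e ek; ring.
by exists w1, k1, e'.
Qed.

Lemma poly_unit_size f : f \is a GRing.unit -> size f = 1%N.
Proof. by rewrite poly_unitE => /andP[/eqP]. Qed.

Lemma rirr_cancel c f h k : rirr f -> (1 < size f)%N -> c != 0 -> c%:P * h = f * k -> rdvd f h.
Proof.
move=> [f0 fu fi] sf c0 /(rdvd_cancel c0)[w1 [k1 [e [e0 ef ->]]]].
case: (fi _ _ ef) => [eu|/poly_unit_size s1].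
  exists (e%:P^-1 * k1); rewrite ef mulrA [e%:P * _]mulrC mulrK //.
by move: sf; rewrite ef size_Cmul // s1.
Qed.

(** An irreducible constant is, up to a unit, a prime of [R]. Otherwise division in [Pdiv.Idomain]
    works up to nonzero constants, which are cancelled afterwards: either [f] is coprime to [g], or
    their gcd agrees with [f] up to constants. *)
Lemma rirr_prime_poly f : rirr f -> rprime f.
Proof.
move=> irf; have [f0 fu fi] := irf; split=> // g h dfgh.
have [s1|s1] := leqP (size f) 1.
  have ef := size1_polyC s1; set c := f`_0 in ef.
  have c0 : c != 0 by rewrite -polyC_eq0 -ef.
  have [[|x s] [u [uu ps ec]]] := facR c0.
    case/negP: fu; rewrite ef ec big_nil mulr1 poly_unitE size_polyC coefC /= uu andbT.
    by rewrite (_ : u != 0) //; apply: contraTneq uu => ->; rewrite unitr0.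
  have px := ps x (mem_head _ _); have [x0 xu _] := px.
  rewrite big_cons in ec; set v := \prod_(j <- s) j in ec.
  have evx : f = x%:P * (u * v)%:P by rewrite ef ec -polyCM; congr (_%:P); ring.
  have uvu : (u * v)%:P \is a GRing.unit.
    case: (fi _ _ evx) => //; rewrite poly_unitE => /andP[_]; rewrite coefC /= => xu'.
    by rewrite xu' in xu.
  have dx k : rdvd x%:P k -> rdvd f k.
    move=> [k' ->]; exists ((u * v)%:P^-1 * k'); rewrite evx.
    by rewrite -[in RHS]mulrA [(u * v)%:P * _]mulrA divrr // mul1r.
  have [|/dx|/dx] := @rdvd_polyC_Gauss x g h px; [|by left|by right].
  by case: dfgh => k ->; exists ((u * v)%:P * k); rewrite evx mulrA.
have dp : (f %| g * h)%R by case: dfgh => k ->; apply: Pdiv.Idomain.dvdp_mulr.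
have [cop|ncop] := boolP (Pdiv.Idomain.coprimep f g).
  move: dp; rewrite Pdiv.Idomain.Gauss_dvdpr // => /Pdiv.Idomain.dvdpP[[c k] /= c0 e].
  by right; apply: (rirr_cancel irf s1 c0 (k := k)); rewrite mul_polyC e mulrC.
left; set w := Pdiv.Idomain.gcdp f g in ncop.
have /Pdiv.Idomain.dvdpP[[c k] /= c0 e] : (w %| f)%R by apply: Pdiv.Idomain.dvdp_gcdl.
have /Pdiv.Idomain.dvdpP[[c' k'] /= c0' e'] : (w %| g)%R by apply: Pdiv.Idomain.dvdp_gcdr.
have [|w1 [k1 [e1 [e10 ew ef]]]] := @rdvd_cancel c f w k c0.
  by rewrite mul_polyC e mulrC.
have k1u : k1 \is a GRing.unit.
  case: (fi _ _ ef) => // /poly_unit_size sw1; case/negP: ncop.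
  by rewrite /Pdiv.Idomain.coprimep -/w ew size_Cmul // sw1.
apply: (rirr_cancel irf s1 c0' (k := k1^-1 * e1%:P * k')).
by rewrite mul_polyC e' ew ef -!mulrA [k1 * _]mulrA divrr // mul1r; ring.
Qed.

End PolyOverFactorial.

Section Mpoly.
Variable K : fieldType.

Lemma mpoly_unit_msize n (F : {mpoly K[n]}) : F != 0 -> (F \is a GRing.unit) = (msize F <= 1)%N.
Proof.
move=> F0; apply/idP/idP => [/mulrV e|sF].
  have Fi0 : F^-1 != 0 by apply: contraTneq isT => z; move: e; rewrite z mulr0 => /eqP; rewrite eq_sym oner_eq0.
  have := msizeM F0 Fi0; rewrite e msize1.
  have : (0 < msize F^-1)%N by rewrite lt0n msize_poly_eq0.
  by move: (msize F^-1) (msize F) => [|y] [|[|x]] //; rewrite addnS.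
have e := msize1_polyC sF; apply/unitrP; exists (F@_0%MM)^-1%:MP.
have c0 : F@_0%MM != 0 by rewrite -(mpolyC_eq0 n) -e.
by rewrite {2 3}e -!mpolyCM mulVf // mulfV.
Qed.

Lemma muni_rirr n (F : {mpoly K[n.+1]}) : rirr F -> rirr (muni F).
Proof.
have unitM (P : {poly {mpoly K[n]}}) : P \is a GRing.unit -> unmuni P \is a GRing.unit.
  move/mulrV => e; apply/unitrP; exists (unmuni P^-1).
  by rewrite -!unmuniM mulrC e -(muni1 n K) muniK.
case=> F0 Fu Fi; split.
- by apply: contraNneq F0 => z; rewrite -(muniK F) z -(muni0 n K) muniK.
- by apply: contraNN Fu => /unitM; rewrite muniK.
move=> b c e; have : F = unmuni b * unmuni c by rewrite -unmuniM -e muniK.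
have muniU (G : {mpoly K[n.+1]}) : G \is a GRing.unit -> muni G \is a GRing.unit.
  move/mulrV => e'; apply/unitrP; exists (muni G^-1).
  have h := congr1 (@muni n K) e'; rewrite muniM muni1 in h.
  by split; [rewrite mulrC|]; exact: h.
by case/Fi => /muniU; rewrite unmuniK; [left|right].
Qed.

Lemma mpoly_factorial_of_prime n :
  (forall F : {mpoly K[n]}, rirr F -> rprime F) -> factorial_ring {mpoly K[n]}.
Proof.
move=> H F; have [N] := ubnP (msize F); elim: N F => // N IH F sN F0.
have [Fu|Fu] := boolP (F \is a GRing.unit).
  by exists [::], F; rewrite big_nil mulr1.
have [irF|nirF] := Classical_Prop.classic (rirr F).
  exists [:: F], 1; rewrite big_seq1 mul1r unitr1; split=> // x.
  by rewrite inE => /eqP ->; apply: H.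
have [b [c [e bu cu]]] : exists b c, [/\ F = b * c, b \isn't a GRing.unit & c \isn't a GRing.unit].
  apply: Classical_Prop.NNPP => no; apply: nirF; split=> // b c e.
  have [bu|bu] := boolP (b \is a GRing.unit); [by left|right].
  by apply/negPn/negP => cu; apply: no; exists b, c.
have /andP[b0 c0] : (b != 0) && (c != 0) by rewrite -negb_or -mulf_eq0 -e.
move: bu cu; rewrite !mpoly_unit_msize // -!ltnNge => sb sc.
have sF := msizeM b0 c0; rewrite -e in sF.
have aux x y z : x = (y + z).-1 -> (1 < y -> 1 < z -> x < N.+1 -> (y < N) && (z < N))%N by lia.
have /andP[sbN scN] := aux _ _ _ sF sb sc sN.
have [//|//|sb' [ub [ubu psb eb]]] := IH b.
have [//|//|sc' [uc [ucu psc ec]]] := IH c.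
exists (sb' ++ sc'), (ub * uc); split.
- by rewrite unitrM ubu.
- by move=> x; rewrite mem_cat => /orP[/psb|/psc].
- by rewrite e eb ec big_cat /=; ring.
Qed.

Theorem mpoly_rirr_prime n (F : {mpoly K[n]}) : rirr F -> rprime F.
Proof.
elim: n F => [|n IH] F irF.
  case: irF => F0 /negP[]; rewrite mpoly_unit_msize // (nvar0_mpolyC F) msizeC.
  by case: (_ != 0).
have := rirr_prime_poly (mpoly_factorial_of_prime IH) (muni_rirr irF).
case: irF => F0 Fu _ [_ _ Fp]; split=> // b c [k e].
have [|[k' e']|[k' e']] := Fp (muni b) (muni c).
- exists (muni k); have h := congr1 (@muni n K) e; rewrite !muniM in h; exact: h.
- left; exists (unmuni k'); apply: etrans (esym (muniK b)) (etrans (congr1 (@unmuni n K) e') _).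
  exact: etrans (unmuniM _ _) (congr1 (fun x => x * unmuni k') (muniK F)).
- right; exists (unmuni k'); apply: etrans (esym (muniK c)) (etrans (congr1 (@unmuni n K) e') _).
  exact: etrans (unmuniM _ _) (congr1 (fun x => x * unmuni k') (muniK F)).
Qed.

End Mpoly.
End Factoriality.

(** * Elimination *)

Section DeterminantTools.
Variable K : fieldType.

(** Entry (i, j) has degree at most r_i - c_j, so each product over a permutation has degree at most
    the sum of the r_i minus that of the c_j, whatever the permutation. *)
Lemma size_det_weighted e (M : 'M[{poly K}]_e) (r c : 'I_e -> nat) :
  (forall i j, M i j != 0 -> (size (M i j) + c j <= (r i).+1)%N) ->
  \det M != 0 -> (size (\det M) + \sum_j c j <= (\sum_i r i).+1)%N.
Proof.
move=> h; set B := ((\sum_i r i).+1 - \sum_j c j)%N => D0.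
have hs (s : 'S_e) : \prod_i M i (s i) != 0 ->
    (size (\prod_i M i (s i))%R + \sum_j c j <= (\sum_i r i).+1)%N.
  move=> /prodf_neq0 nz.
  have h1 i : (size (M i (s i)) + c (s i) <= (r i).+1)%N by apply/h/nz.
  have -> : (\sum_j c j = \sum_i c (s i))%N.
    by rewrite (reindex_inj (@perm_inj _ s)).
  have h2 : (\sum_(i < e) (size (M i (s i)) + c (s i)) <= \sum_(i < e) (r i).+1)%N by apply: leq_sum.
  have h3 : (\sum_(i < e) (r i).+1 = \sum_(i < e) r i + e)%N.
    by under eq_bigr => i _ do rewrite -addn1; rewrite big_split /= sum_nat_const card_ord muln1.
  rewrite h3 big_split /= in h2.
  have h4 : (e <= \sum_(i < e) size (M i (s i)))%N.
    rewrite -[X in (X <= _)%N]card_ord -sum1_card; apply: leq_sum => i _.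
    by rewrite size_poly_gt0 nz.
  have h5 : (size (\prod_i M i (s i))%R <= (\sum_(i < e) size (M i (s i))).+1 - e)%N.
    by have := size_poly_prod_leq predT (fun i => M i (s i)); rewrite cardT size_enum_ord.
  have aux a b c' r' : (a <= b.+1 - e -> b + c' <= r' + e -> e <= b -> a + c' <= r'.+1)%N by lia.
  exact: aux h5 h2 h4.
(* A nonzero product shows that the subtraction defining [B] is not truncated. *)
have [s Ts] : exists s : 'S_e, \prod_i M i (s i) != 0.
  apply/existsP; apply: contraNT D0 => /existsPn z; rewrite /determinant big1 // => s _.
  by have /negbNE/eqP -> := z s; rewrite mulr0.
have cr : (\sum_j c j <= \sum_i r i)%N.
  have aux a c' r' : (0 < a -> a + c' <= r'.+1 -> c' <= r')%N by lia.
  by apply: aux (hs s Ts); rewrite size_poly_gt0.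
have leB a : (a <= B)%N = (a + \sum_j c j <= (\sum_i r i).+1)%N.
  by rewrite /B leq_subRL ?(leqW cr) // addnC.
rewrite -leB.
rewrite /determinant; apply: (big_ind (fun P : {poly K} => size P <= B)%N).
- by rewrite size_poly0.
- by move=> x y sx sy; apply: leq_trans (size_polyD _ _) _; rewrite geq_max sx.
move=> s' _; rewrite -signr_odd; have [->|nz] := eqVneq (\prod_i M i (s' i)) 0.
  by rewrite mulr0 size_poly0.
have -> : size ((-1) ^+ odd s' * \prod_i M i (s' i)) = size (\prod_i M i (s' i)).
  by case: (odd _); rewrite ?expr1 ?expr0 ?mulN1r ?size_polyN ?mul1r.
by rewrite leB hs.
Qed.

Lemma det_rows_dvdp e (M : 'M[{poly K}]_e) (g : {poly K}) k :
  (k <= e)%N -> (forall (i : 'I_e) j, (i < k)%N -> g %| M i j) -> g ^+ k %| \det M.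
Proof.
move=> ke h.
have -> : M = diag_mx (\row_i (if (i < k)%N then g else 1)) *m
              (\matrix_(i, j) (if (i < k)%N then M i j %/ g else M i j)).
  apply/matrixP => i j; rewrite mul_diag_mx !mxE; case: ltnP => ik; last by rewrite mul1r.
  by rewrite mulrC divpK ?h.
rewrite det_mulmx det_diag; apply: dvdp_mulr.
under eq_bigr => i _ do rewrite mxE.
rewrite (bigID (fun i : 'I_e => (i < k)%N)) /=; apply: dvdp_mulr.
rewrite (eq_bigr (fun=> g)) => [|i ->//].
by rewrite -(big_ord_widen e (fun=> g) ke) prodr_const card_ord.
Qed.

(** A constant invertible row operation turns the [k] independent relations at [t] into [k] rows
    that vanish at [t]. *)
Lemma det_order_corank e k (M : 'M[{poly K}]_e) t (U : 'M[K]_(k, e)) :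
  row_free U -> U *m map_mx (horner_eval t) M = 0 -> ('X - t%:P) ^+ k %| \det M.
Proof.
move=> /eqP rU UM; pose E := row_ebase U; have Eu : E \in unitmx by apply: row_ebase_unit.
have z : (pid_mx k : 'M_(k, e)) *m E *m map_mx (horner_eval t) M = 0.
  have := UM; rewrite -{1}(mulmx_ebase U) rU -!mulmxA => h.
  by have := congr1 (mulmx (invmx (col_ebase U))) h; rewrite mulKmx ?col_ebase_unit // mulmx0 mulmxA.
have ke : (k <= e)%N by rewrite -rU rank_leq_col.
suff : ('X - t%:P) ^+ k %| \det (map_mx polyC E *m M).
  rewrite det_mulmx det_map_mx /= mul_polyC dvdpZr //.
  by rewrite -unitfE -unitmxE.
apply: det_rows_dvdp => // i j ik; rewrite dvdp_XsubCl; apply/rootP.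
have := congr1 (fun A : 'M_(k, e) => A (Ordinal ik) j) z; rewrite -mulmxA mxE mxE.
rewrite (bigD1 i) //= big1 ?addr0 => [|i' ne]; last first.
  by rewrite mxE /= [_ == val i'](_ : _ = false) ?mul0r //; apply/negbTE; apply: contraNneq ne => ei; apply/eqP/val_inj.
rewrite mxE /= eqxx ik mul1r => <-; rewrite !mxE horner_sum; apply: eq_bigr => i' _.
by rewrite hornerM !mxE hornerC.
Qed.

End DeterminantTools.

Section RootCounting.
Variable K : finFieldType.
Local Notation q := #|K|.

Lemma sum_orders_leq (D : {poly K}) (c : K -> nat) : D != 0 ->
  (forall t, ('X - t%:P) ^+ c t %| D) -> (\sum_t c t <= (size D).-1)%N.
Proof.
move=> D0 h; rewrite -ltnS prednK ?size_poly_gt0 //.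
have H (s : seq K) : uniq s -> \prod_(t <- s) ('X - t%:P) ^+ c t %| D /\
    size (\prod_(t <- s) ('X - t%:P) ^+ c t) = (\sum_(t <- s) c t).+1.
  elim: s => [|t s IH] /=; first by rewrite !big_nil dvd1p size_poly1.
  case/andP=> ts /IH[d1 d2]; rewrite !big_cons; split.
    rewrite Gauss_dvdp ?h //; rewrite big_seq; apply: (big_ind (fun P => coprimep _ P)).
    - exact: coprimep1.
    - by move=> x y cx cy; rewrite coprimepMr cx.
    move=> t' t's; apply: coprimep_expl; apply: coprimep_expr.
    by rewrite coprimep_XsubC root_XsubC; apply: contraNneq ts => <-.
  rewrite size_mul ?size_exp_XsubC ?d2 ?expf_neq0 ?polyXsubC_eq0 //; first by rewrite addSn addnS.
  by rewrite -size_poly_gt0 d2.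
have [d1 d2] := H _ (index_enum_uniq K).
by rewrite -d2; apply: dvdp_leq.
Qed.

Lemma size_dvd_card_poly (P : {poly K}) : P %| 'X^q - 'X ->
  ((size P).-1 <= #|[set t | root P t]|)%N.
Proof.
rewrite finField_genPoly => /dvdp_prod_XsubC[m]; set s := mask m _ => e.
have su : uniq s by apply: mask_uniq; apply: index_enum_uniq.
rewrite (eqp_size e) size_prod_XsubC /= -(card_uniqP su); apply: subset_leq_card.
apply/subsetP => t ts; rewrite inE (eqp_root e) root_prod_XsubC //.
Qed.

(** f / gcd(f, f') is coprime to f' / gcd(f, f'), so it divides X^q - X and splits into distinct
    rational linear factors. *)
Lemma size_gcd_deriv (f : {poly K}) : f != 0 -> f %| ('X^q - 'X) * f^`() ->
  ((size f).-1 <= (size (gcdp f f^`())).-1 + #|[set t | root f t]|)%N.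
Proof.
move=> f0; set w := gcdp f f^`(); set f1 := f %/ w; set g1 := f^`() %/ w => h.
have ef : f = f1 * w by rewrite divpK ?dvdp_gcdl.
have eg : f^`() = g1 * w by rewrite divpK ?dvdp_gcdr.
have w0 : w != 0 by rewrite gcdp_eq0 negb_and f0.
have f10 : f1 != 0 by apply: contraNneq f0 => z; rewrite ef z mul0r.
have : f1 %| 'X^q - 'X.
  have : coprimep f1 g1 by rewrite coprimep_div_gcd // f0.
  move/Gauss_dvdpl <-; rewrite -(dvdp_mul2r _ _ w0) -ef -mulrA -eg //.
move/size_dvd_card_poly => h1.
have h2 : (#|[set t | root f1 t]| <= #|[set t | root f t]|)%N.
  by apply: subset_leq_card; apply/subsetP => t; rewrite !inE ef rootM => ->.
have aux a b c c1 : (a.-1 <= c1 -> c1 <= c -> 0 < a -> 0 < b -> (a + b).-1.-1 <= b.-1 + c)%N by lia.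
have -> : size f = (size f1 + size w).-1 by rewrite -size_mul // -ef.
by apply: aux h1 h2 _ _; rewrite size_poly_gt0.
Qed.

Lemma mderiv0_pth_power n p (F : {mpoly K[n]}) : p \in [pchar K] ->
  (forall i, F^`M(i) = 0) -> exists H, F = H ^+ p.
Proof.
move=> pK F0; have pp := pcharf_prime pK.
have dv m i : m \in msupp F -> (p %| m i)%N.
  move=> mF; have [->|mi] := posnP (m i); first exact: dvdn0.
  have := mcoeff_mderiv i F (m - U_(i))%MM; rewrite F0 mcoeff0 submK; last first.
    by apply/mnm_lepP => j; rewrite mnm1E; case: eqP => // <-.
  rewrite mnmBE mnm1E eqxx subn1 prednK // => /esym/eqP.
  rewrite -mulr_natr mulf_eq0 -(dvdn_pcharf pK) => /orP[|//].
  by rewrite mcoeff_eq0 mF.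
(* Since c^q = c, the power c^(q/p) is a p-th root of the coefficient c. *)
exists (\sum_(m <- msupp F) (F@_m) ^+ (q %/ p) *: 'X_[[multinom (m i %/ p)%N | i < n]]).
have pM := pchar_mpolyP n pK.
have expD : {morph (fun x : {mpoly K[n]} => x ^+ p) : x y / x + y}.
  by move=> x y; apply: exprDn_pchar; rewrite pnatE.
rewrite {1}(mpolyE F) (big_morph _ expD (id1 := 0)) ?expr0n ?gtn_eqF ?prime_gt0 //.
rewrite !big_seq; apply: eq_bigr => m mF.
rewrite exprZn -exprM divnK ?pchar_dvd_card // expf_card mpolyXn; congr (_ *: 'X_[_]).
by apply/mnmP => i; rewrite mulmnE mnmE divnK ?dv.
Qed.

End RootCounting.

(** * Dehomogenised plane curves and Sylvester matrices *)

Section Bezout.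
Variable K : finFieldType.
Local Notation q := #|K|.

Definition o0 : 'I_3 := ord0.
Definition o1 : 'I_3 := lift ord0 ord0.
Definition o2 : 'I_3 := lift ord0 (lift ord0 ord0).

(* Dehomogenisation [C (1, x, y)], as a polynomial in [y] over [K[x]]. *)
Definition psi (C : {mpoly K[3]}) : {poly {poly K}} :=
  mmap (polyC \o @polyC K) (fun i : 'I_3 => [:: 1; 'X%:P; 'X]`_i) C.
HB.instance Definition _ :=
  GRing.RMorphism.copy psi (mmap (polyC \o @polyC K) (fun i : 'I_3 => [:: 1; 'X%:P; 'X]`_i)).

Lemma psiC c : psi c%:MP = c%:P%:P. Proof. exact: mmapC. Qed.
Lemma psiX i : psi 'X_i = [:: 1; 'X%:P; 'X]`_i. Proof. by rewrite /psi mmapX mmap1U. Qed.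

Lemma mdeg3 (m : 'X_{1..3}) : mdeg m = (m o0 + m o1 + m o2)%N.
Proof. by rewrite mdegE !big_ord_recl big_ord0 addn0 addnA. Qed.

Lemma psi_coef C i j :
  (psi C)`_j`_i = \sum_(m <- msupp C) C@_m * ((m o1 == i) && (m o2 == j))%:R.
Proof.
rewrite (rmorph_mpolyE psi) !coef_sum; apply: eq_bigr => m _ /=.
rewrite psiC !big_ord_recl big_ord0 !psiX /= expr1n mul1r mulr1 -rmorphXn /=.
rewrite !coefCM coefXn mulr_natr coefMn coefXn -mulrnA mulnb.
by rewrite [i == _]eq_sym [j == _]eq_sym.
Qed.

Lemma psi_coef_gt d C i j : C \is d.-homog -> (d < i + j)%N -> (psi C)`_j`_i = 0.
Proof.
move=> hC dij; rewrite psi_coef big_seq big1 // => m mC.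
case: (m o1 =P i) => [e1|_] /=; last by rewrite mulr0.
case: (m o2 =P j) => [e2|_] /=; last by rewrite mulr0.
by have := dhomog_mdeg hC mC; rewrite mdeg3 e1 e2; lia.
Qed.

Lemma size_psi_coef d C j : C \is d.-homog -> (size ((psi C)`_j)%R <= (d - j).+1)%N.
Proof.
by move=> hC; apply/leq_sizeP => i ij; apply: (psi_coef_gt hC); lia.
Qed.

Lemma psi_coef0 d C j : C \is d.-homog -> (d < j)%N -> (psi C)`_j = 0.
Proof.
by move=> hC dj; apply/polyP => i; rewrite coef0; apply: (psi_coef_gt hC); lia.
Qed.

Lemma psi_homog_inj D U : U \is D.-homog -> psi U = 0 -> U = 0.
Proof.
move=> hU U0; apply/mpolyP => m; rewrite mcoeff0; apply/eqP; apply: contraTT isT => nz.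
have mU : m \in msupp U by rewrite mcoeff_msupp.
case/negP: nz; have := psi_coef U (m o1) (m o2); rewrite U0 !coef0.
rewrite (bigD1_seq m) ?msupp_uniq //= !eqxx mulr1 big_seq_cond big1 ?addr0 => [<- //|m'].
case/andP=> m'U ne; case: (_ =P _) => [e1|_] /=; last by rewrite mulr0.
case: (_ =P _) => [e2|_] /=; last by rewrite mulr0.
case/eqP: ne; apply/mnmP => i.
have := dhomog_mdeg hU mU; rewrite -(dhomog_mdeg hU m'U) !mdeg3 e1 e2 => e.
have e0 : m' o0 = m o0 by lia.
case: (unliftP ord0 i) => [i' ->|->//]; case: (unliftP ord0 i') => [i2 ->|->//].
by case: (unliftP ord0 i2) => [[] //|->].
Qed.

(** Powers of x_0 pad the homogenisation to any large degree, so that two polynomials can be lifted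
    with compatible degrees in [syl_det_neq0]. *)
Lemma psi_lift u : exists D0, forall D, (D0 <= D)%N -> exists2 U, U \is D.-homog & psi U = u.
Proof.
have X1 i : 'X_i \is [in K[3], 1.-homog] by rewrite dhomogX /= mdeg1.
have Xn D : 'X_o0 ^+ D \is [in K[3], D.-homog].
  by rewrite -[X in X.-homog]mul1n; apply: dhomogMn.
have liftC (c : {poly K}) : exists D0, forall D, (D0 <= D)%N ->
    exists2 U, U \is D.-homog & psi U = c%:P.
  elim/poly_ind: c => [|c a [D0 IH]].
    by exists 0%N => D _; exists 0; rewrite ?rmorph0 ?polyC0 // dhomog0.
  exists D0.+1 => D hD; have [|U hU eU] := IH D.-1; first by lia.
  exists (U * 'X_o1 + a *: 'X_o0 ^+ D).
    apply: dhomogD; last by apply: dhomogZ.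
    by have := dhomogM hU (X1 o1); rewrite addn1 prednK //; lia.
  rewrite rmorphD rmorphM /= eU psiX -mul_mpolyC rmorphM rmorphXn /= psiC psiX /=.
  by rewrite expr1n mulr1 polyCD polyCM.
elim/poly_ind: u => [|u c [D0 IH]].
  by exists 0%N => D _; exists 0; rewrite ?rmorph0 // dhomog0.
have [D1 H1] := liftC c; exists (maxn D0.+1 D1) => D; rewrite geq_max => /andP[hD hD1].
have [|U hU eU] := IH D.-1; first by lia.
have [V hV eV] := H1 D hD1; exists (U * 'X_o2 + V).
  apply: dhomogD => //.
  by have := dhomogM hU (X1 o2); rewrite addn1 prednK //; lia.
by rewrite rmorphD rmorphM /= eU eV psiX.
Qed.

Lemma psi_deriv C : (psi C)^`() = psi C^`M(o2).
Proof.
rewrite (mpoly_chain_rule (f := psi) (D := deriv)) => [|x y|c]; last 2 first.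
- exact: derivM.
- by rewrite /= psiC derivC.
rewrite !big_ord_recl big_ord0 /= !psiX /= derivX derivC -[1]/(1%:P) derivC.
by rewrite !mulr0 !add0r mulr1 addr0.
Qed.

Definition e_ (i : 'I_3) : 'rV[K]_3 := delta_mx 0 i.

(** Setting x = t restricts [C] to a line of the pencil through [e_ o2], the point at infinity of
    each of these lines. *)
Lemma psi_horner C t : map_poly (horner_eval t) (psi C) = lp (e_ o0 + t *: e_ o1) (e_ o2) C.
Proof.
pose f : {rmorphism {mpoly K[3]} -> {poly K}} := map_poly (horner_eval t) \o psi.
suff : f =1 lp (e_ o0 + t *: e_ o1) (e_ o2) by apply.
apply: mpoly_rmorph_ext => [c|i] /=.
  by rewrite psiC lpC map_polyC /= /horner_eval hornerC.
rewrite psiX lpX !mxE /=; case: (unliftP ord0 i) => [i' ->|->] /=; last first.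
  by rewrite rmorph1 mulr0 addr0 scale0r addr0.
case: (unliftP ord0 i') => [i2 ->|->] /=; last first.
  by rewrite map_polyC /= /horner_eval hornerX add0r mulr1 scale0r addr0.
case: (unliftP ord0 i2) => [[] //|->] /=.
by rewrite map_polyX mulr0 addr0 add0r scale1r.
Qed.

Lemma psi_top d C : C \is d.-homog -> (psi C)`_d = (ev C (e_ o2))%:P.
Proof.
move=> hC; have s1 : (size ((psi C)`_d)%R <= 1)%N by have := size_psi_coef d hC; rewrite subnn.
rewrite (size1_polyC s1); congr (_%:P).
have := psi_horner C 0; rewrite scale0r addr0 => /(congr1 (fun P : {poly K} => P`_d)).
by rewrite (lp_top _ _ hC).2 coef_map /= /horner_eval horner_coef0.
Qed.

Section Sylvester.
Variables (d : nat) (R : comNzRingType) (f g : {poly R}).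

(** The formal degrees are d and d - 1. The degree of a derivative may be smaller in characteristic
    p, and with formal degrees setting x = t still commutes with the construction. *)
Definition syl_row (i : 'I_(d.-1 + d)) : {poly R} :=
  match split i with inl i' => f * 'X^i' | inr i' => g * 'X^i' end.
Definition syl : 'M[R]_(d.-1 + d) := \matrix_(i, j) (syl_row i)`_j.

Hypothesis d0 : (0 < d)%N.
Hypothesis sf : (size f <= d.+1)%N.
Hypothesis sg : (size g <= d)%N.

Lemma size_syl_row i : (size (syl_row i) <= d.-1 + d)%N.
Proof.
rewrite /syl_row; case: splitP => j ej; apply: leq_trans (size_polyMleq _ _) _;
  rewrite size_polyXn; have := ltn_ord j; move: sf sg; lia.
Qed.

Lemma syl_mul (c : 'rV[R]_(d.-1 + d)) j : (c *m syl) 0 j =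
  ((\sum_(i < d.-1) c 0 (lshift d i) *: 'X^i) * f +
   (\sum_(i < d) c 0 (rshift d.-1 i) *: 'X^i) * g)`_j.
Proof.
rewrite mxE; transitivity (\sum_i (c 0 i *: syl_row i)`_j).
  by apply: eq_bigr => i _; rewrite mxE coefZ.
rewrite -coef_sum big_split_ord /= !mulr_suml; congr ((_ : {poly R})`_j); congr (_ + _); apply: eq_bigr => i _.
  by rewrite /syl_row (unsplitK (inl i)) -scalerAl mulrC.
by rewrite /syl_row (unsplitK (inr i)) -scalerAl mulrC.
Qed.

Lemma syl_mul_eq0 (c : 'rV[R]_(d.-1 + d)) : c *m syl = 0 <->
  (\sum_(i < d.-1) c 0 (lshift d i) *: 'X^i) * f +
  (\sum_(i < d) c 0 (rshift d.-1 i) *: 'X^i) * g = 0.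
Proof.
split=> [z|z]; last by apply/rowP => j; rewrite syl_mul z coef0 mxE.
apply/polyP => j; rewrite coef0; have [jl|jl] := ltnP j (d.-1 + d).
  by have := syl_mul c (Ordinal jl); rewrite z mxE.
rewrite !mulr_suml coefD !coef_sum !big1 ?addr0 // => i _.
  rewrite -scalerAl coefZ nth_default ?mulr0 //; apply: leq_trans jl.
  by have := size_syl_row (rshift d.-1 i); rewrite /syl_row (unsplitK (inr i)) mulrC.
rewrite -scalerAl coefZ nth_default ?mulr0 //; apply: leq_trans jl.
by have := size_syl_row (lshift d i); rewrite /syl_row (unsplitK (inl i)) mulrC.
Qed.

End Sylvester.

Lemma sum_polyXn (R : nzRingType) e (P : {poly R}) : (size P <= e)%N -> \sum_(i < e) P`_i *: 'X^i = P.
Proof.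
move=> sP; rewrite -poly_def; apply/polyP => i; rewrite coef_poly; case: ltnP => // ei.
by rewrite nth_default // (leq_trans sP).
Qed.

Lemma coef_sumXn (R : nzRingType) e (c : 'I_e -> R) (i : 'I_e) : (\sum_(j < e) c j *: 'X^j)`_i = c i.
Proof.
rewrite coef_sum (bigD1 i) //= coefZ coefXn eqxx mulr1 big1 ?addr0 // => j nj.
by rewrite coefZ coefXn eq_sym [_ == _](negPf nj) mulr0.
Qed.

Lemma size_sumXn (R : nzRingType) e (c : 'I_e -> R) : (size (\sum_(j < e) c j *: 'X^j)%R <= e)%N.
Proof.
apply/leq_sizeP => i ei; rewrite coef_sum big1 // => j _; rewrite coefZ coefXn gtn_eqF ?mulr0 //.
exact: leq_trans (ltn_ord j) ei.
Qed.

Lemma map_syl (R S : comNzRingType) (h : {rmorphism R -> S}) d (f g : {poly R}) :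
  map_mx h (syl d f g) = syl d (map_poly h f) (map_poly h g).
Proof.
apply/matrixP => i j; rewrite !mxE -coef_map; congr (_`_j); rewrite /syl_row.
by case: splitP => k _; rewrite rmorphM /= map_polyXn.
Qed.

Lemma syl_corank d (f : {poly K}) : (0 < d)%N -> size f = d.+1 ->
  exists U : 'M[K]_((size (gcdp f f^`())).-1, d.-1 + d),
    row_free U /\ U *m syl d f f^`() = 0.
Proof.
move=> d0 sf; set w := gcdp f f^`(); set c := (size w).-1.
set f1 := f %/ w; set g1 := f^`() %/ w.
have f0 : f != 0 by rewrite -size_poly_gt0 sf.
have sf' : (size f^`() <= d)%N by rewrite -ltnS -sf lt_size_deriv.
have ef : f = f1 * w by rewrite divpK ?dvdp_gcdl.
have eg : f^`() = g1 * w by rewrite divpK ?dvdp_gcdr.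
have w0 : w != 0 by rewrite gcdp_eq0 negb_and f0.
have f10 : f1 != 0 by apply: contraNneq f0 => z; rewrite ef z mul0r.
have sw : size w = c.+1 by rewrite (polySpred w0).
have sf1 : (size f1 + c = d.+1)%N by have := size_mul f10 w0; rewrite -ef sf sw addnS /= => ->.
have sg1 : (size g1 + c <= d)%N.
  have [g0|g0] := eqVneq g1 0; last by have := size_mul g0 w0; rewrite -eg sw addnS /= => <-.
  rewrite g0 size_poly0 add0n; have : (0 < size f1)%N by rewrite size_poly_gt0.
  by move: sf1; lia.
(* The rows are the syzygies (g1 X^k) f - (f1 X^k) f' = 0 for k < deg w; they are independent
   because f1 is nonzero. *)
pose U : 'M[K]_(c, d.-1 + d) :=
  \matrix_(k, i) (match split i with inl i' => g1 * 'X^k | inr i' => - (f1 * 'X^k) end)`_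
                 (match split i with inl i' => i' : nat | inr i' => i' end).
have Ul k i : U k (lshift d i) = (g1 * 'X^k)`_i by rewrite mxE (unsplitK (inl i)).
have Ur k i : U k (rshift d.-1 i) = (- (f1 * 'X^k))`_i by rewrite mxE (unsplitK (inr i)).
have sX (P : {poly K}) (k : nat) e : (size P + k <= e)%N -> (size (P * 'X^k)%R <= e)%N.
  by move=> h; apply: leq_trans (size_polyMleq _ _) _; rewrite size_polyXn addnS.
exists U; split; last first.
  apply/row_matrixP => k; rewrite row_mul row0; apply/syl_mul_eq0; rewrite ?sf //.
  under eq_bigr => i _ do rewrite mxE Ul.
  under [X in _ + X * _]eq_bigr => i _ do rewrite mxE Ur.
  rewrite !sum_polyXn; first by rewrite eg ef; ring.
    by rewrite size_polyN sX // -ltnS -sf1 ltn_add2l.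
  rewrite sX // -ltnS prednK //; apply: leq_trans sg1; by rewrite ltn_add2l.
rewrite -kermx_eq0; apply/eqP/row_matrixP => k; rewrite row0.
set x := row k _; have xU : x *m U = 0 by rewrite /x -row_mul mulmx_ker row0.
apply/rowP => j; rewrite [RHS]mxE.
pose P := \sum_(i < c) x 0 i *: 'X^i.
suff P0 : P = 0 by rewrite -(coef_sumXn (x 0) j) -/P P0 coef0.
have : P * f1 = 0.
  apply/polyP => i; rewrite coef0 /P mulr_suml coef_sum; have [il|il] := ltnP i d.
    have : (x *m U) 0 (rshift d.-1 (Ordinal il)) = 0 by rewrite xU mxE.
    rewrite mxE => h; apply: etrans (_ : - (\sum_i x 0 i * U i (rshift d.-1 (Ordinal il))) = 0).
      rewrite -sumrN; apply: eq_bigr => i' _.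
          by rewrite Ur coefN mulrN opprK -scalerAl coefZ [f1 * _]mulrC.
    by rewrite h oppr0.
  apply: big1 => i' _; rewrite -scalerAl coefZ mulrC nth_default ?mul0r //.
  by rewrite mulrC; apply: leq_trans il; apply: sX; rewrite -ltnS -sf1 ltn_add2l.
by move/eqP; rewrite mulf_eq0 (negPf f10) orbF => /eqP.
Qed.

End Bezout.

Section BezoutBound.
Variable K : finFieldType.
Local Notation q := #|K|.
Local Notation e_ := (@e_ K).
Implicit Types C G : {mpoly K[3]}.

Lemma size_lp d n (a b : 'rV[K]_n) (F : {mpoly K[n]}) : F \is d.-homog -> ev F b != 0 ->
  size (lp a b F) = d.+1.
Proof.
move=> hF Fb; have [s1 s2] := lp_top a b hF; apply/eqP; rewrite eqn_leq s1 ltnNge.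
by apply: contraNN Fb => /leq_sizeP /(_ d (leqnn _)); rewrite s2 => ->.
Qed.

Lemma size_psi d C : C \is d.-homog -> ev C (e_ o2) != 0 -> size (psi C) = d.+1.
Proof.
move=> hC C2; apply/eqP; rewrite eqn_leq; apply/andP; split.
  by apply/leq_sizeP => j dj; apply: psi_coef0 hC _.
rewrite ltnNge; apply: contraNN C2 => /leq_sizeP /(_ d (leqnn _)).
by rewrite (psi_top hC) => /eqP; rewrite polyC_eq0.
Qed.

Lemma not_mdvd_small n d e (A B : {mpoly K[n]}) : A \is d.-homog -> B \is e.-homog ->
  B != 0 -> (e < d)%N -> ~ mdvd A B.
Proof.
move=> hA hB B0 ed [H eH]; rewrite eH in B0 hB.
have [f [le hA' _]] := dhomog_factor B0 hB.
have A0 : A != 0 by apply: contraNneq B0 => ->; rewrite mul0r.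
have := dhomog_uniq A0 hA hA'; move: ed le; lia.
Qed.

(** A vanishing determinant yields u f + v f' = 0 with v of degree below d. After homogenisation [C]
    divides V C_y, hence V, since it is prime of larger degree than C_y; so f, of degree d, divides
    v. *)
Lemma syl_det_neq0 d C : rprime C -> C \is d.-homog -> (0 < d)%N ->
  ev C (e_ o2) != 0 -> C^`M(o2) != 0 -> \det (syl d (psi C) (psi C)^`()) != 0.
Proof.
move=> [C0 Cu Cp] hC d0 C2 dC; have sf := size_psi hC C2; set f := psi C in sf *.
have f0 : f != 0 by rewrite -size_poly_gt0 sf.
have sf' : (size f^`() <= d)%N by rewrite -ltnS -sf lt_size_deriv.
have sf1 : (size f <= d.+1)%N by rewrite sf.
apply/negP => /det0P[c c0 /(syl_mul_eq0 d0 sf1 sf')]; set u := \sum_i _ *: _; set v := \sum_i _ *: _ => e.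
have v0 : v != 0.
  apply: contraNneq c0 => v0; move: e; rewrite v0 mul0r addr0 => /eqP.
  rewrite mulf_eq0 (negPf f0) orbF => /eqP u0; apply/eqP/rowP => i; rewrite mxE.
  rewrite -(splitK i); case: (split i) => j /=.
    by rewrite -(coef_sumXn (fun i => c 0 (lshift d i)) j) -/u u0 coef0.
  by rewrite -(coef_sumXn (fun i => c 0 (rshift d.-1 i)) j) -/v v0 coef0.
have [D0 hu] := psi_lift u; have [D1 hv] := psi_lift v.
(* V gets one degree more than U, because the derivative has one degree less than [C]. *)
have [U hU eU] := hu (D0 + D1)%N (leq_addr _ _).
have [V hV eV] := hv (D0 + D1).+1 (leqW (leq_addl _ _)).
have z : U * C + V * C^`M(o2) = 0.
  apply: (psi_homog_inj (D := D0 + D1 + d)).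
    apply: dhomogD; first exact: dhomogM.
    by have := dhomogM hV (dhomog_mderiv o2 hC); rewrite addSnnS prednK.
  by rewrite rmorphD !rmorphM /= eU eV -psi_deriv -/f.
have : rdvd C (V * C^`M(o2)).
  by exists (- U); rewrite mulrN [C * U]mulrC; apply/eqP; rewrite -addr_eq0 addrC z.
case/Cp => [[W eW]|dv]; last first.
  apply: (not_mdvd_small hC (dhomog_mderiv o2 hC) dC _ dv); by rewrite prednK.
have evf : v = f * psi W by rewrite -eV eW rmorphM.
have W0 : psi W != 0 by apply: contraNneq v0 => z'; rewrite evf z' mulr0.
have : (size v <= d)%N by apply: size_sumXn.
rewrite evf size_mul // sf addSn /=; have : (0 < size (psi W))%N by rewrite size_poly_gt0.
by move: (size (psi W)) => x; clear; lia.
Qed.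

Lemma size_syl_det d C : C \is d.-homog -> (0 < d)%N -> \det (syl d (psi C) (psi C)^`()) != 0 ->
  (size (\det (syl d (psi C) (psi C)^`())) <= (d * d.-1).+1)%N.
Proof.
move=> hC d0 D0; set S := syl _ _ _ in D0 *.
(* Entry (i, j) is the coefficient of y^(j - i') in f or f', of degree at most r i - j; the sum of r
   exceeds that of the column indices by d (d - 1). *)
pose r (i : 'I_(d.-1 + d)) := match split i with inl i' => (d + i')%N | inr i' => (d.-1 + i')%N end.
have H i j : S i j != 0 -> (size (S i j) + j <= (r i).+1)%N.
  rewrite mxE /syl_row /r; case: splitP => i' ei; rewrite coefMXn; case: ltnP => [|ij]; rewrite ?eqxx //.
    set k := (j - i')%N; have [kd|kd] := leqP k d; last by rewrite (psi_coef0 hC) // eqxx.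
    move=> _; have := size_psi_coef k hC; rewrite /k in kd *; move: (size _) ij kd => x; lia.
  set k := (j - i')%N; rewrite psi_deriv; have hC' := dhomog_mderiv o2 hC.
  have [kd|kd] := leqP k d.-1; last by rewrite (psi_coef0 hC') // eqxx.
  move=> _; have := size_psi_coef k hC'; rewrite /k in kd *; move: (size _) ij kd => x; lia.
have := size_det_weighted H D0; rewrite !big_split_ord /=.
have -> : (\sum_(i < d.-1) r (lshift d i) = d * d.-1 + \sum_(i < d.-1) i)%N.
  rewrite mulnC -[X in (X * d)%N]card_ord -sum_nat_const -big_split; apply: eq_bigr => i _.
  by rewrite /r (unsplitK (inl i)).
have -> : (\sum_(i < d) r (rshift d.-1 i) = \sum_(i < d) (d.-1 + i))%N.
  by apply: eq_bigr => i _; rewrite /r (unsplitK (inr i)).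
by rewrite -addnA -addSn leq_add2r.
Qed.

Definition nzeros n (F : {mpoly K[n]}) (a b : 'rV[K]_n) : nat :=
  #|[set y : K | ev F (a + y *: b) == 0]|.

(* Over [x = t], the corank of the Sylvester matrix of [f] and [f'] is at least the degree of
   [gcd (f, f')], which by [f | (X^q - X) f'] is at least [d] minus the number of rational roots;
   so the determinant, of degree at most [d (d - 1)], vanishes at [t] to that order. *)
Lemma bezout_coord d C G : rprime C -> C \is d.-homog -> (0 < d)%N -> frob C = C * G ->
  ev C (e_ o2) != 0 -> C^`M(o2) != 0 ->
  (\sum_(t : K) (d - nzeros C (e_ o0 + t *: e_ o1)%R (e_ o2)) <= d * d.-1)%N.
Proof.
move=> pC hC d0 CG C2 dC; have D0 := syl_det_neq0 pC hC d0 C2 dC.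
set S := syl _ _ _ in D0; have sD := size_syl_det hC d0 D0.
pose ft t := lp (e_ o0 + t *: e_ o1) (e_ o2) C.
have sft t : size (ft t) = d.+1 by apply: size_lp.
pose c t := (size (gcdp (ft t) (ft t)^`())).-1.
have ord t : ('X - t%:P) ^+ c t %| \det S.
  have [U [Uf US]] := syl_corank d0 (sft t).
  apply: (det_order_corank Uf); rewrite map_syl -[map_poly _ (psi C)^`()]deriv_map.
  by rewrite [map_poly _ (psi C)]psi_horner.
apply: leq_trans (_ : (\sum_t c t <= _)%N); last first.
  by apply: leq_trans (sum_orders_leq D0 ord) _; rewrite -ltnS prednK ?size_poly_gt0.
apply: leq_sum => t _; rewrite leq_subLR addnC.
have f0 : ft t != 0 by rewrite -size_poly_gt0 sft.
have := size_gcd_deriv f0 (line_divides (e_ o0 + t *: e_ o1) (e_ o2) hC CG).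
rewrite sft /=; suff -> : [set y | root (ft t) y] = [set y | ev C (e_ o0 + t *: e_ o1 + y *: e_ o2) == 0] by [].
by apply/setP => y; rewrite !inE rootE horner_lp.
Qed.

Lemma rprime_lsub n (B : 'M[K]_n) (C : {mpoly K[n]}) : B \in unitmx -> rprime C -> rprime (lsub B C).
Proof.
move=> Bu [C0 Cu Cp].
have LK : cancel (@lsub K n n B) (lsub (invmx B)).
  by move=> F; rewrite lsub_comp mulVmx // lsub1.
have LK' : cancel (@lsub K n n (invmx B)) (lsub B).
  by move=> F; rewrite lsub_comp mulmxV // lsub1.
split.
- by apply: contraNneq C0 => z; rewrite -[C]LK z rmorph0.
- by apply: contraNN Cu => /(rmorph_unit (lsub (invmx B))); rewrite /= LK.
move=> F G [k e]; case: (Cp (lsub (invmx B) F) (lsub (invmx B) G)).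
- by exists (lsub (invmx B) k); rewrite -rmorphM e rmorphM /= LK.
- by move=> [k' ek]; left; exists (lsub B k'); rewrite -[F]LK' ek rmorphM.
- by move=> [k' ek]; right; exists (lsub B k'); rewrite -[G]LK' ek rmorphM.
Qed.

Lemma bezout_bound d C G (B : 'M[K]_3) : B \in unitmx -> rprime C -> C \is d.-homog ->
  (0 < d)%N -> frob C = C * G -> ev C (row o2 B) != 0 -> mder (row o2 B) C != 0 ->
  (\sum_(t : K) (d - nzeros C (row o0 B + t *: row o1 B)%R (row o2 B))
    <= d * d.-1)%N.
Proof.
move=> Bu pC hC d0 CG C2 dC.
have eB i : e_ i *m B = row i B by rewrite -rowE.
have dC' : lsub B (mder (row o2 B) C) != 0.
  apply: contraNneq dC => z; have := congr1 (lsub (invmx B)) z.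
  by rewrite lsub_comp mulVmx // lsub1 rmorph0 => ->.
have := @bezout_coord d (lsub B C) (lsub B G) (rprime_lsub Bu pC) (lsub_homog B hC) d0.
rewrite frob_lsub CG rmorphM ev_lsub eB mderiv_lsub => /(_ erefl C2 dC').
congr (_ <= _)%N; apply: eq_bigr => t _; congr (_ - _)%N; congr (#|pred_of_set _|).
by apply/setP => y; rewrite !inE ev_lsub !mulmxDl -!scalemxAl !eB.
Qed.

End BezoutBound.

(** * Counting in the projective plane *)

Section ProjectivePlane.
Variable K : finFieldType.
Local Notation q := #|K|.
Local Notation vec := 'rV[K]_3.

Lemma indep_row_free n (a b : 'rV[K]_n) : indep a b -> row_free (col_mx a b).
Proof.
move=> iab; rewrite -kermx_eq0; apply/eqP/row_matrixP => k; rewrite row0.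
set x := row k _; have : x *m col_mx a b = 0 by rewrite /x -row_mul mulmx_ker row0.
rewrite -[x]hsubmxK mul_row_col [lsubmx x]mx11_scalar [rsubmx x]mx11_scalar !mul_scalar_mx.
by case/iab => -> ->; rewrite !raddf0 row_mx0.
Qed.

Lemma span_line (l a b v : vec) : l != 0 -> indep a b -> dot l a = 0 -> dot l b = 0 ->
  dot l v = 0 -> exists c1 c2, v = c1 *: a + c2 *: b.
Proof.
move=> l0 iab la lb lv; have fab := indep_row_free iab.
have ker (w : vec) : dot l w = 0 -> (w <= kermx l^T)%MS.
  by move=> lw; apply/sub_kermxP/rowP => i; rewrite ord1 -dot_mx lw mxE.
have rk : \rank (kermx l^T) = 2%N.
  by rewrite mxrank_ker mxrank_tr rank_rV l0.
have sub : (col_mx a b <= kermx l^T)%MS by rewrite col_mx_sub !ker.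
have /eqmxP e : (col_mx a b == kermx l^T)%MS.
  by rewrite -(geq_leqif (mxrank_leqif_eq sub)) rk (eqP fab).
have : (v <= col_mx a b)%MS by rewrite e ker.
case/submxP=> u ->; rewrite -[u]hsubmxK mul_row_col.
by rewrite [lsubmx u]mx11_scalar [rsubmx u]mx11_scalar !mul_scalar_mx; eexists; eexists.
Qed.

Lemma ker_line (a b : vec) : indep a b -> exists2 l, l != 0 & forall l' : vec,
  (dot l' a = 0 /\ dot l' b = 0) <-> exists c, l' = c *: l.
Proof.
move=> iab; have fab := indep_row_free iab; set M := (col_mx a b)^T.
have rk : \rank (kermx M) = 1%N.
  by rewrite mxrank_ker /M mxrank_tr (eqP fab).
have ker (w : vec) : (w <= kermx M)%MS <-> dot w a = 0 /\ dot w b = 0.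
  rewrite /M tr_col_mx; split=> [/sub_kermxP|[wa wb]]; last apply/sub_kermxP.
    rewrite mul_mx_row => /eqP; rewrite row_mx_eq0 => /andP[/eqP za /eqP zb].
    by rewrite !(dotC w) !dot_mx za zb !mxE.
  rewrite mul_mx_row; apply/eqP; rewrite row_mx_eq0; apply/andP.
  by split; apply/eqP/rowP => i; rewrite ord1 -dot_mx mxE dotC.
pose l := nz_row (kermx M); have l0 : l != 0.
  by rewrite nz_row_eq0 -mxrank_eq0 rk.
have lM : (l <= kermx M)%MS by apply: nz_row_sub.
have /eqmxP e : (l == kermx M)%MS.
  by rewrite -(geq_leqif (mxrank_leqif_eq lM)) rk rank_rV l0.
exists l => // l'; rewrite -ker -e; split=> [/sub_rVP[c ->]|[c ->]]; first by exists c.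
exact: scalemx_sub.
Qed.

Lemma indepPn n (a b : 'rV[K]_n) : b != 0 -> (forall c, a != c *: b) -> indep a b.
Proof.
move=> b0 h c1 c2 e; have c10 : c1 = 0.
  apply: contraTeq isT => c10; have /eqP[] := h (- (c2 / c1)).
  apply: (scalerI c10); rewrite scalerA mulrN mulrCA divff // mulr1 scaleNr.
  by apply/eqP; rewrite -addr_eq0 e.
move: e; rewrite c10 scale0r add0r => /eqP; rewrite scaler_eq0 (negPf b0) orbF => /eqP.
by [].
Qed.

Lemma indep_sym n (a b : 'rV[K]_n) : indep a b -> indep b a.
Proof. by move=> i c1 c2; rewrite addrC => /i[]. Qed.

Lemma indep_neqZ n (a b : 'rV[K]_n) c : indep a b -> a != c *: b.
Proof.
move=> i; apply/eqP => e; have [] := i 1 (- c); first by rewrite scale1r e scaleNr subrr.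
by move/eqP; rewrite oner_eq0.
Qed.

Lemma indep_neq0l n (a b : 'rV[K]_n) : indep a b -> a != 0.
Proof. by move=> i; have := indep_neqZ 0 i; rewrite scale0r. Qed.

Lemma indep_neq0r n (a b : 'rV[K]_n) : indep a b -> b != 0.
Proof. by move/indep_sym/indep_neq0l. Qed.

Lemma indep_addZ n (a b : 'rV[K]_n) t : indep a b -> a + t *: b != 0.
Proof. by move=> i; apply/eqP => e; have := indep_neqZ (- t) i; rewrite scaleNr -addr_eq0 e eqxx. Qed.

Lemma kernel_partner n (l b : 'rV[K]_n) : (2 < n)%N -> b != 0 -> exists2 a, indep a b & dot l a = 0.
Proof.
move=> n3 b0; have [a1 [a2 [i12 l1 l2]]] := kernel_indep l n3.
have [/existsP[c /eqP e]|/existsPn h] := boolP [exists c, a1 == c *: b]; last first.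
  by exists a1 => //; apply: indepPn.
exists a2 => //; apply: indepPn => // c'; apply/eqP => e'.
have c0 : c != 0 by apply: contraNneq (indep_neq0l i12) => z; rewrite e z scale0r.
have := indep_neqZ (c' / c) (indep_sym i12); rewrite e e' scalerA divfK ?eqxx //.
Qed.

Lemma line_partner (l b : vec) : b != 0 -> exists2 a, indep a b & dot l a = 0.
Proof. exact: kernel_partner. Qed.

(** [pick] depends only on the support of [v], which a nonzero scalar does not change; so
    proportional vectors get the same representative. *)
Definition nrm (v : vec) : vec := if [pick i | v 0 i != 0] is Some i then (v 0 i)^-1 *: v else 0.

Lemma nrmP v : v != 0 -> exists2 c, c != 0 & nrm v = c *: v.
Proof.
rewrite /nrm; case: pickP => [i vi _|h /row_neq0P[i]]; last by rewrite h.
by exists (v 0 i)^-1; rewrite ?invr_eq0.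
Qed.

Lemma nrmZ c v : c != 0 -> nrm (c *: v) = nrm v.
Proof.
move=> c0; rewrite /nrm (eq_pick (Q := fun i => v 0 i != 0)) => [|i]; last first.
  by rewrite /= mxE mulf_eq0 (negPf c0).
case: pickP => // i vi; rewrite mxE scalerA invfM mulrAC mulVf // mul1r //.
Qed.

Lemma nrm_nrm v : nrm (nrm v) = nrm v.
Proof.
have [->|/nrmP[c c0 e]] := eqVneq v 0; last by rewrite {1}e nrmZ.
by rewrite [X in nrm X](_ : _ = 0) // /nrm; case: pickP => // i; rewrite mxE eqxx.
Qed.

Definition normed (v : vec) := (v != 0) && (nrm v == v).
Definition pt : Type := {v : vec | normed v}.
HB.instance Definition _ := Finite.on pt.
HB.instance Definition _ := SubType.on pt.

Lemma nrm_normed v : v != 0 -> normed (nrm v).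
Proof.
move=> v0; rewrite /normed nrm_nrm eqxx andbT; have [c c0 ->] := nrmP v0.
by rewrite scaler_eq0 negb_or c0.
Qed.

Lemma const1_neq0 : delta_mx 0 0 != 0 :> vec.
Proof. by apply/row_neq0P; exists 0; rewrite mxE eqxx oner_eq0. Qed.

Definition mkpt (v : vec) : pt := insubd (Sub _ (nrm_normed const1_neq0) : pt) (nrm v).

Lemma pt_neq0 (x : pt) : val x != 0. Proof. by case: x => v /= /andP[]. Qed.

Lemma val_mkpt v : v != 0 -> val (mkpt v) = nrm v.
Proof. by move=> v0; rewrite val_insubd nrm_normed. Qed.

Lemma mkptP v : v != 0 -> exists2 c, c != 0 & val (mkpt v) = c *: v.
Proof. by move=> v0; rewrite val_mkpt //; apply: nrmP. Qed.

Lemma mkptZ c v : c != 0 -> mkpt (c *: v) = mkpt v.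
Proof. by move=> c0; rewrite /mkpt nrmZ. Qed.

Lemma mkpt_val x : mkpt (val x) = x.
Proof. by apply/val_inj; rewrite val_mkpt ?pt_neq0 //; case: x => v /= /andP[_ /eqP]. Qed.

Lemma mkpt_eq u v : u != 0 -> v != 0 -> mkpt u = mkpt v -> exists2 c, c != 0 & u = c *: v.
Proof.
move=> /mkptP[c c0 eu] /mkptP[c' c0' ev'] e; exists (c^-1 * c'); first by rewrite mulf_neq0 ?invr_eq0.
by rewrite -scalerA -ev' -e eu scalerA mulVf // scale1r.
Qed.

Lemma pt_indep (x y : pt) : x != y -> indep (val x) (val y).
Proof.
move=> nxy; apply: indepPn (pt_neq0 y) _ => c; apply: contraNneq nxy => e.
have c0 : c != 0 by apply: contraNneq (pt_neq0 x) => z; rewrite e z scale0r.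
by rewrite -(mkpt_val x) e mkptZ // mkpt_val.
Qed.

(* Points and lines are both represented by normalised vectors. *)
Definition inc (x l : pt) : bool := dot (val l) (val x) == 0.

Lemma inc_sym x l : inc x l = inc l x. Proof. by rewrite /inc dotC. Qed.

Lemma inc_mkpt v l : v != 0 -> inc (mkpt v) l = (dot (val l) v == 0).
Proof. by move=> /mkptP[c c0 e]; rewrite /inc e dotZr mulf_eq0 (negPf c0). Qed.

Lemma line_param (l : pt) a b (f : pt -> nat) : indep a b -> dot (val l) a = 0 -> dot (val l) b = 0 ->
  (\sum_(x | inc x l) f x = f (mkpt b) + \sum_(t : K) f (mkpt (a + t *: b)%R))%N.
Proof.
move=> iab la lb; have b0 := indep_neq0r iab; have ab0 t := indep_addZ t iab.
have lab t : dot (val l) (a + t *: b) = 0 by rewrite dotDr dotZr la lb mulr0 addr0.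
rewrite (eq_bigl (mem (mkpt b |: [set mkpt (a + t *: b) | t in setT]))) => [|x]; last first.
  rewrite inE; apply/idP/setU1P => [xl|[->|/imsetP[t _ ->]]].
  - have [c1 [c2 ex]] := span_line (pt_neq0 l) iab la lb (eqP xl).
    have [c10|c10] := eqVneq c1 0.
      left; move: ex; rewrite c10 scale0r add0r => ex; rewrite -(mkpt_val x) ex mkptZ //.
      by apply: contraNneq (pt_neq0 x) => z; rewrite ex z scale0r.
    right; apply/imsetP; exists (c2 / c1) => //; rewrite -(mkpt_val x) ex -[RHS](mkptZ _ c10).
    by rewrite scalerDr scalerA mulrCA divff // mulr1.
  - by rewrite inc_mkpt // lb.
  - by rewrite inc_mkpt // lab.
rewrite big_setU1 /=; last first.
  apply/imsetP => -[t _ /esym /(mkpt_eq (ab0 t) b0)[c _ e]].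
  have := indep_neqZ (c - t) iab; rewrite scalerBl -e addrK eqxx //.
rewrite big_imset /=; first by congr addn; apply: eq_bigl => t; rewrite inE.
move=> t t' _ _ /(mkpt_eq (ab0 t) (ab0 t'))[c _].
rewrite scalerDr scalerA => e; have := iab (1 - c) (t - c * t').
rewrite !scalerBl scale1r addrACA e -opprD subrr => /(_ erefl)[/eqP].
by rewrite subr_eq0 => /eqP <- /eqP; rewrite mul1r subr_eq0 => /eqP.
Qed.

(** The complement of [l] is an affine plane. With [row o1 B] and [row o2 B] on [l], the parameter t
    indexes the lines through [row o2 B] other than [l]. *)
Lemma plane_param (l : pt) (B : 'M[K]_3) (f : pt -> nat) : B \in unitmx ->
  dot (val l) (row o1 B) = 0 -> dot (val l) (row o2 B) = 0 ->
  (\sum_(x | ~~ inc x l) f x =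
   \sum_(t : K) \sum_(y : K) f (mkpt ((row o0 B + t *: row o1 B) + y *: row o2 B)%R))%N.
Proof.
move=> Bu l1 l2.
pose u (p : K * K) : vec := \row_(i < 3) [:: 1; p.1; p.2]`_i.
have mulB (w : vec) : w *m B = w 0 o0 *: row o0 B + w 0 o1 *: row o1 B + w 0 o2 *: row o2 B.
  by rewrite mulmx_sum_row !big_ord_recl big_ord0 addr0 addrA.
have uB p : u p *m B = (row o0 B + p.1 *: row o1 B) + p.2 *: row o2 B.
  by rewrite mulB !mxE /= scale1r.
have uB0 p : u p *m B != 0.
  apply/eqP => /(congr1 (mulmx^~ (invmx B))); rewrite mulmxK // mul0mx => /rowP/(_ o0).
  by rewrite !mxE /= => /eqP; rewrite oner_eq0.
have l0 : dot (val l) (row o0 B) != 0.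
  apply: contraNneq (pt_neq0 l) => z; apply/eqP.
  have : B *m (val l)^T = 0.
    apply/row_matrixP => i; rewrite row_mul row0; apply/rowP => j; rewrite ord1 -dot_mx mxE.
    case: (unliftP ord0 i) => [i' ->|->//]; case: (unliftP ord0 i') => [i2 ->|->//].
    by case: (unliftP ord0 i2) => [[] //|->].
  move/(congr1 (mulmx (invmx B))); rewrite mulKmx // mulmx0 => /(congr1 trmx).
  by rewrite trmxK trmx0.
rewrite pair_bigA /= (eq_bigl (mem [set mkpt (u p *m B) | p in setT])) => [|x]; last first.
  rewrite inE; apply/idP/imsetP => [nx|[p _ ->]]; last first.
    by rewrite inc_mkpt // uB !dotDr !dotZr l1 l2 !mulr0 !addr0.
  pose w := val x *m invmx B; have ew : w *m B = val x by rewrite mulmxKV.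
  have w0 : w 0 o0 != 0.
    apply: contraNneq nx => z; rewrite /inc -ew mulB z scale0r add0r dotDr !dotZr l1 l2.
    by rewrite !mulr0 addr0.
  exists (w 0 o1 / w 0 o0, w 0 o2 / w 0 o0) => //; rewrite uB /= -(mkpt_val x) -ew mulB.
  rewrite -[RHS](mkptZ _ w0) !scalerDr !scalerA ![w 0 o0 * _]mulrCA divff // !mulr1 //.
rewrite big_imset /=; first by apply: eq_big => [p|p _]; rewrite ?inE // uB.
move=> p p' _ _ /(mkpt_eq (uB0 p) (uB0 p'))[c _].
rewrite scalemxAl => /(congr1 (mulmx^~ (invmx B))); rewrite !mulmxK // => /rowP e.
have c1 : c = 1 by have := e o0; rewrite !mxE /= mulr1.
have := e o1; have := e o2; rewrite !mxE /= c1 !mul1r; case: p p' {e} => [? ?] [? ?] /=.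
by move=> -> ->.
Qed.

Lemma card_line l : #|[pred x | inc x l]| = q.+1.
Proof.
have [a [b [iab la lb]]] := kernel_indep (val l) (isT : (2 < 3)%N).
by rewrite -sum1_card (line_param _ iab la lb) sum1_card.
Qed.

Lemma card_pencil x : #|[pred l | inc x l]| = q.+1.
Proof. by rewrite -(card_line x); apply: eq_card => l; rewrite !inE inc_sym. Qed.

Lemma card_join x y : x != y -> #|[pred l | inc x l && inc y l]| = 1%N.
Proof.
move=> nxy; have [l l0 H] := ker_line (pt_indep nxy).
rewrite (eq_card (B := pred1 (mkpt l))) ?card1 // => m; rewrite !inE /=.
apply/andP/eqP => [[/eqP xm /eqP ym]|->].
  have [c e] := (H (val m)).1 (conj xm ym).
  rewrite -(mkpt_val m) e mkptZ //.
  by apply: contraNneq (pt_neq0 m) => z; rewrite e z scale0r.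
have [|lx ly] := (H l).2; first by exists 1; rewrite scale1r.
by rewrite ![inc _ (mkpt l)]inc_sym !inc_mkpt // ![dot _ l]dotC lx ly eqxx.
Qed.

Section IncidenceCounting.
Variable S : pred pt.
Local Notation N := #|S|.
Definition nu (l : pt) := #|[pred x | inc x l && S x]|.

(** A point other than [x] lies on one line through [x], while [x] lies on all q + 1 of them. *)
Lemma sum_pencil_nu x : (\sum_(l | inc x l) nu l = N + q * S x)%N.
Proof.
have -> : (\sum_(l | inc x l) nu l = \sum_(y | S y) #|[pred l | inc x l && inc y l]|)%N.
  under eq_bigr => l _ do rewrite /nu -sum1_card.
  under [RHS]eq_bigr => y _ do rewrite -sum1_card.
  rewrite (exchange_big_dep S) /= => [|l y _ /andP[] //].
  by apply: eq_bigr => y Sy; apply: eq_bigl => l; rewrite !inE Sy andbT.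
rewrite -sum1_card; have [Sx|nSx] := boolP (S x); last first.
  rewrite muln0 addn0; apply: eq_bigr => y Sy; rewrite card_join //.
  by apply: contraNneq nSx => ->.
rewrite (bigD1 x) //= [in RHS](bigD1 x) //= muln1.
rewrite (eq_card (B := [pred l | inc x l])) => [|l]; last by rewrite !inE andbb.
rewrite card_pencil [X in (_ + X = _)%N](eq_bigr (fun=> 1%N)) => [|y /andP[_ nyx]]; last first.
  by rewrite card_join // eq_sym.
by rewrite -[RHS]addnA [(_ + q)%N]addnC addnA add1n.
Qed.

Lemma sum_nu : (\sum_l nu l = N * q.+1)%N.
Proof.
under eq_bigr => l _ do rewrite /nu -sum1_card.
rewrite (exchange_big_dep S) /= => [|l y _ /andP[] //].
rewrite -sum_nat_const; apply: eq_bigr => y Sy; rewrite -(card_pencil y) -sum1_card.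
by apply: eq_bigl => l; rewrite !inE Sy andbT.
Qed.

End IncidenceCounting.

Lemma card_plane : #|{: pt}| = (q * q + q).+1.
Proof.
pose x0 := mkpt (delta_mx 0 0); have := sum_pencil_nu predT x0.
rewrite (eq_bigr (fun=> q.+1)) => [|l _]; last first.
  by rewrite -(card_line l) /nu; apply: eq_card => x; rewrite !inE andbT.
rewrite sum_nat_const card_pencil muln1 => h; apply: (@addIn q); rewrite -[LHS]h.
by clear; move: #|K| => x; lia.
Qed.

End ProjectivePlane.

(** * Frobenius nonclassical plane curves *)

(** [m] stands for d - 1, [r] for the sum of the defects through a point of the curve, [N] for the
    number of points, [W] for the sum of all defects, [e] for the number of external lines. If q =
    m^2 + eps + 1, the relations on [N] give r + eps + 1 <= m; in terms of del = m - r the weighted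
    inequality then fails. *)
Lemma plane_degree_arith q m r N W e :
  (0 < m -> 1 <= r -> r + N + q = q.+1 * m.+1 -> m.+1 * q + m.+1 <= N + m.+1 * m ->
   W + N * q.+1 = (q * q + q).+1 * m.+1 -> e <= q.-1 ->
   (m.+1 - r) * (W - m.+1 * e) <= N * r -> q <= m * m)%N.
Proof.
move=> m0 r1 eN hN eW he h; rewrite leqNgt; apply/negP => lt.
have [eps eq] : exists eps, q = (m * m + eps.+1)%N by exists (q - m * m).-1; lia.
have rm : (r + eps.+1 <= m)%N by lia.
have [del er] : exists del, (m = r + del)%N by exists (m - r)%N; lia.
have d1 : (eps.+1 <= del)%N by lia.
have eN' : N = (m * q + 1 + del)%N by lia.
have e1 : (N * r + del * m * q + del * del.+1 = m * m * q + m * del.+1)%N.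
  by rewrite eN' er; lia.
have eW' : (W + m.+1 * q = q.+1 * (q + r))%N.
  by have := congr1 (muln^~ q.+1) eN; lia.
have hme : (m.+1 * e <= m.+1 * q.-1)%N by rewrite leq_mul2l he orbT.
have hq1 : (m.+1 * q.-1 + m.+1 = m.+1 * q)%N by rewrite eq addnS /=; lia.
have hX : (q * q + m + m + 1 <= (W - m.+1 * e) + q + m * q + del * q + del)%N.
  have h1 : (q.+1 * (q + r) + del * q + del = q * q + q + q * m + m)%N by rewrite er; lia.
  by lia.
have hX' : (del.+1 * (q * q + m + m + 1) <= N * r + del.+1 * (q + m * q + del * q + del))%N.
  apply: (@leq_trans (del.+1 * ((W - m.+1 * e) + (q + m * q + del * q + del)))%N).
    by rewrite leq_mul2l /=; move: hX; rewrite !addnA.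
  rewrite mulnDr leq_add2r; apply: leq_trans h; rewrite leq_mul2r; apply/orP; right; lia.
have k1 : (m + 1 + del + del + del * del <= del * q + eps.+1)%N.
  have p1 : (del * del.+1 <= del * m)%N by rewrite leq_mul2l; apply/orP; right; lia.
  have p2 : (del * (m * m).+1 <= del * q)%N by rewrite leq_mul2l eq; apply/orP; right; lia.
  have p3 : (2 * m <= m * m)%N by rewrite leq_mul2r; apply/orP; right; lia.
  have p4 : (1 * (m * m - m) <= del * (m * m - m))%N by rewrite leq_mul2r; apply/orP; right; lia.
  have p5 : (del * (m * m - m) + del * m = del * (m * m))%N.
    by rewrite -mulnDr subnK // leq_pmulr.
  lia.
have k2 : (q * (m + 1 + del + del + del * del) <= q * (del * q + eps.+1))%N by rewrite leq_mul2l k1 orbT.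
have e2 : (m * m * q + q * eps.+1 = q * q)%N by rewrite [X in (_ = X * _)%N]eq; lia.
clear -hX' k2 e1 e2; lia.
Qed.

(** The same count with q = m^2 and no external line: the weighted inequality excludes del = m - r >
    0. *)
Lemma plane_degree_arith_eq m r N W :
  (1 < m -> r + N + m * m = (m * m).+1 * m.+1 ->
   m.+1 * (m * m) + m.+1 <= N + m.+1 * m ->
   W + N * (m * m).+1 = (m * m * (m * m) + m * m).+1 * m.+1 ->
   (m.+1 - r) * W <= N * r -> r = m /\ W = N * r)%N.
Proof.
move=> m1 eN; have m0 : (0 < m)%N by lia.
move=> hN eW h.
have [del er] : exists del, (m = r + del)%N by exists (m - r)%N; lia.
have eN' : N = (m * m * m + 1 + del)%N by lia.
have eW' : (W + m.+1 * (m * m) = (m * m).+1 * (m * m + r))%N.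
  by have := congr1 (muln^~ (m * m).+1) eN; lia.
have e0 : del = 0%N.
  case: del er eN' => // del er eN'; exfalso.
  have h1 : (del.+2 * W <= N * r)%N by apply: leq_trans h; rewrite leq_mul2r; apply/orP; right; lia.
  have eW2 : (W + del.+1 * (m * m).+1 = m * m * (m * m) + m)%N by rewrite {2 3}er in eW' *; lia.
  have h2 : (del.+2 * (W + del.+1 * (m * m).+1) <= N * r + del.+2 * (del.+1 * (m * m).+1))%N by lia.
  rewrite eW2 in h2.
  have e1 : (N * r + del.+1 * m * (m * m) + del.+1 * del.+2 = m * m * (m * m) + m * del.+2)%N.
    by rewrite eN' er; lia.
  have k : (del.+2 * del.+1 * (m * m) + del.+1 * (m * m) <= del.+1 * m * (m * m) + del.+1 * (m * m * (m * m)))%N.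
    have mm : (2 * m <= m * m)%N by rewrite leq_mul2r m1 orbT.
    have k : (del.+3 <= m + m * m)%N by lia.
    by have := leq_mul (leqnn (del.+1 * (m * m))) k; lia.
  have p : (0 < del.+1 * (m * m))%N by rewrite !muln_gt0 m0.
  lia.
have erm : r = m by lia.
split=> //; rewrite erm; move: eW' eN'; rewrite e0 erm; lia.
Qed.

Section PlaneCurves.
Variable K : finFieldType.
Local Notation q := #|K|.
Local Notation vec := 'rV[K]_3.
Local Notation pt := (pt K).

Lemma dot0r n (l : 'rV[K]_n) : dot l 0 = 0.
Proof. by rewrite /dot big1 // => j _; rewrite mxE mulr0. Qed.

Lemma card_roots_leq (f : {poly K}) : f != 0 -> (#|[set t | root f t]| < size f)%N.
Proof.
move=> f0; rewrite cardE; apply: max_poly_roots => //; last exact: enum_uniq.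
by apply/allP => t; rewrite mem_enum inE.
Qed.

Lemma card_roots_double (f : {poly K}) r : f != 0 -> root f r -> root f^`() r ->
  (#|[set t | root f t]|.+1 < size f)%N.
Proof.
move=> f0 /factor_theorem[g eg] dr.
have g0 : g != 0 by apply: contraNneq f0 => z; rewrite eg z mul0r.
have gr : root g r.
  by move: dr; rewrite eg derivM derivXsubC mulr1 rootE !hornerE subrr mulr0 add0r -rootE.
have -> : size f = (size g).+1 by rewrite eg size_Mmonic ?monicXsubC // size_XsubC addn2.
rewrite ltnS; apply: leq_trans (card_roots_leq g0); rewrite ltnS; apply: subset_leq_card.
by apply/subsetP => t; rewrite !inE eg rootM root_XsubC => /orP[//|/eqP->].
Qed.

Lemma dhomog0C n (F : {mpoly K[n]}) : F \is 0.-homog -> F = (F@_0%MM)%:MP.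
Proof.
move=> hF; apply/mpolyP => m; rewrite mcoeffC; have [->|m0] := eqVneq m 0%MM.
  by rewrite mulr1.
rewrite mulr0; apply: memN_msupp_eq0; apply: contraNN m0 => mF.
by rewrite -mdeg_eq0 (dhomog_mdeg hF mF).
Qed.

Lemma lin_inj n (l l' : 'rV[K]_n) : lin l = lin l' -> l = l'.
Proof.
move=> e; apply/rowP => i; have := mderiv_lin l i; rewrite e mderiv_lin.
by move/(congr1 (mcoeff 0%MM)); rewrite !mcoeffC eqxx !mulr1 => ->.
Qed.

Lemma lin_dvd_lin n (l l' : 'rV[K]_n) : l != 0 -> l' != 0 -> mdvd (lin l') (lin l) -> exists c, l = c *: l'.
Proof.
move=> l0 l0' [M eM]; have M0 : M != 0.
  by apply: contraNneq l0 => z; rewrite -lin_eq0 eM z mulr0.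
have := dhomog_lin l; rewrite eM => /(dhomog_lin_cofactor M0 l0') /dhomog0C e.
exists (M@_0%MM); apply: lin_inj; rewrite eM {1}e mulrC mul_mpolyC /lin scaler_sumr.
by apply: eq_bigr => i _; rewrite mxE scalerA.
Qed.

(** Vectors of distinct points are not proportional, so once [lin l] is split off the other linear
    forms still divide the cofactor, whose degree is one less. *)
Lemma size_lin_divisors (s : seq pt) k (F : {mpoly K[3]}) : uniq s -> F != 0 -> F \is k.-homog ->
  (forall l, l \in s -> mdvd (lin (val l)) F) -> (size s <= k)%N.
Proof.
elim: s k F => [//|l s IH] k F /= /andP[ls us] F0 hF h.
have [M eM] := h l (mem_head _ _); rewrite eM in F0 hF.
have M0 : M != 0 by apply: contraNneq F0 => ->; rewrite mulr0.
have hM := dhomog_lin_cofactor M0 (pt_neq0 l) hF.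
have k0 : (0 < k)%N.
  have [e [le hl _]] := dhomog_factor F0 hF; apply: leq_trans le.
  by rewrite (dhomog_uniq _ hl (dhomog_lin _)) // lin_eq0 pt_neq0.
rewrite -(prednK k0) ltnS; apply: (IH _ M) => // l' l's.
have := h l'; rewrite inE l's orbT eM => /(_ isT) /(lin_prime (pt_neq0 l'))[|//].
move/(lin_dvd_lin (pt_neq0 l) (pt_neq0 l')) => [c e]; case/negP: ls.
suff -> : l = l' by [].
rewrite -(mkpt_val l) e mkptZ ?mkpt_val //.
by apply: contraNneq (pt_neq0 l) => z; rewrite e z scale0r.
Qed.

Lemma rprime_not_pth_power (C H : {mpoly K[3]}) k : rprime C -> C = H ^+ k.+2 -> False.
Proof.
move=> [C0 Cu Cp] e.
have dH j : rdvd C (H ^+ j.+1) -> rdvd C H.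
  by elim: j => [//|j IH]; rewrite exprS => /Cp[//|/IH].
have [M eM] : rdvd C H by apply: (dH k.+1); exists 1; rewrite mulr1.
case/negP: Cu; apply/unitrP; exists (M * H ^+ k * M).
suff h : C * (M * H ^+ k * M) = 1 by split; rewrite // mulrC.
by apply: (mulfI C0); rewrite mulr1 {3}e !exprS {2 3}eM; ring.
Qed.

Definition onC (C : {mpoly K[3]}) (x : pt) := ev C (val x) == 0.

Lemma onC_mkpt_homog k (H : {mpoly K[3]}) v : H \is k.-homog -> v != 0 ->
  onC H (mkpt v) = (ev H v == 0).
Proof.
move=> hH /mkptP[c c0 e]; rewrite /onC e (ev_homogZ _ _ hH) mulf_eq0 expf_eq0 (negPf c0).
by rewrite andbF.
Qed.

Lemma nu_param_homog k (H : {mpoly K[3]}) (l : pt) a b : H \is k.-homog ->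
  indep a b -> dot (val l) a = 0 -> dot (val l) b = 0 ->
  nu (onC H) l = ((ev H b == 0%R) + nzeros H a b)%N.
Proof.
move=> hH iab la lb.
have -> : nu (onC H) l = (\sum_(x | inc x l) onC H x)%N.
  rewrite /nu -sum1_card (eq_bigl (fun x => inc x l && onC H x)) => [|x]; last by rewrite inE.
  by rewrite big_mkcondr; apply: eq_bigr => x _; case: (onC H x).
rewrite (line_param _ iab la lb) (onC_mkpt_homog hH) ?(indep_neq0r iab) //; congr addn.
rewrite /nzeros -sum1_card [RHS]big_mkcond; apply: eq_bigr => t _.
by rewrite (onC_mkpt_homog hH) ?indep_addZ // inE; case: (_ == 0).
Qed.

Lemma nzeros_roots (H : {mpoly K[3]}) a b : nzeros H a b = #|[set t | root (lp a b H) t]|.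
Proof. by apply: eq_card => t; rewrite !inE rootE horner_lp. Qed.

Lemma line_many_zeros k (H : {mpoly K[3]}) (l : pt) : H \is k.-homog ->
  (k < nu (onC H) l)%N -> forall v, dot (val l) v = 0 -> ev H v = 0.
Proof.
move=> hH kl b lb; apply/eqP; apply/negPn/negP => Hb.
have [b0|b0] := eqVneq b 0.
  move: kl Hb; rewrite b0; case: k hH => [|k] hH; last by rewrite (ev_homog0 _ hH) ?eqxx.
  rewrite (dhomog0C hH) evC => /card_gt0P[x]; rewrite inE => /andP[_].
  by rewrite /onC evC => ->.
have [a iab la] := line_partner (val l) b0.
move: kl; rewrite (nu_param_homog hH iab la lb) (negPf Hb) add0n nzeros_roots ltnNge.
rewrite -ltnS -(size_lp a hH Hb) card_roots_leq // -size_poly_gt0 (size_lp a hH Hb) //.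
Qed.

(** [pc_bound] is the reverse of the inequality to be proved, and the estimates below rely on it. By
    [plane_curve_bound] only the case of equality remains. *)
Record plane_curve (d : nat) (C G : {mpoly K[3]}) : Prop := PlaneCurve {
  pc_prime : rprime C;
  pc_homog : C \is d.-homog;
  pc_frob : frob C = C * G;
  pc_deg : (2 <= d)%N;
  pc_card : (4 <= q)%N;
  pc_bound : (d.-1 * d.-1 <= q)%N }.

Section Curve.
Variables (d : nat) (C G : {mpoly K[3]}).
Hypothesis pc : plane_curve d C G.
Let pC := pc_prime pc. Let hC := pc_homog pc. Let CG := pc_frob pc.
Let d2 := pc_deg pc. Let q4 := pc_card pc. Let dq := pc_bound pc.

Local Notation onC := (onC C).
Local Notation N := #|[pred x | onC x]|.
Local Notation nuC := (nu onC).

Lemma C_neq0 : C != 0. Proof. by case: pC. Qed.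

Lemma d_gt0 : (0 < d)%N. Proof. exact: ltnW. Qed.

Lemma d_lt_q : (d < q)%N.
Proof.
move: q4 dq d2; move: #|K| => x; case: d => [|[|[|[|e]]]] //=; try lia.

Qed.

Lemma onC_mkpt v : v != 0 -> onC (mkpt v) = (ev C v == 0).
Proof. exact: onC_mkpt_homog hC. Qed.

Lemma no_linear_factor (l : vec) : l != 0 -> ~ mdvd (lin l) C.
Proof.
move=> l0 [M eM]; have [C0 Cu Cp] := pC.
have M0 : M != 0 by apply: contraNneq C0 => z; rewrite eM z mulr0.
have hM : M \is d.-1.-homog by apply: dhomog_lin_cofactor M0 l0 _; rewrite -eM.
have : rdvd C (lin l * M) by exists 1; rewrite mulr1.
case/Cp => [|] dv.
  by apply: (not_mdvd_small hC (dhomog_lin l) _ _ dv) => //; rewrite lin_eq0.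
by apply: (not_mdvd_small hC hM M0 _ dv); rewrite prednK ?d_gt0.
Qed.

Lemma line_off (l : pt) : exists v, [/\ v != 0, dot (val l) v = 0 & ev C v != 0].
Proof.
have [/existsP[v /andP[/eqP lv Cv]]|/existsPn h] :=
    boolP [exists v : vec, (dot (val l) v == 0) && (ev C v != 0)].
  exists v; split=> //; apply: contraNneq Cv => ->; by rewrite (ev_homog0 d_gt0 hC).
case: (no_linear_factor (pt_neq0 l)); apply: lin_dvd_homog (pt_neq0 l) hC (ltnW d_lt_q) _ => v lv.
by have := h v; rewrite lv eqxx /= negbK => /eqP.
Qed.

Lemma nu_param (l : pt) a b : indep a b -> dot (val l) a = 0 -> dot (val l) b = 0 ->
  nuC l = ((ev C b == 0%R) + nzeros C a b)%N.
Proof. exact: nu_param_homog hC. Qed.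

Lemma nu_leq (l : pt) : (nuC l <= d)%N.
Proof.
have [b [b0 lb Cb]] := line_off l; have [a iab la] := line_partner (val l) b0.
rewrite (nu_param iab la lb) (negPf Cb) add0n nzeros_roots -ltnS -(size_lp a hC Cb).
by apply: card_roots_leq; rewrite -size_poly_gt0 (size_lp a hC Cb).
Qed.

Lemma nu_double_root (l : pt) a b r : indep a b -> dot (val l) a = 0 -> dot (val l) b = 0 ->
  ev C b != 0 -> root (lp a b C) r -> root (lp a b C)^`() r -> (nuC l < d)%N.
Proof.
move=> iab la lb Cb rf rf'; rewrite (nu_param iab la lb) (negPf Cb) add0n nzeros_roots.
rewrite -ltnS -(size_lp a hC Cb); apply: card_roots_double rf rf'.
by rewrite -size_poly_gt0 (size_lp a hC Cb).
Qed.

(** The restriction to [l] has a double root at [P]. The condition is phrased to include singular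
    [P], for which every line through [P] qualifies. *)
Lemma nu_tangent (P l : pt) : onC P -> inc P l ->
  (forall v, dot (val l) v = 0 -> dot (grad C (val P)) v = 0) -> (nuC l < d)%N.
Proof.
move=> SP Pl tl; have [b [b0 lb Cb]] := line_off l.
have iPb : indep (val P) b.
  apply: indepPn b0 _ => c; apply: contraTneq SP => e.
  have c0 : c != 0 by apply: contraNneq (pt_neq0 P) => z; rewrite e z scale0r.
  by rewrite /onC e (ev_homogZ _ _ hC) mulf_neq0 // expf_neq0.
apply: (@nu_double_root l (val P) b 0 iPb (eqP Pl) lb Cb).
  by rewrite rootE horner_coef0 lp_coef0.
by rewrite rootE deriv_lp horner_coef0 lp_coef0 ev_mder tl.
Qed.

(** [C] is not a p-th power, so some monomial m occurs in a partial derivative. The coefficient of m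
    in [mder Q C] is a nonzero linear form in [Q]; its product with [C] has degree d + 1 <= q and so
    does not vanish everywhere. *)
Lemma derivable_off : exists Q, ev C Q != 0 /\ mder Q C != 0.
Proof.
have [p pp pK] := finPcharP K.
have [i Ci] : exists i, C^`M(i) != 0.
  apply/existsP; apply: contraT => /existsPn h.
  have [|H e] := mderiv0_pth_power pK (F := C); first by move=> i; apply/eqP/negbNE/h.
  case: p pp e {pK} => [|[|k]] // _ e; by case: (rprime_not_pth_power pC e).
have [m Cm] : exists m, C^`M(i)@_m != 0.
  by exists (mlead C^`M(i)); rewrite mleadc_eq0.
pose l : vec := \row_j C^`M(j)@_m.
have l0 : l != 0 by apply/row_neq0P; exists i; rewrite mxE.
have [/existsP[Q CQ]|/existsPn h] := boolP [exists Q : vec, ev (C * lin l) Q != 0].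
  move: CQ; rewrite evM ev_lin mulf_eq0 negb_or => /andP[CQ lQ]; exists Q; split=> //.
  apply: contraNneq lQ => /(congr1 (mcoeff m)); rewrite mcoeff0 /mder raddf_sum /= => <-.
  by apply/eqP; apply: eq_bigr => j _; rewrite mcoeffZ mxE mulrC.
have : C * lin l = 0.
  apply: homog_vanish (dhomogM hC (dhomog_lin l)) _ _; first by rewrite addn1 d_lt_q.
  by move=> v; apply/eqP/negbNE/h.
by move/eqP; rewrite mulf_eq0 (negPf C_neq0) lin_eq0 (negPf l0).
Qed.

Lemma card_split_line (l : pt) : (N = nuC l + \sum_(x | ~~ inc x l) onC x)%N.
Proof.
rewrite /nu -sum1_card (bigID (fun x => inc x l)) /=; congr addn.
  by rewrite -sum1_card; apply: eq_bigl => x; rewrite !inE andbC.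
rewrite big_mkcondl; apply: eq_bigr => x _; rewrite inE; by case: (onC x).
Qed.

(** The lines through [Q] other than [l] cover the plane off [l], and their defects sum to at most d
    (d - 1). No defect is charged to [l], whence the term [nuC l]. *)
Lemma bezout_line Q (l : pt) : ev C Q != 0 -> mder Q C != 0 -> dot (val l) Q = 0 ->
  (q * d + nuC l <= N + d * d.-1)%N.
Proof.
move=> CQ dQ lQ.
have Q0 : Q != 0 by apply: contraNneq CQ => ->; rewrite (ev_homog0 d_gt0 hC).
have [a iaQ la] := line_partner (val l) Q0.
have [i li] := row_neq0P _ (pt_neq0 l).
pose b : vec := delta_mx 0 i.
have lb : dot (val l) b != 0.
  rewrite /dot (bigD1 i) //= big1 ?addr0 => [|j /negPf nj]; first by rewrite mxE !eqxx mulr1.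
  by rewrite mxE nj andbF mulr0.
pose B : 'M[K]_3 := \matrix_(i < 3) [:: b; a; Q]`_i.
have r0 : row o0 B = b by rewrite rowK.
have r1 : row o1 B = a by rewrite rowK.
have r2 : row o2 B = Q by rewrite rowK.
have Bu : B \in unitmx.
  rewrite -row_free_unit -kermx_eq0; apply/eqP/row_matrixP => k; rewrite row0.
  set x := row k _; have : x *m B = 0 by rewrite /x -row_mul mulmx_ker row0.
  rewrite mulmx_sum_row !big_ord_recl big_ord0 addr0 -/o0 -/o1 -/o2 r0 r1 r2 => e.
  have x0 : x 0 o0 = 0.
    have := congr1 (dot (val l)) e; rewrite !dotDr !dotZr la lQ dot0r !mulr0 !addr0.
    move=> /eqP; rewrite mulf_eq0 (negPf lb) orbF => /eqP; by [].
  move: e; rewrite x0 scale0r add0r => /iaQ[x1 x2]; apply/rowP => j; rewrite [RHS]mxE.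
  case: (unliftP ord0 j) => [j' ->|->//]; case: (unliftP ord0 j') => [j2 ->|->//].
  by case: (unliftP ord0 j2) => [[] //|->].
have := bezout_bound Bu pC hC d_gt0 CG; rewrite r0 r1 r2 => /(_ CQ dQ) h.
rewrite (card_split_line l) (plane_param _ Bu) ?r1 ?r2 // r0.
have -> : (\sum_t \sum_y onC (mkpt (b + t *: a + y *: Q)%R) = \sum_(t : K) nzeros C (b + t *: a)%R Q)%N.
  apply: eq_bigr => t _; rewrite /nzeros -sum1_card [RHS]big_mkcond; apply: eq_bigr => y _.
  rewrite inE onC_mkpt; first by case: (_ == 0).
  apply: contraNneq lb => z; have := congr1 (dot (val l)) z; by rewrite !dotDr !dotZr la lQ dot0r !mulr0 !addr0 => ->.
have h2 : (q * d <= \sum_(t : K) nzeros C (b + t *: a)%R Q +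
      \sum_(t : K) (d - nzeros C (b + t *: a)%R Q))%N.
  rewrite -big_split -sum_nat_const; apply: leq_sum => t _ /=; lia.
rewrite addnC -addnA leq_add2l; apply: leq_trans h2 _; by rewrite leq_add2l.
Qed.

Lemma join_exists (x y : pt) : exists l, inc x l && inc y l.
Proof.
have [->|nxy] := eqVneq x y.
  have : (0 < #|[pred l | inc y l]|)%N by rewrite card_pencil.
  by case/card_gt0P => l; rewrite inE => yl; exists l; rewrite yl.
have : (0 < #|[pred l | inc x l && inc y l]|)%N by rewrite card_join.
by case/card_gt0P => l; rewrite inE => yl; exists l.
Qed.

Lemma nu_gt0 (l P : pt) : onC P -> inc P l -> (0 < nuC l)%N.
Proof. by move=> SP Pl; apply/card_gt0P; exists P; rewrite inE Pl. Qed.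

(* Otherwise all defects are positive, and the sums of defects through a point off [C] and through
   a point of [C] are too large for [bezout_line]. *)
Lemma exists_full_line : exists l, nuC l = d.
Proof.
have [/existsP[l /eqP h]|/existsPn h] := boolP [exists l, nuC l == d]; first by exists l.
have lt l : (nuC l <= d.-1)%N.
  by rewrite -ltnS prednK ?d_gt0 // ltn_neqAle h nu_leq.
have [Q [CQ dQ]] := derivable_off.
have Q0 : Q != 0 by apply: contraNneq CQ => ->; rewrite (ev_homog0 d_gt0 hC).
have incQ l : inc (mkpt Q) l -> dot (val l) Q = 0 by rewrite inc_mkpt // => /eqP.
exfalso; have [N0|] := posnP N.
  have [l /andP[Ql _]] := join_exists (mkpt Q) (mkpt Q).
  have := bezout_line CQ dQ (incQ l Ql); rewrite N0 add0n.
  have := d_lt_q; move: d2 (nuC l); move: #|K| => x; clear; case: d => // e; nia.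
case/card_gt0P => P; rewrite inE => SP.
have [l /andP[Ql Pl]] := join_exists (mkpt Q) P.
have h1 := bezout_line CQ dQ (incQ l Ql); have h2 := nu_gt0 SP Pl.
have h3 : (N + q <= q.+1 * d.-1)%N.
  have := sum_pencil_nu onC P; rewrite SP muln1 => <-; rewrite -(card_pencil P) -sum_nat_const.
  by apply: leq_sum => m _; apply: lt.
have h4 : (q * d + 1 <= N + d * d.-1)%N by apply: leq_trans h1; rewrite leq_add2l.
move: h3 h4 dq d2 q4; move: N #|K| => x y; clear; case: d => [|e] //=; nia.
Qed.

Lemma nuC_full_deriv (l : pt) a b : indep a b -> dot (val l) a = 0 -> dot (val l) b = 0 ->
  ev C b != 0 -> nuC l = d -> (lp a b C)^`() != 0.
Proof.
move=> iab la lb Cb full; apply/eqP => z.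
have : (0 < nuC l)%N by rewrite full d_gt0.
rewrite (nu_param iab la lb) (negPf Cb) add0n nzeros_roots.
case/card_gt0P => r; rewrite inE => rr.
have := nu_double_root iab la lb Cb rr; by rewrite z root0 full ltnn => /(_ isT).
Qed.

(** The centre is a point off [C] on a full line: there f' is nonzero, since f has only simple
    roots, so the derivative of [C] in that direction is nonzero too. *)
Lemma card_curve_lower : (d * q + d <= N + d * d.-1)%N.
Proof.
have [l full] := exists_full_line; have [b [b0 lb Cb]] := line_off l.
have [a iab la] := line_partner (val l) b0.
have := nuC_full_deriv iab la lb Cb full; rewrite deriv_lp => nz.
have dC : mder b C != 0 by apply: contraNneq nz => ->; rewrite rmorph0.
by have := bezout_line Cb dC lb; rewrite full mulnC.
Qed.

Definition defect l := (d - nuC l)%N.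

Lemma nu_defect l : (nuC l + defect l = d)%N.
Proof. by rewrite subnKC ?nu_leq. Qed.

Lemma sum_defect_pencil x : (\sum_(l | inc x l) defect l + N + q * onC x = q.+1 * d)%N.
Proof.
rewrite -addnA -sum_pencil_nu -big_split -(card_pencil x) -sum_nat_const.
by apply: eq_bigr => l _; rewrite /= addnC nu_defect.
Qed.

Lemma sum_defect : (\sum_l defect l + N * q.+1 = (q * q + q).+1 * d)%N.
Proof.
rewrite -sum_nu -big_split -(card_plane K) -sum_nat_const.
by apply: eq_bigr => l _; rewrite /= addnC nu_defect.
Qed.

Lemma curve_point : exists P, onC P.
Proof.
have [l full] := exists_full_line; have : (0 < nuC l)%N by rewrite full d_gt0.
by case/card_gt0P => P; rewrite inE => /andP[_ SP]; exists P.
Qed.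

(* The sum of the defects of the lines through a rational point of [C]. *)
Definition rdef := (q.+1 * d - N - q)%N.

Lemma rdef_eq : (rdef + N + q = q.+1 * d)%N.
Proof.
have [P SP] := curve_point; have := sum_defect_pencil P; rewrite SP muln1 /rdef.
by move: (\sum_(l | _) _)%N N q => x y z; lia.
Qed.

Lemma sum_defect_on P : onC P -> (\sum_(l | inc P l) defect l = rdef)%N.
Proof.
move=> SP; have := sum_defect_pencil P; rewrite SP muln1 -rdef_eq.
by move/addIn/addIn.
Qed.

(** All q + 1 lines through a singular point would have positive defect, while [card_curve_lower]
    gives rdef + q <= d (d - 1). *)
Lemma curve_smooth P : onC P -> grad C (val P) != 0.
Proof.
move=> SP; apply/eqP => g0.
have h : (q.+1 <= rdef)%N.
  rewrite -(sum_defect_on SP) -(card_pencil P) -sum1_card; apply: leq_sum => l Pl.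
  rewrite subn_gt0; apply: (nu_tangent SP Pl) => v _.
  by rewrite g0 /dot big1 // => i _; rewrite mxE mul0r.
have := rdef_eq; have := card_curve_lower; move: h dq d2.
by move: rdef N #|K| => x y z; clear; case: d => [|e] //=; nia.
Qed.

Definition tangent (P : pt) : pt := mkpt (grad C (val P)).

Lemma tangentP P : onC P -> exists2 c, c != 0 & val (tangent P) = c *: grad C (val P).
Proof. by move=> SP; apply: mkptP; apply: curve_smooth. Qed.

Lemma inc_tangent P x : onC P -> inc x (tangent P) = (dot (grad C (val P)) (val x) == 0).
Proof. by move=> SP; rewrite inc_sym inc_mkpt ?curve_smooth // dotC. Qed.

Lemma tangent_self P : onC P -> inc P (tangent P).
Proof.
by move=> SP; rewrite inc_tangent // -ev_mder (ev_Euler _ hC) (eqP SP) mul0rn.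
Qed.

Lemma defect_tangent P : onC P -> (0 < defect (tangent P))%N.
Proof.
move=> SP; rewrite subn_gt0; apply: (nu_tangent SP (tangent_self SP)) => v.
have [c c0 ->] := tangentP SP; rewrite dotC dotZr dotC => /eqP.
by rewrite mulf_eq0 (negPf c0) => /eqP.
Qed.

Lemma defect_leq l P : onC P -> inc P l -> (defect l <= rdef)%N.
Proof. by move=> SP Pl; rewrite -(sum_defect_on SP) (bigD1 l) //= leq_addr. Qed.

Lemma sum_defect_nu : (\sum_l defect l * nuC l = N * rdef)%N.
Proof.
rewrite -sum_nat_const; under [RHS]eq_bigr => P SP do rewrite -(sum_defect_on SP).
rewrite (exchange_big_dep predT) //=; apply: eq_bigr => l _.
rewrite /nu -sum1_card big_distrr /=; apply: eq_big => x; first by rewrite !inE andbC.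
by rewrite muln1.
Qed.

End Curve.
End PlaneCurves.

(** * The degree bound for plane curves *)

Section PlaneCurveBound.
Variable K : finFieldType.
Local Notation q := #|K|.
Local Notation vec := 'rV[K]_3.
Local Notation pt := (pt K).

Lemma dhomog_frob n d (F : {mpoly K[n]}) : (0 < d)%N -> F \is d.-homog ->
  frob F \is (q + d.-1).-homog.
Proof.
move=> d0 hF; apply: rpred_sum => i _; apply: dhomogM; last exact: dhomog_mderiv.
by rewrite -[X in X.-homog]mul1n; apply: dhomogMn; rewrite dhomogX /= mdeg1.
Qed.

Lemma dhomog_cofactor n d (F G : {mpoly K[n]}) : (0 < d)%N -> F != 0 -> G != 0 -> F \is d.-homog ->
  frob F = F * G -> G \is q.-1.-homog.
Proof.
move=> d0 F0 G0 hF FG; have FG0 : F * G != 0 by rewrite mulf_neq0.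
have := dhomog_frob d0 hF; rewrite FG => /(dhomog_factor FG0)[e [le hF' hG]].
have := dhomog_uniq F0 hF hF' => ed; move: hG; rewrite -ed.
suff -> : (q + d.-1 - d = q.-1)%N by [].
have := card_field_gt1 K; move: #|K| d0 => x; clear; lia.
Qed.

Section Curve.
Variables (d : nat) (C G : {mpoly K[3]}).
Hypothesis pc : plane_curve d C G.
Let pC := pc_prime pc. Let hC := pc_homog pc. Let CG := pc_frob pc.
Let d2 := pc_deg pc. Let q4 := pc_card pc. Let dq := pc_bound pc.
Local Notation N := #|[pred x | onC C x]|.
Local Notation nuC := (nu (onC C)).

(** With G = 0, a full line would give d f = - (X^q - X) f' with f' nonzero, of degree at least q >
    d. *)
Lemma cofactor_neq0 : G != 0.
Proof.
apply/eqP => G0; have [l full] := exists_full_line pc.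
have [b [b0 lb Cb]] := line_off pc l; have [a iab la] := line_partner (val l) b0.
have nz := nuC_full_deriv pc iab la lb Cb full.
have := lp_frob a b hC; rewrite CG G0 mulr0 rmorph0; set f := lp a b C in nz *.
move/eqP; rewrite eq_sym addr_eq0 => /eqP e.
have Xq0 : 'X^q - 'X != 0 :> {poly K}.
  by rewrite -size_poly_gt0 size_polyDl ?size_polyXn // size_polyN size_polyX ltnS card_field_gt1.
have := size_mul Xq0 nz; rewrite -size_polyN -e size_polyDl ?size_polyXn; last first.
  by rewrite size_polyN size_polyX ltnS card_field_gt1.
have : (size (f *+ d)%R <= d.+1)%N.
  by rewrite -scaler_nat; apply: leq_trans (size_scale_leq _ _) _; rewrite (lp_top a b hC).1.
have : (0 < size f^`())%N by rewrite size_poly_gt0.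
have := d_lt_q pc; move: (size (f *+ d)%R) (size f^`()) #|K| => x y z; clear; lia.
Qed.

Let hG : G \is q.-1.-homog.
Proof. exact: dhomog_cofactor (d_gt0 pc) (C_neq0 pc) cofactor_neq0 hC CG. Qed.

(** f' = 0 for every parametrisation of the line, so d = 0 in [K] and g f = d f gives g = 0. The
    coefficient of g at q - 1 is the value of [G] at the point at infinity [b], which is arbitrary
    on the line. *)
Lemma external_line (l : pt) : nuC l = 0%N -> d%:R = 0 :> K /\ mdvd (lin (val l)) G.
Proof.
move=> ext.
have off b : b != 0 -> dot (val l) b = 0 -> ev C b != 0.
  move=> b0 lb; apply/negP => Cb.
  have : (0 < nuC l)%N by apply: (@nu_gt0 _ C l (mkpt b)); rewrite ?(onC_mkpt pc) // inc_mkpt // lb.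
  by rewrite ext.
have H b : b != 0 -> dot (val l) b = 0 -> d%:R = 0 :> K /\ ev G b = 0.
  move=> b0 lb; have [a iab la] := line_partner (val l) b0.
  have offt t : ev C (a + t *: b) != 0.
    by apply: off; rewrite ?indep_addZ // dotDr dotZr la lb mulr0 addr0.
  have z := line_no_zero hC CG offt.
  have dK := line_no_zero_deg hC CG (off b b0 lb) offt; split=> //.
  have f0 : lp a b C != 0 by rewrite -size_poly_gt0 (size_lp a hC (off b b0 lb)).
  have := lp_frob a b hC; rewrite z mulr0 addr0 CG rmorphM /= -mulr_natr => /(mulfI f0) e.
  rewrite -(lp_top a b hG).2 e -polyC_natr dK coefC; case: eqP => //.
have [b [b0 lb Cb]] := line_off pc l.
split; first by case: (H b b0 lb).
apply: lin_dvd_homog (pt_neq0 l) hG (leq_pred _) _ => v lv.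
have [->|v0] := eqVneq v 0; last by case: (H v v0 lv).
by apply: ev_homog0 hG; move: q4; case: #|K| => [|[]].
Qed.

Lemma card_external : (#|[pred l | nuC l == 0%N]| <= q.-1)%N.
Proof.
rewrite cardE; apply: (size_lin_divisors (enum_uniq _) cofactor_neq0 hG) => l.
by rewrite mem_enum inE => /eqP /external_line[].
Qed.

(** A line that meets [C] has defect at most [rdef], hence at least d - rdef points; the external
    lines, each of defect d, are removed from the sum. *)
Lemma weighted_defect :
  ((d - rdef d C) * (\sum_l defect d C l - d * #|[pred l | nuC l == 0%N]|) <= N * rdef d C)%N.
Proof.
rewrite -(sum_defect_nu pc) (bigID (fun l => nuC l == 0%N)) /=.
have -> : (\sum_(l | nuC l == 0%N) defect d C l = d * #|[pred l | nuC l == 0%N]|)%N.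
  by rewrite mulnC -sum_nat_const; apply: eq_bigr => l /eqP h; rewrite /defect h subn0.
rewrite addKn [X in (_ <= X)%N](bigID (fun l => nuC l == 0%N)) /=.
apply: leq_trans (leq_addl _ _); rewrite big_distrr /=; apply: leq_sum => l.
rewrite -lt0n => /card_gt0P[P]; rewrite inE => /andP[Pl SP].
rewrite mulnC leq_mul2l; apply/orP; right.
have := defect_leq pc SP Pl; have := nu_defect pc l.
by move: (nuC l) (defect d C l) (rdef d C) => x y z; clear; lia.
Qed.

Lemma rdef_gt0 : (0 < rdef d C)%N.
Proof.
have [P SP] := curve_point pc; apply: leq_trans (defect_tangent pc SP) (defect_leq pc SP (tangent_self pc SP)).
Qed.

Theorem plane_curve_bound : (q <= d.-1 * d.-1)%N.
Proof.
have dE : d = d.-1.+1 by rewrite prednK // (d_gt0 pc).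
have m0 : (0 < d.-1)%N by move: d2; case: d => [|[]].
apply: (@plane_degree_arith q d.-1 (rdef d C) N (\sum_l defect d C l) _ m0 rdef_gt0) card_external _;
  rewrite -?dE.
- exact: rdef_eq pc.
- exact: card_curve_lower pc.
- exact: sum_defect pc.
- exact: weighted_defect.
Qed.

Section Equality.
Variable s : nat.
Hypotheses (sq : (s * s)%N = q) (ds : d = s.+1).

Lemma s_gt1 : (1 < s)%N. Proof. by move: q4; rewrite -sq; case: s => [|[]]. Qed.

Lemma s_pchar p : p \in [pchar K] -> (p %| s)%N.
Proof.
move=> pK; have := pchar_dvd_card pK; rewrite -sq Euclid_dvdM ?(pcharf_prime pK) //.
by case/orP.
Qed.

Lemma s_natr0 : s%:R = 0 :> K.
Proof. by have [p pp pK] := finPcharP K; apply/eqP; rewrite -(dvdn_pcharf pK) s_pchar. Qed.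

Lemma d_natr1 : d%:R = 1 :> K.
Proof. by rewrite ds -addn1 natrD s_natr0 add0r. Qed.

Lemma no_external l : (0 < nuC l)%N.
Proof.
rewrite lt0n; apply/eqP => /external_line[/eqP].
by rewrite d_natr1 oner_eq0.
Qed.

Lemma equality_count : rdef d C = s /\ (\sum_l defect d C l = N * s)%N.
Proof.
have h := weighted_defect; have e0 : #|[pred l | nuC l == 0%N]| = 0%N.
  by apply: eq_card0 => l; rewrite !inE; apply/negbTE; rewrite -lt0n no_external.
rewrite e0 muln0 subn0 ds in h.
have [] := @plane_degree_arith_eq s (rdef d C) N (\sum_l defect d C l) s_gt1; rewrite ?sq -?ds.
- exact: rdef_eq pc.
- by have := card_curve_lower pc; rewrite ds.
- exact: sum_defect pc.
- by rewrite ds.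
by move=> -> ->.
Qed.

(** Every [nuC] is positive, and weighting the defects by [nuC] does not change their sum. *)
Lemma defect_nu1 l : (0 < defect d C l)%N -> nuC l = 1%N.
Proof.
move=> dl; have [er eW] := equality_count; have := sum_defect_nu pc; rewrite er -eW => e.
have H m : (defect d C m <= defect d C m * nuC m)%N by rewrite leq_pmulr // no_external.
have : (defect d C l * nuC l = defect d C l)%N.
  apply/eqP; rewrite eqn_leq H andbT.
  have := e; rewrite (bigD1 l) //= [X in (_ = X)%N](bigD1 l) //= => e'.
  have : (\sum_(i | i != l) defect d C i <= \sum_(i | i != l) defect d C i * nuC i)%N by apply: leq_sum.
  move: e'; move: (\sum_(i | i != l) defect d C i)%N (\sum_(i | i != l) defect d C i * nuC i)%N.
  by move: (defect d C l * nuC l)%N (defect d C l) => x y z w; clear; lia.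
by move/eqP; rewrite -{2}[defect d C l]muln1 eqn_pmul2l // => /eqP.
Qed.

Lemma line_dichotomy l : nuC l = 1%N \/ nuC l = d.
Proof.
have [z|nz] := posnP (defect d C l); last by left; apply: defect_nu1.
by right; have := nu_defect pc l; rewrite z addn0.
Qed.

Lemma tangent_only P x : onC C P -> onC C x -> inc x (tangent C P) -> x = P.
Proof.
move=> SP Sx xT; have := defect_nu1 (defect_tangent pc SP).
rewrite /nu => /eqP; rewrite -[X in X == _]cardsE => /cards1P[y /setP ey].
have : x \in [set y] by rewrite -ey !inE xT.
have : P \in [set y] by rewrite -ey !inE (tangent_self pc SP).
by rewrite !inE => /eqP -> /eqP.
Qed.

Lemma tangent_unique P l : onC C P -> inc P l -> nuC l = 1%N -> l = tangent C P.
Proof.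
move=> SP Pl n1; apply/eqP; apply/negPn/negP => ne.
have [er _] := equality_count; have := sum_defect_on pc SP.
rewrite er (bigD1 l) //= (bigD1 (tangent C P)) /=; last by rewrite (tangent_self pc SP) eq_sym.
have -> : defect d C l = s by rewrite /defect n1 ds subn1.
have := defect_tangent pc SP; move: (\sum_(_ | _) _)%N (defect d C (tangent C P)) => x y.
by clear; lia.
Qed.

(** The defects of the lines through [x] sum to s + q = s (s + 1) and each of them is 0 or s; a
    tangent determines its point of contact. *)
Lemma card_feet x : ~~ onC C x -> #|[pred P | onC C P && inc x (tangent C P)]| = s.+1.
Proof.
move=> nx; have [er _] := equality_count.
have := sum_defect_pencil pc x; rewrite (negPf nx) muln0 addn0 -(rdef_eq pc) er => e.
have {}e : (\sum_(l | inc x l) defect d C l = s + q)%N.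
  by move: e; move: (\sum_(_ | _) _)%N N #|K| => a b c; clear; lia.
have : (s * #|[pred l | inc x l && (nuC l == 1%N)]| = s + q)%N.
  rewrite -e (bigID (fun l => nuC l == 1%N)) /= [X in (_ + X)%N]big1 ?addn0 => [|l /andP[_ n1]].
    rewrite mulnC -sum_nat_const; apply: eq_big => [l|l]; first by rewrite inE.
    by rewrite inE /defect => /andP[_ /eqP ->]; rewrite ds subn1.
  by case: (line_dichotomy l) n1 => [->|] // e1 _; rewrite /defect e1 subnn.
rewrite -sq -mulSn [(s.+1 * s)%N]mulnC => /eqP; rewrite eqn_pmul2l ?(ltnW s_gt1) // => /eqP <-.
pose D := [set P | onC C P && inc x (tangent C P)].
have inj : {in D &, injective (tangent C)}.
  move=> P P'; rewrite !inE => /andP[SP _] /andP[SP' _] eT.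
  by apply: (tangent_only SP' SP); rewrite -eT (tangent_self pc SP).
transitivity #|D|; first by apply: eq_card => P; rewrite !inE.
rewrite -(card_in_imset inj); apply: eq_card => l; rewrite !inE.
apply/imsetP/andP => [[P]|[xl /eqP n1]].
  rewrite inE => /andP[SP xT] ->; split=> //; apply/eqP/defect_nu1; exact: (defect_tangent pc).
have : (0 < nuC l)%N by rewrite n1.
case/card_gt0P => P; rewrite inE => /andP[Pl SP].
by exists P; rewrite ?inE ?SP -(tangent_unique SP Pl n1).
Qed.

End Equality.
End Curve.
End PlaneCurveBound.

(** * Plane curves of degree s + 1 over a field of order s^2 *)

Section PlaneCurveEquality.
Variable K : finFieldType.
Local Notation q := #|K|.
Local Notation vec := 'rV[K]_3.
Local Notation pt := (pt K).

Lemma onCE (H : {mpoly K[3]}) x : onC H x = (ev H (val x) == 0). Proof. by []. Qed.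

Lemma poly_all_roots (f : {poly K}) : (size f <= q)%N -> (forall t, f.[t] = 0) -> f = 0.
Proof.
move=> sf f0; apply/eqP; apply/negPn/negP => nz.
have := card_roots_leq nz; rewrite (eq_card (B := K)) => [|t]; last by rewrite !inE rootE f0 eqxx.
by rewrite ltnNge sf.
Qed.

Lemma mderiv_sum n i I r (P : pred I) (f : I -> {mpoly K[n]}) :
  (\sum_(j <- r | P j) f j)^`M(i) = \sum_(j <- r | P j) (f j)^`M(i).
Proof. exact: raddf_sum. Qed.

Lemma mder_comm n u v (F : {mpoly K[n]}) : mder u (mder v F) = mder v (mder u F).
Proof.
rewrite /mder; under eq_bigr => i _ do rewrite mderiv_sum scaler_sumr.
rewrite exchange_big; apply: eq_bigr => j _; rewrite [in RHS]mderiv_sum [in RHS]scaler_sumr.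
by apply: eq_bigr => i _; rewrite /= !mderivZ mderiv_comm !scalerA mulrC.
Qed.

Lemma mder_add n v (F H : {mpoly K[n]}) : mder v (F + H) = mder v F + mder v H.
Proof. by rewrite /mder -big_split; apply: eq_bigr => i _; rewrite mderivD scalerDr. Qed.

Lemma mder_scale n v c (F : {mpoly K[n]}) : mder v (c *: F) = c *: mder v F.
Proof. by rewrite /mder scaler_sumr; apply: eq_bigr => i _; rewrite mderivZ !scalerA mulrC. Qed.

Lemma mder_frob n v (F : {mpoly K[n]}) : mder v (frob F) = frob (mder v F).
Proof.
have dXq i j : ('X_i ^+ q : {mpoly K[n]})^`M(j) = 0.
  have [p pp pK] := finPcharP K.
  rewrite mpolyXn mderivX mulmnE natrM.
  have -> : q%:R = 0 :> K by apply/eqP; rewrite -(dvdn_pcharf pK) pchar_dvd_card.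
  by rewrite mulr0 scale0r.
rewrite /frob /mder.
under eq_bigr => j _ do rewrite mderiv_sum scaler_sumr.
rewrite exchange_big; apply: eq_bigr => i _; rewrite [in RHS]mderiv_sum [in RHS]mulr_sumr.
apply: eq_bigr => j _ /=; rewrite mderivM dXq mul0r add0r mderivZ.
by rewrite mderiv_comm scalerAr.
Qed.

Section Curve.
Variables (d : nat) (C G : {mpoly K[3]}) (s : nat).
Hypothesis pc : plane_curve d C G.
Hypotheses (sq : (s * s)%N = q) (ds : d = s.+1).
Let pC := pc_prime pc. Let hC : C \is d.-homog := pc_homog pc. Let CG := pc_frob pc.
Let d2 := pc_deg pc. Let q4 := pc_card pc. Let dq := pc_bound pc.
Local Notation onC := (onC C).
Local Notation nuC := (nu onC).
Local Notation T P := (grad C (val P)).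

Let dK : d%:R = 1 :> K. Proof. exact: d_natr1 sq ds. Qed.

Let s_lt_q : (s < q)%N.
Proof. by have := d_lt_q pc; rewrite ds => /ltnW. Qed.

Lemma off_neq0 v : ev C v != 0 -> v != 0.
Proof. by apply: contraNneq => ->; rewrite (ev_homog0 (d_gt0 pc) hC). Qed.

Lemma tangent_on_multiple P v : onC P -> dot (T P) v = 0 -> ev C v = 0 -> exists c, v = c *: val P.
Proof.
move=> SP Tv Cv; have [->|v0] := eqVneq v 0; first by exists 0; rewrite scale0r.
have [c c0 e] := mkptP v0.
have xP : mkpt v = P.
  apply: (tangent_only pc sq ds SP); first by rewrite (onC_mkpt pc) // Cv.
  by rewrite (inc_tangent pc) // e dotZr Tv mulr0.
by exists c^-1; rewrite -xP e scalerA mulVf // scale1r.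
Qed.

Lemma tangent_addZ P Q t : onC P -> dot (T P) Q = 0 -> ev C Q != 0 -> ev C (Q + t *: val P) != 0.
Proof.
move=> SP TQ CQ; apply/eqP => z.
have TP : dot (T P) (val P) = 0 by have := tangent_self pc SP; rewrite (inc_tangent pc) // => /eqP.
have [|c e] := tangent_on_multiple SP _ z; first by rewrite dotDr dotZr TQ TP mulr0 addr0.
case/eqP: CQ; rewrite -[Q](addrK (t *: val P)) e -scalerBl (ev_homogZ _ _ hC).
by rewrite (eqP SP) mulr0.
Qed.

(** [P] is the only point of [C] on its tangent, so X -> C(Q + X P) has no rational zero and its
    derivative vanishes. *)
Lemma foot_on_polar P Q : onC P -> dot (T P) Q = 0 -> ev C Q != 0 -> dot (grad C Q) (val P) = 0.
Proof.
move=> SP TQ CQ; have := line_no_zero hC CG (fun t => tangent_addZ t SP TQ CQ).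
by rewrite deriv_lp -ev_mder => /(congr1 (horner^~ 0)); rewrite horner0 horner_lp scale0r addr0.
Qed.

Lemma mderP_on_tangent P v : onC P -> dot (T P) v = 0 -> ev (mder (val P) C) v = 0.
Proof.
move=> SP Tv; have [Cv|Cv] := eqVneq (ev C v) 0; last by rewrite ev_mder foot_on_polar.
have [c ->] := tangent_on_multiple SP Tv Cv.
by rewrite (ev_homogZ _ _ (dhomog_mder _ hC)) (ev_Euler _ hC) (eqP SP) mul0rn mulr0.
Qed.

Lemma TPP P : onC P -> dot (T P) (val P) = 0.
Proof. by move=> SP; have := tangent_self pc SP; rewrite (inc_tangent pc) // => /eqP. Qed.

(** The derivative of [C] along [P] has degree s < q and vanishes on the tangent at [P]; as d = 1 in
    [K], Euler's relation reduces to f = X f'. *)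
Lemma lp_tangent P Q : onC P -> dot (T P) Q = 0 -> ev C Q != 0 ->
  lp (val P) Q C = 'X * (lp (val P) Q C)^`().
Proof.
move=> SP TQ CQ; have := lp_Euler (val P) Q hC; rewrite -mulr_natr.
have -> : d%:R = 1 :> {poly K} by rewrite -polyC_natr dK.
rewrite mulr1 => {1}->.
suff -> : lp (val P) Q (mder (val P) C) = 0 by rewrite add0r.
apply: poly_all_roots => [|t].
  by apply: leq_trans (lp_top _ _ (dhomog_mder _ hC)).1 _; rewrite ds.
by rewrite horner_lp mderP_on_tangent // dotDr dotZr TPP // TQ mulr0 addr0.
Qed.

Lemma lp_tangent_cofactor P Q : onC P -> dot (T P) Q = 0 -> ev C Q != 0 ->
  lp (val P) Q G = 'X^(q.-1).
Proof.
move=> SP TQ CQ; have eX := lp_tangent SP TQ CQ.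
have f0 : lp (val P) Q C != 0 by rewrite -size_poly_gt0 (size_lp _ hC CQ).
have := lp_frob (val P) Q hC; rewrite CG rmorphM /= -mulr_natr.
have -> : d%:R = 1 :> {poly K} by rewrite -polyC_natr dK.
rewrite mulr1 mulrBl -eX addrCA subrr addr0 -{1}(prednK (ltnW (card_field_gt1 K))) exprSr.
by rewrite -mulrA -eX mulrC => /(mulIf f0).
Qed.

(* The restriction [f] of [C] to a tangent [T_P] through [Q] satisfies [f = X f'], hence [f'' = 0]:
   the second derivative, of degree [s - 1], is divisible by [s + 1] lines. *)
Lemma second_deriv_off Q : ev C Q != 0 -> mder Q (mder Q C) = 0.
Proof.
move=> CQ; apply/eqP; apply/negPn/negP => nz; have Q0 := off_neq0 CQ.
have nx : ~~ onC (mkpt Q) by rewrite (onC_mkpt pc).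
have cf := card_feet pc sq ds nx.
pose D := [set P | onC P && inc (mkpt Q) (tangent C P)].
have inj : {in D &, injective (tangent C)}.
  move=> P P'; rewrite !inE => /andP[SP _] /andP[SP' _] eT.
  by apply: (tangent_only pc sq ds SP' SP); rewrite -eT (tangent_self pc SP).
have cD : #|tangent C @: D| = s.+1.
  by rewrite card_in_imset // -cf; apply: eq_card => P; rewrite !inE.
have hD : mder Q (mder Q C) \is s.-1.-homog.
  by have := dhomog_mder Q (dhomog_mder Q hC); rewrite ds.
have := size_lin_divisors (enum_uniq (mem (tangent C @: D))) nz hD; rewrite -cardE cD.
suff H : forall l, l \in enum (tangent C @: D) -> mdvd (lin (val l)) (mder Q (mder Q C)).
  by move/(_ H); have := s_gt1 pc sq; clear; lia.
move=> l; rewrite mem_enum => /imsetP[P]; rewrite inE => /andP[SP QT] ->.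
have [c c0 eT] := tangentP pc SP.
have TQ : dot (T P) Q = 0.
  by move: QT; rewrite inc_mkpt // eT dotC dotZr mulf_eq0 (negPf c0) dotC => /eqP.
apply: (lin_dvd_homog (pt_neq0 _) hD) => [|v].
  by apply: leq_trans (leq_pred _) (ltnW s_lt_q).
rewrite eT dotC dotZr dotC => /eqP; rewrite mulf_eq0 (negPf c0) /= => /eqP Tv.
have z : lp (val P) Q (mder Q (mder Q C)) = 0.
  rewrite -!deriv_lp; have := congr1 (@deriv K) (lp_tangent SP TQ CQ).
  rewrite derivM derivX mul1r => /eqP; rewrite -subr_eq0 opprD addNKr oppr_eq0 mulf_eq0 polyX_eq0.
  by move/eqP.
have iPQ : indep (val P) Q.
  apply: indepPn => // k; apply: contraNneq CQ => e.
  have k0 : k != 0 by apply: contraNneq (pt_neq0 P) => zk; rewrite e zk scale0r.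
  by have := SP; rewrite onCE e (ev_homogZ _ _ hC) mulf_eq0 expf_eq0 (negPf k0) andbF.
have [c1 [c2 ->]] := span_line (curve_smooth pc SP) iPQ (TPP SP) TQ Tv.
have [->|c10] := eqVneq c1 0.
  rewrite scale0r add0r (ev_homogZ _ _ hD) -(lp_top (val P) Q hD).2 z coef0 mulr0 //.
have -> : c1 *: val P + c2 *: Q = c1 *: (val P + (c2 / c1) *: Q).
  by rewrite scalerDr scalerA mulrCA divff // mulr1.
by rewrite (ev_homogZ _ _ hD) -horner_lp z horner0 mulr0.
Qed.

(* [mder Q C] has degree [s] and vanishes at the [s + 1] points of contact of the tangents
   through [Q], all of which lie on the polar line of [Q]. *)
Lemma polar_vanish Q v : ev C Q != 0 -> dot (grad C Q) v = 0 -> ev (mder Q C) v = 0.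
Proof.
move=> CQ; have Q0 := off_neq0 CQ.
have g0 : grad C Q != 0.
  apply/eqP => g0; have := ev_Euler Q hC; rewrite ev_mder g0 dotC dot0r -mulr_natr dK mulr1.
  by move=> z; rewrite -z eqxx in CQ.
have hD : mder Q C \is s.-homog by have := dhomog_mder Q hC; rewrite ds.
have nx : ~~ onC (mkpt Q) by rewrite (onC_mkpt pc).
have [c c0 eg] := mkptP g0.
move=> gv; apply: (line_many_zeros (l := mkpt (grad C Q)) hD); last first.
  by rewrite eg dotC dotZr dotC gv mulr0.
have := card_feet pc sq ds nx => cf; rewrite -ltnS in cf *.
rewrite ltnS -cf; apply: subset_leq_card; apply/subsetP => P; rewrite !inE => /andP[SP QT].
have TQ : dot (T P) Q = 0.
  have [c' c0' eT] := tangentP pc SP.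
  by move: QT; rewrite inc_mkpt // eT dotC dotZr mulf_eq0 (negPf c0') dotC => /eqP.
rewrite inc_sym inc_mkpt // dotC foot_on_polar // eqxx /=.
by rewrite onCE ev_mder TQ eqxx.
Qed.

Lemma hessian_tangent P Q v : onC P -> dot (T P) Q = 0 -> ev C Q != 0 ->
  ev (mder v (mder Q C)) (val P) = 0.
Proof.
move=> SP TQ CQ.
have gQ : dot (grad C Q) Q = ev C Q by rewrite -ev_mder (ev_Euler _ hC) -mulr_natr dK mulr1.
(* [v] is split into a multiple of [Q], covered by [second_deriv_off], and a vector on the polar
   line of [Q], along which [mder Q C] vanishes. *)
pose w := v - (dot (grad C Q) v / ev C Q) *: Q.
have gw : dot (grad C Q) w = 0 by rewrite /w -scaleNr dotDr dotZr gQ mulNr divfK // subrr.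
have -> : v = (dot (grad C Q) v / ev C Q) *: Q + w by rewrite addrC subrK.
rewrite mder_linear second_deriv_off // scaler0 add0r -(lp_coef1 _ w).
suff -> : lp (val P) w (mder Q C) = 0 by rewrite coef0.
apply: poly_all_roots => [|t].
  by apply: leq_trans (lp_top _ _ (dhomog_mder _ hC)).1 _; rewrite ds.
by rewrite horner_lp polar_vanish // dotDr dotZr gw mulr0 addr0 foot_on_polar.
Qed.

(** A tangent vector on [C] is a multiple of [P], and adding [Q] moves it off [C]; this covers the
    directions in T_P. The remaining one is given by a [U] off both [C] and T_P, where
    [second_deriv_off] applies. *)
Lemma hessian_zero P u v : onC P -> ev (mder v (mder u C)) (val P) = 0.
Proof.
move=> SP; have [Q [Q0 lQ CQ]] := line_off pc (tangent C P).
have TQ : dot (T P) Q = 0.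
  have [c c0 eT] := tangentP pc SP.
  by move: lQ; rewrite eT dotC dotZr dotC => /eqP; rewrite mulf_eq0 (negPf c0) => /eqP.
have tan w w' : dot (T P) w = 0 -> ev (mder w' (mder w C)) (val P) = 0.
  move=> Tw; have [Cw|Cw] := eqVneq (ev C w) 0; last exact: hessian_tangent.
  have Cw' : ev C (w + Q) != 0.
    by have [c ->] := tangent_on_multiple SP Tw Cw; rewrite addrC tangent_addZ.
  have := hessian_tangent w' SP (_ : dot (T P) (w + Q) = 0) Cw'.
  by rewrite mderD mder_add evD (hessian_tangent w' SP TQ CQ) addr0; apply; rewrite dotDr Tw TQ addr0.
have [U [CU TU]] : exists U, ev C U != 0 /\ dot (T P) U != 0.
  have [/existsP[U]|/existsPn h] := boolP [exists U : vec, ev (C * lin (T P)) U != 0].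
    by rewrite evM ev_lin mulf_eq0 negb_or => /andP[CU TU]; exists U.
  have : C * lin (T P) = 0.
    apply: homog_vanish (dhomogM hC (dhomog_lin _)) _ _; first by rewrite addn1 (d_lt_q pc).
    by move=> x; apply/eqP/negbNE/h.
  by move/eqP; rewrite mulf_eq0 (negPf (C_neq0 pc)) lin_eq0 (negPf (curve_smooth pc SP)).
have dec x : exists c w, x = c *: U + w /\ dot (T P) w = 0.
  exists (dot (T P) x / dot (T P) U), (x - (dot (T P) x / dot (T P) U) *: U).
  by rewrite addrC subrK -scaleNr dotDr dotZr mulNr divfK // subrr.
have [c [w [-> Tw]]] := dec u; have [c' [w' [-> Tw']]] := dec v.
rewrite mder_linear !mder_linear mder_add !mder_scale mder_add !mder_scale second_deriv_off //.
rewrite !scaler0 add0r !evD !evZ (tan w) // (mder_comm w' U) !(tan w') //.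
by rewrite (tan w) // !mulr0 !addr0.
Qed.

(** Otherwise all lines through [x] are tangents and [C] has q + 1 points; but rdef = s gives s^3 +
    1 of them. *)
Lemma secant_through x : ~~ onC x -> exists2 l, inc x l & nuC l = d.
Proof.
move=> nx; have [/existsP[l /andP[xl /eqP h]]|/existsPn h] := boolP [exists l, inc x l && (nuC l == d)].
  by exists l.
have n1 l : inc x l -> nuC l = 1%N.
  by move=> xl; case: (line_dichotomy pc sq ds l) => // e; have := h l; rewrite xl e eqxx.
have := sum_pencil_nu onC x; rewrite (negPf nx) muln0 addn0 (eq_bigr (fun=> 1%N)) // sum1_card card_pencil.
have [er _] := equality_count pc sq ds; have := rdef_eq pc; rewrite er -sq ds.
rewrite (_ : #|[pred x | onC x]| = #|onC|) //.
by have := s_gt1 pc sq; move: #|onC| => y; case: s => // z; clear; nia.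
Qed.

(** A second derivative has degree s - 1 and vanishes on [C]; it vanishes on every secant, which has
    s + 1 points of [C], and each point off [C] is on a secant. *)
Lemma second_derivs_zero u v : mder v (mder u C) = 0.
Proof.
have hD : mder v (mder u C) \is s.-1.-homog.
  by have := dhomog_mder v (dhomog_mder u hC); rewrite ds.
apply: (homog_vanish hD); first by apply: leq_trans (leq_pred _) (ltnW s_lt_q).
move=> x; have [x0|x0] := eqVneq x 0.
  have := hessian_zero; rewrite x0; have [P SP] := curve_point pc.
  case es : s.-1 hD => [|k] hD _; last by rewrite (ev_homog0 _ hD).
  by have := hessian_zero u v SP; rewrite (dhomog0C hD) !evC.
have [Sx|nx] := boolP (onC (mkpt x)).
  have [c c0 e] := mkptP x0; have := hessian_zero u v Sx; rewrite e (ev_homogZ _ _ hD) => /eqP.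
  by rewrite mulf_eq0 expf_eq0 (negPf c0) andbF => /eqP.
have [l xl nl] := secant_through nx.
apply: (line_many_zeros (l := l) hD); last by move: xl; rewrite inc_mkpt // => /eqP.
apply: (@leq_trans (nuC l)); first by rewrite nl ds; have := s_gt1 pc sq; clear; lia.
apply: subset_leq_card; apply/subsetP => P; rewrite !inE => /andP[-> SP] /=.
by rewrite onCE hessian_zero.
Qed.

(** Applying [mder Q] to [frob C] gives [frob (mder Q C)], which is 0; so C divides (mder Q C) G,
    and it cannot divide the first factor for reasons of degree. *)
Lemma curve_dvd_cofactor : mdvd C G.
Proof.
have [Q [CQ dQ]] := derivable_off pc; have [C0 Cu Cp] := pC.
have : mder Q (C * G) = 0.
  rewrite -CG mder_frob /frob big1 // => i _; rewrite -mder_delta second_derivs_zero mulr0 //.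
rewrite mderM => /eqP; rewrite addr_eq0 => /eqP e.
have : rdvd C (mder Q C * G) by exists (- mder Q G); rewrite e mulrN.
case/Cp => // dv; case: (not_mdvd_small hC (dhomog_mder Q hC) dQ _ dv).
by rewrite ds.
Qed.

(** On the tangent g = X^(q-1), and f divides g since [C] divides [G]; so f is the monomial C(Q)
    X^d. *)
Lemma const_along_tangent P Q c : onC P -> dot (T P) Q = 0 -> ev C Q != 0 ->
  ev C (Q + c *: val P) = ev C Q.
Proof.
move=> SP TQ CQ; have [G' eG] := curve_dvd_cofactor.
have := lp_tangent_cofactor SP TQ CQ; rewrite eG rmorphM /= => e.
have [|k [c' [_ ef]]] := @poly_factor_monomial K q.-1 1 _ _ (oner_neq0 _) (etrans e _).
  by rewrite mul1r.
have sf := size_lp (val P) hC CQ; have [_ ftop] := lp_top (val P) Q hC.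
have c0 : c' != 0 by apply: contraTneq isT => z; move: sf; rewrite ef z mul0r size_poly0.
have kd : k = d by move: sf; rewrite ef size_Cmul // size_polyXn => -[].
have ec : c' = ev C Q by rewrite -ftop ef kd coefCM coefXn eqxx mulr1.
have [->|nz] := eqVneq c 0; first by rewrite scale0r addr0.
have -> : Q + c *: val P = c *: (val P + c^-1 *: Q).
  by rewrite scalerDr scalerA divff // scale1r addrC.
rewrite (ev_homogZ _ _ hC) -horner_lp ef kd ec hornerM hornerC hornerXn mulrCA -exprMn divff //.
by rewrite expr1n mulr1.
Qed.

Lemma const_on_tangent P Q Q' : onC P -> dot (T P) Q = 0 -> ev C Q != 0 ->
  dot (T P) Q' = 0 -> ev C Q' != 0 -> ev C Q ^+ s.-1 = ev C Q' ^+ s.-1.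
Proof.
move=> SP TQ CQ TQ' CQ'.
have iPQ : indep (val P) Q.
  apply: indepPn (off_neq0 CQ) _ => k; apply: contraNneq CQ => e.
  have k0 : k != 0 by apply: contraNneq (pt_neq0 P) => zk; rewrite e zk scale0r.
  by have := SP; rewrite onCE e (ev_homogZ _ _ hC) mulf_eq0 expf_eq0 (negPf k0) andbF.
have [c1 [c2 e]] := span_line (curve_smooth pc SP) iPQ (TPP SP) TQ TQ'.
have c20 : c2 != 0.
  apply: contraNneq CQ' => z; rewrite e z scale0r addr0 (ev_homogZ _ _ hC) (eqP SP) mulr0 //.
have -> : Q' = c2 *: (Q + (c1 / c2) *: val P).
  by rewrite e scalerDr scalerA mulrCA divff // mulr1 addrC.
rewrite (ev_homogZ _ _ hC) const_along_tangent // exprMn -exprM.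
have -> : (d * s.-1 = q.-1)%N.
  by rewrite ds -sq; have := s_gt1 pc sq; clear; case: s => // k _; rewrite /= ; lia.
have -> : c2 ^+ q.-1 = 1.
  by apply: (mulfI c20); rewrite -exprS prednK ?(ltnW (card_field_gt1 K)) // expf_card mulr1.
by rewrite mul1r.
Qed.

Theorem plane_curve_const Q Q' : ev C Q != 0 -> ev C Q' != 0 -> ev C Q ^+ s.-1 = ev C Q' ^+ s.-1.
Proof.
have foot x : ev C x != 0 -> exists2 P, onC P & dot (T P) x = 0.
  move=> Cx; have x0 := off_neq0 Cx.
  have : (0 < #|[pred P | onC P && inc (mkpt x) (tangent C P)]|)%N.
    by rewrite (card_feet pc sq ds) // (onC_mkpt pc).
  case/card_gt0P => P; rewrite inE => /andP[SP xT]; exists P => //.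
  have [c c0 eT] := tangentP pc SP.
  by move: xT; rewrite inc_mkpt // eT dotC dotZr mulf_eq0 (negPf c0) dotC => /eqP.
move=> CQ CQ'; have [P SP TQ] := foot Q CQ; have [P' SP' TQ'] := foot Q' CQ'.
have [eP|nP] := eqVneq P P'; first by apply: (const_on_tangent SP) => //; rewrite eP.
have [R] := join_exists (tangent C P) (tangent C P'); rewrite ![inc _ R]inc_sym => /andP[R1 R2].
(* A common point of the two tangents on [C] would be the point of contact of both. *)
have CR : ev C (val R) != 0.
  apply: contraNN nP => CR; have e1 := tangent_only pc sq ds SP CR R1.
  by have e2 := tangent_only pc sq ds SP' CR R2; rewrite -e1 -e2.
rewrite !(inc_tangent pc) // in R1 R2.
rewrite (const_on_tangent SP TQ CQ (eqP R1) CR).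
by rewrite -(const_on_tangent SP' TQ' CQ' (eqP R2) CR).
Qed.

End Curve.
End PlaneCurveEquality.

(** * Plane sections, and the bound for reduced hypersurfaces *)

Section PlaneSections.
Variable K : finFieldType.
Local Notation q := #|K|.

Lemma frobM n (F H : {mpoly K[n]}) : frob (F * H) = frob F * H + F * frob H.
Proof.
rewrite /frob mulr_suml mulr_sumr -big_split; apply: eq_bigr => i _ /=.
by rewrite mderivM; ring.
Qed.

Lemma unit_ev_neq0 n (F : {mpoly K[n]}) v : F \is a GRing.unit -> ev F v != 0.
Proof. by move/(rmorph_unit (meval (v 0))); rewrite unitfE. Qed.

Lemma irreducible_factor_at n (F : {mpoly K[n]}) v : F != 0 -> ev F v = 0 ->
  exists C H, [/\ F = C * H, rirr C & ev C v = 0].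
Proof.
have [N] := ubnP (msize F); elim: N F => // N IH F sN F0 Fv.
have Fu : F \isn't a GRing.unit by apply/negP => /(unit_ev_neq0 v); rewrite Fv eqxx.
have [irF|nirF] := Classical_Prop.classic (rirr F).
  by exists F, 1; rewrite mulr1.
have [b [c [e bu cu]]] : exists b c, [/\ F = b * c, b \isn't a GRing.unit & c \isn't a GRing.unit].
  apply: Classical_Prop.NNPP => no; apply: nirF; split=> // b c e.
  have [bu|bu] := boolP (b \is a GRing.unit); [by left|right].
  by apply/negPn/negP => cu; apply: no; exists b, c.
wlog bv : b c e bu cu / ev b v = 0.
  move=> wl; have : (ev b v == 0) || (ev c v == 0) by rewrite -mulf_eq0 -evM -e Fv.
  case/orP=> /eqP h; first by apply: (wl b c).
  by apply: (wl c b) => //; rewrite mulrC.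
have /andP[b0 c0] : (b != 0) && (c != 0) by rewrite -negb_or -mulf_eq0 -e.
move: bu cu; rewrite !mpoly_unit_msize // -!ltnNge => sb sc.
have sF := msizeM b0 c0; rewrite -e in sF.
have aux x y z : x = (y + z).-1 -> (1 < y -> 1 < z -> x < N.+1 -> y < N)%N by lia.
have [//|//|C [H [eb irC Cv]]] := IH b (aux _ _ _ sF sb sc sN).
by exists C, (H * c); rewrite mulrA -eb.
Qed.

Lemma gradM_zero n (F H : {mpoly K[n]}) v : ev F v = 0 -> grad (F * H) v = ev H v *: grad F v.
Proof.
move=> Fv; apply/rowP => i; rewrite !mxE mderivM evD !evM Fv mul0r addr0 mulrC //.
Qed.

(** By smoothness at [v] the cofactor [H] is nonzero there. [C] divides (frob C) H, so it divides
    [frob C]: the component through [v] inherits the nonclassical property. *)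
Lemma prime_factor_at n d (F G : {mpoly K[n]}) v : F \is d.-homog -> frob F = F * G ->
  ev F v = 0 -> grad F v != 0 ->
  exists C H GC e, [/\ F = C * H, rprime C, C \is e.-homog, H \is (d - e).-homog &
    [/\ (0 < e <= d)%N, ev C v = 0, ev H v != 0 & frob C = C * GC]].
Proof.
move=> hF FG Fv gF; have F0 : F != 0.
  apply: contraNneq gF => ->; apply/eqP/rowP => i; by rewrite !mxE mderiv0 ev0.
have [C [H [e irC Cv]]] := irreducible_factor_at F0 Fv; have pC := mpoly_rirr_prime irC.
rewrite e in F0 hF FG gF.
have [k [kd hC hH]] := dhomog_factor F0 hF.
have Hv : ev H v != 0 by apply: contraNneq gF => z; rewrite gradM_zero // z scale0r.
have [C0 Cu Cp] := pC.
have : rdvd C (frob C * H).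
  by exists (H * G - frob H); rewrite mulrBr mulrA -FG frobM; ring.
case/Cp => [[GC eGC]|[k' ek]]; last by rewrite ek evM Cv mul0r eqxx in Hv.
exists C, H, GC, k; split=> //; split=> //; rewrite kd andbT lt0n; apply/eqP => k0.
rewrite k0 in hC; move: Cv; rewrite (dhomog0C hC) evC => z.
by move: C0; rewrite (dhomog0C hC) z mpolyC0 eqxx.
Qed.

Lemma dhomog1_lin n (F : {mpoly K[n]}) : F \is 1.-homog -> exists l, F = lin l.
Proof.
move=> hF; exists (\row_i F@_U_(i)); apply/mpolyP => m; rewrite /lin raddf_sum /=.
have [/eqP|m1] := eqVneq (mdeg m) 1%N.
  rewrite mdeg_eq1 => /existsP[i /eqP ->]; rewrite (bigD1 i) //= big1 ?addr0 => [|j /negPf nj].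
    by rewrite mcoeffZ mcoeffX eqxx mulr1 mxE.
  by rewrite mcoeffZ mcoeffXU nj mulr0.
rewrite (dhomog_nemf_coeff hF) // big1 // => i _; rewrite mcoeffZ mcoeffX; case: eqP => [e|_].
  by rewrite -e mdeg1 eqxx in m1.
by rewrite mulr0.
Qed.

Lemma dot_grad_lsub m n (B : 'M[K]_(m, n)) F v u :
  dot (grad (lsub B F) v) u = dot (grad F (v *m B)) (u *m B).
Proof. by rewrite -!ev_mder mder_lsub ev_lsub. Qed.

(** [u0] makes the section smooth at [x]. If its component through [x] is a line, this line is the
    tangent of the section. Otherwise its degree e satisfies q <= (e - 1)^2, which with (d - 1)^2 <=
    q forces e = d and a constant cofactor. *)
Lemma section_dichotomy n d (F G : {mpoly K[n]}) (B : 'M[K]_(3, n)) (x u0 : 'rV[K]_3) :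
  F \is d.-homog -> frob F = F * G -> (4 <= q)%N -> (d.-1 * d.-1 <= q)%N ->
  ev F (x *m B) = 0 -> dot (grad F (x *m B)) (u0 *m B) != 0 ->
  (forall u : 'rV[K]_3, dot (grad F (x *m B)) (u *m B) = 0 -> ev F (u *m B) = 0) \/
  ((q <= d.-1 * d.-1)%N /\
   exists C GC c, [/\ c != 0, lsub B F = c *: C & plane_curve d C GC]).
Proof.
move=> hF FG q4 dq Fx gu0.
have hF0 := lsub_homog B hF.
have FG0 : frob (lsub B F) = lsub B F * lsub B G by rewrite frob_lsub FG rmorphM.
have Fx0 : ev (lsub B F) x = 0 by rewrite ev_lsub.
have gx : grad (lsub B F) x != 0.
  by apply: contraNneq gu0 => z; rewrite -dot_grad_lsub z dotC dot0r.
have [C [H [GC [e [eF pC hC hH [/andP[e0 ed] Cx Hx CG]]]]]] := prime_factor_at hF0 FG0 Fx0 gx.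
have [e1|e1] := leqP e 1.
  left=> u; have {e0 e1}e1 : e = 1%N by apply/eqP; rewrite eqn_leq e1.
  rewrite -dot_grad_lsub -ev_lsub eF gradM_zero // dotC dotZr dotC => /eqP.
  rewrite e1 in hC; have [l el] := dhomog1_lin hC.
  rewrite mulf_eq0 (negPf Hx) /= evM el -ev_mder /mder ev_sum => /eqP h.
  suff -> : ev (lin l) u = 0 by rewrite mul0r.
  by rewrite ev_lin -[RHS]h; apply: eq_bigr => i _; rewrite mderiv_lin evZ evC mulrC.
right; have le : (e.-1 * e.-1 <= d.-1 * d.-1)%N by apply: leq_mul; rewrite -!subn1 leq_sub2r.
have pcC : plane_curve e C GC by split=> //; apply: leq_trans le dq.
have qe := plane_curve_bound pcC; have qd := leq_trans qe le; split=> //.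
have ede : e = d.
  have : (d.-1 * d.-1 <= e.-1 * e.-1)%N by apply: leq_trans dq qe.
  have aux a b : (a * a <= b * b -> a <= b)%N by move=> h; rewrite leqNgt; apply/negP => ?; nia.
  by move/aux; move: e1 ed; clear; lia.
rewrite ede subnn in hH; have eH := dhomog0C hH; rewrite ede in pcC.
exists C, GC, (H@_0%MM); split=> //; last by rewrite eF {1}eH mulrC mul_mpolyC.
by move: Hx; rewrite {1}eH evC.
Qed.

Definition squarefree n (F : {mpoly K[n]}) := forall H, mdvd (H ^+ 2) F -> (msize H <= 1)%N.

(** Without zeros every restriction to a line has zero derivative. So the partial derivatives vanish
    at each rational point (in the direction of the point itself, by Euler and d = 0 in [K]), and
    [F] is a p-th power. *)
Lemma squarefree_has_zero n d (F G : {mpoly K[n]}) : (2 < n)%N -> F != 0 -> F \is d.-homog ->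
  (0 < d)%N -> (d <= q)%N -> frob F = F * G -> squarefree F ->
  exists2 v, v != 0 & ev F v = 0.
Proof.
move=> n3 F0 hF d0 dq FG red.
have [/existsP[v /andP[v0 /eqP Fv]]|/existsPn h] := boolP [exists v : 'rV[K]_n, (v != 0) && (ev F v == 0)].
  by exists v.
have off v : v != 0 -> ev F v != 0 by move=> v0; have := h v; rewrite v0.
have [p pp pK] := finPcharP K.
have key a b : indep a b -> ev (mder b F) a = 0 /\ d%:R = 0 :> K.
  move=> iab; have b0 := indep_neq0r iab; have offt t : ev F (a + t *: b) != 0 by apply: off; apply: indep_addZ.
  split; last exact: line_no_zero_deg hF FG (off b b0) offt.
  by rewrite -(lp_coef0 a b) -deriv_lp (line_no_zero hF FG offt) coef0.
have dK : d%:R = 0 :> K.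
  by have [a [b [iab _ _]]] := kernel_indep (0 : 'rV[K]_n) n3; case: (key a b iab).
have d1 : (0 < d.-1)%N.
  by case: d dK d0 {hF dq key} => [|[|//]] // /eqP; rewrite oner_eq0.
have Fi i : F^`M(i) = 0.
  have hFi := dhomog_mderiv i hF; apply: (homog_vanish hFi); first exact: leq_trans (leq_pred _) dq.
  move=> v; have [->|v0] := eqVneq v 0; first by rewrite (ev_homog0 d1 hFi).
  rewrite -mder_delta.
  have [/existsP[c /eqP ec]|/existsPn nc] := boolP [exists c, delta_mx 0 i == c *: v].
    by rewrite ec mderZ evZ (ev_Euler _ hF) -mulr_natr dK !mulr0.
  by case: (key v (delta_mx 0 i)) => //; apply: indep_sym; apply: indepPn v0 _.
have [H eH] := mderiv0_pth_power pK Fi.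
have : (msize H <= 1)%N.
  apply: red; exists (H ^+ (p - 2)); rewrite -exprD subnKC ?prime_gt1 //.
move/msize1_polyC => eC; have : F \is 0.-homog.
  by rewrite eH eC -rmorphXn /= -alg_mpolyC; apply: rpredZ; apply: dhomog1.
by move/(dhomog_uniq F0 hF) => z; rewrite z in d0.
Qed.

Lemma kernel_meet n (l l' : 'rV[K]_n) : (2 < n)%N -> exists v, [/\ v != 0, dot l v = 0 & dot l' v = 0].
Proof.
move=> n3; have [a [b [iab la lb]]] := kernel_indep l n3.
have [z|z] := eqVneq (dot l' b) 0; first by exists b; rewrite (indep_neq0r iab).
exists (a + (- (dot l' a / dot l' b)) *: b); rewrite indep_addZ // !dotDr !dotZr la lb mulr0 addr0.
by rewrite mulNr divfK // subrr.
Qed.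

(** Otherwise F = l M with l tangent at [P], and [M] has a rational zero [R], which is off l. The
    tangent at [R] also divides [F], hence [M], and the two hyperplanes meet in a singular rational
    point. *)
Lemma tangent_not_contained n d (F G : {mpoly K[n]}) : (2 < n)%N -> F != 0 -> F \is d.-homog ->
  (1 < d)%N -> (d <= q)%N -> frob F = F * G -> squarefree F -> smooth_rational F ->
  exists P R, [/\ P != 0, ev F P = 0, dot (grad F P) R = 0 & ev F R != 0].
Proof.
move=> n3 F0 hF d1 dq FG red sm.
have [/existsP[[P R] /and4P[P0 /eqP FP /eqP gR FR]]|/existsPn h] :=
  boolP [exists z : 'rV[K]_n * 'rV[K]_n, [&& z.1 != 0, ev F z.1 == 0, dot (grad F z.1) z.2 == 0 & ev F z.2 != 0]].
  by exists P, R.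
have tan P : P != 0 -> ev F P = 0 -> mdvd (lin (grad F P)) F.
  move=> P0 FP; apply: lin_dvd_homog (sm P P0 FP) hF dq _ => R gR.
  by have := h (P, R); rewrite /= P0 FP gR !eqxx /= negbK => /eqP.
have [P P0 FP] := squarefree_has_zero n3 F0 hF (ltnW d1) dq FG red.
have [M eM] := tan P P0 FP; have g0 := sm P P0 FP; set l := grad F P in eM g0.
have M0 : M != 0 by apply: contraNneq F0 => z; rewrite eM z mulr0.
have hM : M \is d.-1.-homog by apply: dhomog_lin_cofactor M0 g0 _; rewrite -eM.
have MG : frob M = M * (G - lin l ^+ q.-1) by apply: frob_lin_cofactor g0 _; rewrite -eM.
have redM : squarefree M by move=> H [H' e]; apply: red; exists (lin l * H'); rewrite eM e; ring.
have d10 : (0 < d.-1)%N by move: d1; clear; lia.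
have [R R0 MR] := squarefree_has_zero n3 M0 hM d10 (leq_trans (leq_pred _) dq) MG redM.
have FR : ev F R = 0 by rewrite eM evM MR mulr0.
have smM : smooth_rational (lin l * M) by rewrite -eM.
have lR : dot l R != 0 by apply/eqP => z; apply: (not_smooth_of_common_zero smM R0 z MR).
exfalso; have := tan R R0 FR; rewrite {2}eM => /(lin_prime (sm R R0 FR))[|] [M' eM'].
  case/eqP: lR; rewrite -ev_lin eM' evM ev_lin -ev_mder (ev_Euler _ hF) FR mul0rn mul0r //.
have [v [v0 lv lv']] := kernel_meet l (grad F R) n3.
apply: (not_smooth_of_common_zero smM v0 lv).
by rewrite eM' evM ev_lin lv' mul0r.
Qed.

Theorem squarefree_degree_bound n d (F G : {mpoly K[n]}) : (2 < n)%N -> F != 0 -> F \is d.-homog ->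
  (1 < d)%N -> frob F = F * G -> squarefree F -> smooth_rational F -> (q <= d.-1 * d.-1)%N.
Proof.
move=> n3 F0 hF d1 FG red sm; rewrite leqNgt; apply/negP => lt.
have [p pp pK] := finPcharP K.
have pd := degree_gt_char pK n3 d1 F0 hF FG sm.
(* Part (i) gives p < d, so q > (d - 1)^2 >= p^2 >= 4. *)
have q4 : (4 <= q)%N.
  apply: leq_trans (ltnW lt); have := prime_gt1 pp; move: pd; clear; case: d => // e; nia.
have dq : (d <= q)%N by apply: leq_trans lt; move: d1; clear; case: d => [|[|[|e]]] //= _; nia.
have [P [R [P0 FP gR FR]]] := tangent_not_contained n3 F0 hF d1 dq FG red sm.
have [i gi] := row_neq0P _ (sm P P0 FP).
pose ei : 'rV[K]_n := delta_mx 0 i.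
pose B : 'M[K]_(3, n) := \matrix_(k < 3) [:: P; R; ei]`_k.
have eB (j : 'I_3) : delta_mx 0 j *m B = [:: P; R; ei]`_j by rewrite -rowE rowK.
have gv : dot (grad F P) ei != 0 by rewrite -ev_mder mder_delta; move: gi; rewrite mxE.
have := @section_dichotomy n d F G B (delta_mx 0 o0) (delta_mx 0 o2) hF FG q4 (ltnW lt).
rewrite !eB => /(_ FP gv)[h|[]]; last by rewrite leqNgt lt.
by have := h (delta_mx 0 o1); rewrite eB => /(_ gR) z; rewrite z eqxx in FR.
Qed.

End PlaneSections.

(** * The case of equality *)

Section ConstantPower.
Variable K : finFieldType.
Local Notation q := #|K|.

Lemma const_of_plane_curve d s (F C G : {mpoly K[3]}) c : (s * s)%N = q -> d = s.+1 ->
  F = c *: C -> plane_curve d C G -> forall Q Q', ev F Q != 0 -> ev F Q' != 0 ->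
  ev F Q ^+ s.-1 = ev F Q' ^+ s.-1.
Proof.
move=> sq ds -> pc Q Q'; rewrite !evZ !mulf_eq0 !negb_or => /andP[_ CQ] /andP[_ CQ'].
by rewrite !exprMn (plane_curve_const pc sq ds CQ CQ').
Qed.

Lemma square_card_gt1 s : (s * s)%N = q -> (1 < s)%N.
Proof. by move=> e; have := card_field_gt1 K; rewrite -e; case: s {e} => [|[]]. Qed.

Lemma square_card_ge4 s : (s * s)%N = q -> (4 <= q)%N.
Proof. by move=> e; have := square_card_gt1 e; rewrite -e; case: s {e} => [|[|k]] // _; clear; lia. Qed.

Lemma square_card_succ_leq s : (s * s)%N = q -> (s.+1 <= q)%N.
Proof. by move=> e; have := square_card_gt1 e; rewrite -e; case: s {e} => [|[|k]] // _; clear; lia. Qed.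

Lemma plane_const s (F G : {mpoly K[3]}) : (s * s)%N = q -> F != 0 -> F \is s.+1.-homog ->
  frob F = F * G -> squarefree F -> smooth_rational F ->
  forall Q Q', ev F Q != 0 -> ev F Q' != 0 -> ev F Q ^+ s.-1 = ev F Q' ^+ s.-1.
Proof.
move=> sq F0 hF FG red sm; have s1 := square_card_gt1 sq.
have [P [R [P0 FP gR FR]]] :=
  tangent_not_contained (isT : (2 < 3)%N) F0 hF (ltnW s1) (square_card_succ_leq sq) FG red sm.
have [i gi] := row_neq0P _ (sm P P0 FP).
have gv : dot (grad F P) (delta_mx 0 i) != 0 by rewrite -ev_mder mder_delta; move: gi; rewrite mxE.
have := @section_dichotomy K 3 s.+1 F G 1%:M P (delta_mx 0 i) hF FG (square_card_ge4 sq).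
rewrite !mulmx1 sq => /(_ (leqnn _) FP gv)[h|[_ [C [GC [c [c0 eF pc]]]]]].
  by have := h R; rewrite mulmx1 => /(_ gR) z; rewrite z eqxx in FR.
by rewrite lsub1 in eF; apply: const_of_plane_curve sq erefl eF pc.
Qed.

(** On a line inside l = 0 the cofactor has a zero over an algebraic closure, and [F] is singular
    there. *)
Lemma no_linear_factor_smooth n d l (F : {mpoly K[n.+1]}) : (2 < n.+1)%N -> (1 < d)%N ->
  l != 0 -> F != 0 -> F \is d.-homog -> smooth_rational F -> smooth_hypersurface F -> ~ mdvd (lin l) F.
Proof.
move=> n3 d1 l0 F0 hF sm smX [M eM].
have M0 : M != 0 by apply: contraNneq F0 => z; rewrite eM z mulr0.
have hM : M \is d.-1.-homog by apply: dhomog_lin_cofactor M0 l0 _; rewrite -eM.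
have d10 : (0 < d.-1)%N by move: d1; clear; lia.
have [a [b [iab la lb]]] := kernel_indep l n3.
have [Mb|Mb] := eqVneq (ev M b) 0.
  by rewrite eM in sm; apply: (not_smooth_of_common_zero sm (indep_neq0r iab) lb Mb).
have [L [f _]] := countable_algebraic_closure K.
have sM := size_lp a hM Mb.
have [x rx] : exists x, root (map_poly f (lp a b M)) x.
  by apply/closed_rootP; rewrite size_map_poly sM; move: d10; clear; lia.
pose v i : L := f (a 0 i) + x * f (b 0 i).
have evf (H : {mpoly K[n.+1]}) : meval v (map_mpoly f H) = (map_poly f (lp a b H)).[x].
  pose g1 : {rmorphism {mpoly K[n.+1]} -> L} := meval v \o map_mpoly f.
  pose g2 : {rmorphism {mpoly K[n.+1]} -> L} := horner_eval x \o (map_poly f \o lp a b).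
  suff : g1 =1 g2 by move/(_ H).
  apply: mpoly_rmorph_ext => [c|i] /=.
    by rewrite map_mpolyC mevalC lpC map_polyC /horner_eval hornerC.
  rewrite map_mpolyX mevalXU lpX rmorphD /= map_polyC map_polyZ map_polyX /horner_eval /= !hornerE.
  by rewrite /v mulrC.
have Mv : meval v (map_mpoly f M) = 0 by rewrite evf; apply/eqP.
have lv : meval v (map_mpoly f (lin l)) = 0.
  rewrite evf; suff -> : lp a b (lin l) = 0 by rewrite rmorph0 horner0.
  rewrite /lin rmorph_sum /=; under eq_bigr => i _ do rewrite lpZ lpX scalerDr scalerA -mul_polyC -polyCM.
  rewrite big_split /= -rmorph_sum -scaler_suml -/(dot l a) -/(dot l b) la lb.
  by rewrite rmorph0 scale0r addr0.
have [i vi] : exists i, v i != 0.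
  apply/existsP; apply: contraT => /existsPn z.
  have [j bj] := row_neq0P _ (indep_neq0r iab).
  have ex : x = f (- (a 0 j / b 0 j)).
    have := z j; rewrite negbK /v addrC addr_eq0 => /eqP e.
    have fb : f (b 0 j) != 0 by rewrite fmorph_eq0.
    by apply: (mulIf fb); rewrite e -rmorphM mulNr divfK // rmorphN.
  case/eqP: (indep_addZ (- (a 0 j / b 0 j)) iab); apply/rowP => k; rewrite !mxE.
  have := z k; rewrite negbK /v ex -rmorphM -rmorphD fmorph_eq0 => /eqP; by [].
have [||j] := smX L f v; first by exists i.
  by rewrite eM rmorphM mevalM Mv mulr0.
by rewrite eM mderivM rmorphD /= mevalD !rmorphM /= Mv lv mulr0 mul0r addr0 eqxx.
Qed.

(** As d = 1 in [K], the line joining [Q] and [Q'] meets [F] in a rational point [R]. If no plane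
    through this line has an irreducible section smooth at [R], then [F] vanishes on all of T_R,
    which smoothness excludes. *)
Lemma surface_const s (F G : {mpoly K[4]}) : (s * s)%N = q -> F != 0 -> F \is s.+1.-homog ->
  frob F = F * G -> smooth_rational F -> smooth_hypersurface F ->
  forall Q Q', ev F Q != 0 -> ev F Q' != 0 -> ev F Q ^+ s.-1 = ev F Q' ^+ s.-1.
Proof.
move=> sq F0 hF FG sm smX Q Q' FQ FQ'; have s1 := square_card_gt1 sq.
have off0 v : ev F v != 0 -> v != 0.
  by apply: contraNneq => ->; rewrite (ev_homog0 _ hF).
have [/existsP[c /eqP ec]|/existsPn nc] := boolP [exists c, Q == c *: Q'].
  have c0 : c != 0 by apply: contraNneq (off0 _ FQ) => z; rewrite ec z scale0r.
  rewrite ec (ev_homogZ _ _ hF) exprMn -exprM.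
  have -> : (s.+1 * s.-1 = q.-1)%N by rewrite -sq; case: s s1 {sq hF} => // k _; rewrite /=; clear; lia.
  have -> : c ^+ q.-1 = 1.
    by apply: (mulfI c0); rewrite -exprS prednK ?(ltnW (card_field_gt1 K)) // expf_card mulr1.
  by rewrite mul1r.
have iQ : indep Q Q' by apply: indepPn (off0 _ FQ') nc.
have [t Ft] : exists t, ev F (Q + t *: Q') = 0.
  have [/existsP[t /eqP h]|/existsPn h] := boolP [exists t, ev F (Q + t *: Q') == 0]; first by exists t.
  have /eqP := line_no_zero_deg hF FG FQ' h; by rewrite (d_natr1 sq erefl) oner_eq0.
set R := Q + t *: Q' in Ft; have R0 : R != 0 by apply: indep_addZ.
have gR := sm R R0 Ft.
pose B (v : 'rV[K]_4) : 'M[K]_(3, 4) := \matrix_(k < 3) [:: Q; Q'; v]`_k.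
have eB v (j : 'I_3) : delta_mx 0 j *m B v = [:: Q; Q'; v]`_j by rewrite -rowE rowK.
pose x : 'rV[K]_3 := delta_mx 0 o0 + t *: delta_mx 0 o1.
have ex v : x *m B v = R by rewrite mulmxDl -scalemxAl !eB.
have step v u0 : dot (grad F R) (u0 *m B v) != 0 ->
    ev F Q ^+ s.-1 = ev F Q' ^+ s.-1 \/
    forall u : 'rV[K]_3, dot (grad F R) (u *m B v) = 0 -> ev F (u *m B v) = 0.
  move=> gu; have := @section_dichotomy K 4 s.+1 F G (B v) x u0 hF FG (square_card_ge4 sq).
  rewrite ex sq => /(_ (leqnn _) Ft gu)[h|[_ [C [GC [c [c0 eF pc]]]]]]; [by right|left].
  have := const_of_plane_curve sq erefl eF pc (Q := delta_mx 0 o0) (Q' := delta_mx 0 o1).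
  by rewrite !ev_lsub !eB; apply.
apply: Classical_Prop.NNPP => no.
have {}step v u0 : dot (grad F R) (u0 *m B v) != 0 ->
    forall u : 'rV[K]_3, dot (grad F R) (u *m B v) = 0 -> ev F (u *m B v) = 0.
  by move=> /step[|//].
apply: (no_linear_factor_smooth (isT : (2 < 4)%N) _ gR F0 hF sm smX); first exact: ltnW.
apply: (lin_dvd_homog gR hF (square_card_succ_leq sq)) => w gw.
have viaw u0 : dot (grad F R) (u0 *m B w) != 0 -> ev F w = 0.
  by move=> h; have := step w u0 h (delta_mx 0 o2); rewrite eB; apply.
have [gQ|gQ] := eqVneq (dot (grad F R) Q) 0; last by apply: (viaw (delta_mx 0 o0)); rewrite eB.
have [i gi] := row_neq0P _ gR.
have gv : dot (grad F R) (delta_mx 0 i) != 0 by rewrite -ev_mder mder_delta; move: gi; rewrite mxE.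
have := step (delta_mx 0 i) (delta_mx 0 o2); rewrite eB => /(_ gv (delta_mx 0 o0)).
by rewrite eB => /(_ gQ) z; rewrite z eqxx in FQ.
Qed.

End ConstantPower.

(** * Hermitian forms over a field of order s^2 *)

Section Hermitian.
Variable K : finFieldType.
Local Notation q := #|K|.
Variable s : nat.
Hypothesis sq : (s * s)%N = q.

Let s1 : (1 < s)%N. Proof. exact: square_card_gt1 sq. Qed.
Let s_lt_q : (s < q)%N. Proof. exact: square_card_succ_leq sq. Qed.

Lemma exprsD (S : comNzRingType) p : p \in [pchar K] -> p \in [pchar S] ->
  {morph (fun x : S => x ^+ s) : x y / x + y}.
Proof.
move=> pK pS x y; apply: exprDn_pchar.
have : [pchar S].-nat q.
  by rewrite (card_field_pchar pK) pnatX pnatE ?pS //; case/andP: pK.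
by rewrite -sq pnatM => /andP[].
Qed.

Lemma exprs_sum (S : comNzRingType) p I (r : seq I) (f : I -> S) :
  p \in [pchar K] -> p \in [pchar S] -> (\sum_(i <- r) f i) ^+ s = \sum_(i <- r) f i ^+ s.
Proof.
move=> pK pS; apply: (big_morph _ (exprsD pK pS)).
by rewrite expr0n gtn_eqF // ltnW.
Qed.

Lemma exprsDK (x y : K) : (x + y) ^+ s = x ^+ s + y ^+ s.
Proof. by have [p _ pK] := finPcharP K; apply: (exprsD pK pK). Qed.

Lemma exprss (x : K) : (x ^+ s) ^+ s = x.
Proof. by rewrite -exprM sq expf_card. Qed.

(** For a generator g and a = g^i, the relation a^(s-1) = 1 says that q - 1 = (s + 1)(s - 1) divides
    i (s - 1), so s + 1 divides i. *)
Lemma norm_surjective (a : K) : a != 0 -> a ^+ s = a -> exists2 m, m != 0 & m ^+ s.+1 = a.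
Proof.
move=> a0 as_; have q1 := card_field_gt1 K; have q0 : (0 < q.-1)%N by move: q1; move: #|K|; lia.
have unity (x : K) : x != 0 -> x ^+ q.-1 = 1.
  by move=> x0; apply: (mulfI x0); rewrite -exprS prednK ?(ltnW q1) // expf_card mulr1.
pose rs := [seq x <- enum K | x != 0].
have : has q.-1.-primitive_root rs.
  apply: cyclic.has_prim_root => //.
  - by apply/allP => x; rewrite mem_filter unity_rootE => /andP[x0 _]; rewrite unity.
  - by rewrite filter_uniq // enum_uniq.
  rewrite size_filter.
  have : (count (pred1 (0%R : K)) (enum K) + count (predC (pred1 (0%R : K))) (enum K) = q)%N.
    by rewrite count_predC -cardE.
  by rewrite count_uniq_mem ?enum_uniq // mem_enum /= => <-.
case/hasP=> g _ pg; have [i0 ei] := prim_rootP pg (unity a a0); move: (nat_of_ord i0) ei => i ei.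
have qE : q.-1 = (s.+1 * s.-1)%N by rewrite -sq; case: s s1 => // k _; rewrite /=; clear; lia.
have : (q.-1 %| i * s.-1)%N.
  rewrite (prim_order_dvd pg) exprM -ei; apply/eqP; apply: (mulfI a0).
  by rewrite -exprS prednK ?(ltnW s1) // as_ mulr1.
rewrite qE dvdn_pmul2r; last by move: s1; clear; lia.
case/dvdnP => k ek; exists (g ^+ k); last by rewrite -exprM -ek -ei.
by apply: contraNneq a0 => z; rewrite ei ek exprM z expr0n.
Qed.

Section Form.
Variables (n : nat) (E : {mpoly K[n]}).
Hypothesis hE : E \is s.+1.-homog.
Hypothesis frobE : frob E = E ^+ s.

Let dK : s.+1%:R = 1 :> K. Proof. exact: d_natr1 sq erefl. Qed.

(** Since m has degree s < q, only the exponent of x_i reaches q, so no other summand x_k^q E_k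
    contains this monomial. *)
Lemma mcoeff_frob i (m : 'X_{1..n}) : mdeg m = s ->
  (frob E)@_(U_(i) *+ q + m)%MM = E^`M(i)@_m.
Proof.
move=> ms; rewrite /frob raddf_sum /= (bigD1 i) //= big1 ?addr0 => [|k nk].
  by rewrite mpolyXn mulrC mcoeffMX.
rewrite mpolyXn mulrC; apply: memN_msupp_eq0; rewrite (perm_mem (msuppMX _ _)).
apply/mapP => -[m' _ /(congr1 (fun M : 'X_{1..n} => M k))].
rewrite !mnmDE !mulmnE !mnm1E eqxx eq_sym (negPf nk) mul0n add0n mul1n => e.
have : (m k <= s)%N by rewrite -ms mdegE (bigD1 k) //= leq_addr.
by rewrite e leqNgt (leq_trans s_lt_q) // leq_addr.
Qed.

Lemma msupp_exprs (M : 'X_{1..n}) : M \in msupp (E ^+ s) -> exists m, M = (m *+ s)%MM.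
Proof.
have [p _ pK] := finPcharP K.
rewrite {1}(mpolyE E) (exprs_sum _ _ pK (pchar_mpolyP n pK)) mcoeff_msupp raddf_sum /= => nz.
apply: Classical_Prop.NNPP => no; case/negP: nz; rewrite big1 // => m _.
rewrite exprZn mpolyXn mcoeffZ mcoeffX; case: eqP => [e|_]; last by rewrite mulr0.
by case: no; exists m.
Qed.

(* The exponents of [x_i^q E_i] do not overlap for distinct [i], so each monomial of [E_i] shows up
   in [E^s], all of whose exponents are multiples of [s]. *)
Lemma mderiv_support i (m : 'X_{1..n}) : m \in msupp E^`M(i) -> exists j, m = (U_(j) *+ s)%MM.
Proof.
move=> mE; have ms : mdeg m = s by rewrite (dhomog_mdeg (dhomog_mderiv i hE) mE).
have [|M eM] := @msupp_exprs (U_(i) *+ q + m)%MM.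
  by rewrite -frobE mcoeff_msupp mcoeff_frob // -mcoeff_msupp.
have dv j : (s %| m j)%N.
  have := congr1 (fun M : 'X_{1..n} => M j) eM; rewrite mnmDE !mulmnE => e.
  have : (s %| U_(i)%MM j * q + m j)%N by rewrite e dvdn_mull.
  by rewrite dvdn_addr // dvdn_mull // -sq dvdn_mulr.
have [j mj] : exists j, (0 < m j)%N.
  apply/existsP; apply: contraT => /existsPn z; move: ms; rewrite mdegE big1 => [e|j _].
    by have := s1; rewrite -e.
  by apply/eqP; rewrite -leqn0 leqNgt.
have sj : (s <= m j)%N := dvdn_leq mj (dv j).
exists j; apply/mnmP => k; rewrite mulmnE mnm1E; move: ms; rewrite mdegE (bigD1 j) //=.
have [<-|njk] := eqVneq j k; first by move: sj; rewrite mul1n; lia.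
by rewrite (bigD1 k) 1?eq_sym //= mul0n; move: sj; lia.
Qed.

(** Linear in [u] and s-semilinear in [v]; its diagonal is [E], because s + 1 = 1 in [K]. *)
Definition herm (u v : 'rV[K]_n) : K := ev (mder u E) v.

Lemma mderiv_hermE i : E^`M(i) = \sum_j E^`M(i)@_(U_(j) *+ s)%MM *: 'X_j ^+ s.
Proof.
apply/mpolyP => m; rewrite [RHS]raddf_sum /=.
have [mE|nE] := boolP (m \in msupp E^`M(i)); last first.
  rewrite (memN_msupp_eq0 nE) big1 // => j _; rewrite mcoeffZ mpolyXn mcoeffX.
  by case: eqP => [e|_]; rewrite ?mulr0 // e (memN_msupp_eq0 nE) mul0r.
have [j ej] := mderiv_support mE; rewrite ej (bigD1 j) //= big1 ?addr0 => [|k nk].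
  by rewrite mcoeffZ mpolyXn mcoeffX eqxx mulr1.
rewrite mcoeffZ mpolyXn mcoeffX; case: eqP => [/(congr1 (fun M : 'X_{1..n} => M k))|_].
  by rewrite !mulmnE !mnm1E eqxx eq_sym (negPf nk) mul0n mul1n => z; have := s1; rewrite z.
by rewrite mulr0.
Qed.

Lemma hermDr u v w : herm u (v + w) = herm u v + herm u w.
Proof.
rewrite /herm /mder !ev_sum -big_split; apply: eq_bigr => i _ /=.
rewrite !evZ -mulrDr mderiv_hermE !ev_sum -big_split; congr (_ * _); apply: eq_bigr => j _ /=.
by rewrite !evZ !evXn !evX mxE exprsDK mulrDr.
Qed.

Lemma hermZr u c v : herm u (c *: v) = c ^+ s * herm u v.
Proof. exact: ev_homogZ (dhomog_mder u hE). Qed.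

Lemma hermDl u v w : herm (u + v) w = herm u w + herm v w.
Proof. by rewrite /herm mderD evD. Qed.

Lemma hermZl c u v : herm (c *: u) v = c * herm u v.
Proof. by rewrite /herm mderZ evZ. Qed.

Lemma herm0l v : herm 0 v = 0.
Proof. by rewrite -(scale0r (0 : 'rV[K]_n)) hermZl mul0r. Qed.

Lemma herm_diag v : herm v v = ev E v.
Proof. by rewrite /herm (ev_Euler _ hE) -mulr_natr dK mulr1. Qed.

Hypothesis E_sub : forall v, ev E v ^+ s = ev E v.

Lemma polarization (a b : K) : (forall c : K, a * c ^+ s + b * c = 0) -> a = 0 /\ b = 0.
Proof.
move=> h; have : a *: 'X^s + b *: 'X = 0 :> {poly K}.
  apply: poly_all_roots => [|t]; last by rewrite !hornerE h.
  apply: leq_trans (size_polyD _ _) _; rewrite geq_max; apply/andP; split;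
    apply: leq_trans (size_scale_leq _ _) _; rewrite ?size_polyXn ?size_polyX //.
  exact: card_field_gt1.
move=> e; split.
  have := congr1 (fun P : {poly K} => P`_s) e.
  by rewrite coefD !coefZ coefXn eqxx coefX gtn_eqF // mulr1 mulr0 addr0 coef0.
have := congr1 (fun P : {poly K} => P`_1) e.
by rewrite coefD !coefZ coefXn coefX eqxx ltn_eqF // mulr1 mulr0 add0r coef0.
Qed.

Lemma herm_expand u v c : ev E (u + c *: v) =
  ev E u + herm u v * c ^+ s + herm v u * c + c * c ^+ s * ev E v.
Proof.
by rewrite -!herm_diag hermDl !hermDr !hermZl !hermZr; ring.
Qed.

(** [E] takes values fixed by the s-th power. Equating E(u + c v) with its s-th power leaves only
    terms in c and c^s, whose coefficients vanish because s < q. *)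
Lemma herm_conj u v : herm v u = herm u v ^+ s.
Proof.
have h c : (herm u v - herm v u ^+ s) * c ^+ s + (herm v u - herm u v ^+ s) * c = 0.
  have := E_sub (u + c *: v); rewrite herm_expand !exprsDK !exprMn !exprss !E_sub => e.
  apply/eqP; rewrite -subr_eq0 -oppr_eq0; apply/eqP.
  transitivity ((ev E u + herm u v ^+ s * c + herm v u ^+ s * c ^+ s + c ^+ s * c * ev E v)
    - (ev E u + herm u v * c ^+ s + herm v u * c + c * c ^+ s * ev E v)); first by ring.
  by rewrite e subrr.
by have [_ /eqP] := polarization h; rewrite subr_eq0 => /eqP.
Qed.

Definition orthonormal m (W : 'M[K]_(m, n)) :=
  [forall i, forall j, herm (row i W) (row j W) == (i == j)%:R].

Lemma herm_suml m (x : 'rV[K]_m) (W : 'M[K]_(m, n)) v :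
  herm (x *m W) v = \sum_i x 0 i * herm (row i W) v.
Proof.
rewrite mulmx_sum_row; elim/big_rec2: _ => [|i a b _ <-]; last by rewrite hermDl hermZl.
exact: herm0l.
Qed.

Lemma orthonormal_coord m (W : 'M[K]_(m, n)) (x : 'rV[K]_m) j :
  orthonormal W -> herm (x *m W) (row j W) = x 0 j.
Proof.
move=> /forallP oW; rewrite herm_suml (bigD1 j) //= big1 ?addr0 => [|i nij].
  by have /forallP/(_ j)/eqP -> := oW j; rewrite eqxx mulr1.
by have /forallP/(_ j)/eqP -> := oW i; rewrite (negPf nij) mulr0.
Qed.

Lemma orthonormal_diag m (W : 'M[K]_(m, n)) (x : 'rV[K]_m) :
  orthonormal W -> ev E (x *m W) = \sum_i x 0 i ^+ s.+1.
Proof.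
move=> oW; rewrite -herm_diag herm_suml; apply: eq_bigr => i _.
by rewrite (herm_conj (x *m W)) orthonormal_coord // exprS.
Qed.

Lemma orthonormal_free m (W : 'M[K]_(m, n)) : orthonormal W -> row_free W.
Proof.
move=> oW; rewrite -kermx_eq0; apply/eqP/row_matrixP => k; rewrite row0.
set x := row k _; have xW : x *m W = 0 by rewrite /x -row_mul mulmx_ker row0.
apply/rowP => j; rewrite [RHS]mxE -(orthonormal_coord x j oW) xW.
exact: herm0l.
Qed.

(** A vector orthogonal to [W] with nonzero value could be scaled to length 1 by [norm_surjective]
    and appended. [E] may be degenerate, so [W] need not have [n] rows. *)
Lemma maximal_orthonormal : exists m (W : 'M[K]_(m, n)), orthonormal W /\
  forall v, (forall i, herm v (row i W) = 0) -> ev E v = 0.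
Proof.
pose P m := [exists W : 'M[K]_(m, n), orthonormal W].
have P0 : exists m, P m.
  by exists 0%N; apply/existsP; exists 0; apply/forallP => -[].
have Pn m : P m -> (m <= n)%N.
  by case/existsP => W /orthonormal_free /eqP <-; apply: rank_leq_col.
case: (ex_maxnP P0 Pn) => m /existsP[W oW] mmax; exists m, W; split=> // v vW.
apply/eqP; apply/negPn/negP => Ev; have [k k0 ek] := norm_surjective Ev (E_sub v).
pose w := k^-1 *: v.
have ww : herm w w = 1.
  by rewrite hermZl hermZr herm_diag mulrA -exprS -ek -exprMn mulVf // expr1n.
have wW i : herm w (row i W) = 0 by rewrite hermZl vW mulr0.
have : P (m + 1)%N.
  apply/existsP; exists (col_mx W w); apply/forallP => i; apply/forallP => j.
  rewrite -(splitK i) -(splitK j); case: (split i) => i'; case: (split j) => j' /=.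
  - rewrite !rowKu (inj_eq (@lshift_inj _ _)).
    by have /forallP/(_ i')/forallP/(_ j') := oW.
  - rewrite rowKu rowKd eq_lrshift (ord1 j') row_id herm_conj wW expr0n gtn_eqF //.
    exact: ltnW.
  - by rewrite rowKu rowKd eq_rlshift (ord1 i') row_id wW.
  - by rewrite !rowKd (ord1 i') (ord1 j') !row_id eqxx ww.
by move/mmax; rewrite addn1 ltnn.
Qed.

Lemma perp_complement m (W : 'M[K]_(m, n)) : orthonormal W -> exists k (V : 'M[K]_(k, n)),
  [/\ n = (m + k)%N, row_free (col_mx W V) & forall (x : 'rV[K]_k) i, herm (x *m V) (row i W) = 0].
Proof.
move=> oW; pose Phi : 'M[K]_(n, m) := \matrix_(j, i) (grad E (row i W)) 0 j.
have hPhi v i : herm v (row i W) = (v *m Phi) 0 i.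
  by rewrite /herm ev_mder mxE; apply: eq_bigr => j _; rewrite [Phi _ _]mxE mulrC.
pose V := row_base (kermx Phi).
have VW (x : 'rV[K]_(\rank (kermx Phi))) i : herm (x *m V) (row i W) = 0.
  rewrite hPhi; have /sub_kermxP -> : (x *m V <= kermx Phi)%MS.
    by rewrite (submx_trans (submxMl _ _)) // eq_row_base.
  by rewrite mxE.
have fr : row_free (col_mx W V).
  rewrite -kermx_eq0; apply/eqP/row_matrixP => k; rewrite row0.
  set x := row k _; have : x *m col_mx W V = 0 by rewrite /x -row_mul mulmx_ker row0.
  rewrite -[x]hsubmxK mul_row_col => e.
  have xl : lsubmx x = 0.
    apply/rowP => j; rewrite [RHS]mxE -(orthonormal_coord _ j oW).
    rewrite -[_ *m W](addrK (rsubmx x *m V)) e sub0r -scaleN1r hermZl VW mulr0 //.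
  move: e; rewrite xl mul0mx add0r => /eqP; rewrite mulmx_free_eq0 ?row_base_free // => /eqP ->.
  by rewrite row_mx0.
exists (\rank (kermx Phi)), V; split=> //.
have := rank_leq_col (col_mx W V); rewrite (eqP fr).
have := mxrank_ker Phi; have := rank_leq_col Phi; move: (\rank _) (\rank _) => a b; lia.
Qed.

End Form.

Theorem hermitian_normal_form n (E : {mpoly K[n]}) : E \is s.+1.-homog -> frob E = E ^+ s ->
  (forall v, ev E v ^+ s = ev E v) -> exists m (B : 'M[K]_n), [/\ B \in unitmx, (m <= n)%N &
    forall x, ev E (x *m B) = \sum_(i < n | (i < m)%N) x 0 i ^+ s.+1].
Proof.
move=> hE fE Es; have [m [W [oW iso]]] := maximal_orthonormal hE fE Es.
have [k [V [en fr VW]]] := perp_complement hE oW.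
subst n; exists m, (col_mx W V); split; rewrite ?leq_addr //; first by rewrite -row_free_unit.
move=> x; rewrite -{1}[x]hsubmxK mul_row_col.
set w := lsubmx x *m W; set v := rsubmx x *m V.
have Ev : ev E v = 0 by apply: iso => i; apply: VW.
have wv : herm E v w = 0.
  rewrite (herm_conj hE fE Es) herm_suml big1 ?expr0n ?gtn_eqF ?(ltnW s1) // => i _.
  by rewrite (herm_conj hE fE Es) VW expr0n gtn_eqF ?(ltnW s1) // mulr0.
have := herm_expand hE fE w v 1; rewrite scale1r Ev wv (herm_conj hE fE Es) wv.
rewrite expr0n gtn_eqF ?(ltnW s1) // !mul0r !mulr0 !addr0 => ->.
rewrite (orthonormal_diag hE fE Es) // big_split_ord /= [X in _ = _ + X]big1 ?addr0 => [|i].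
  by apply: eq_big => i; [rewrite ltn_ord|rewrite mxE].
by rewrite ltnNge leq_addr.
Qed.

End Hermitian.

(** * From constant powers to the Hermitian equation *)

Section Conclusion.
Variable K : finFieldType.
Local Notation q := #|K|.

Lemma comp_lin_subst n (A : 'M[K]_n.+1) (F : {mpoly K[n.+1]}) : F \mPo lin_subst A = lsub A^T F.
Proof.
pose f : {rmorphism {mpoly K[n.+1]} -> {mpoly K[n.+1]}} := comp_mpoly (lin_subst A).
suff : f =1 lsub A^T by move/(_ F).
apply: mpoly_rmorph_ext => [c|i] /=; first by rewrite comp_mpolyC lsubC.
rewrite comp_mpolyXU lsubX -tnth_nth tnth_mktuple.
by apply: eq_bigr => j _; rewrite mxE.
Qed.

Lemma hermitian_of_const s n (F G : {mpoly K[n.+1]}) : (s * s)%N = q -> F != 0 ->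
  F \is s.+1.-homog -> frob F = F * G -> smooth_rational F ->
  (forall Q Q', ev F Q != 0 -> ev F Q' != 0 -> ev F Q ^+ s.-1 = ev F Q' ^+ s.-1) ->
  is_hermitian_hypersurface s F.
Proof.
move=> sq F0 hF FG sm cst; have s1 := square_card_gt1 sq; have sq' := square_card_succ_leq sq.
have [Q FQ] : exists Q, ev F Q != 0.
  apply/existsP; apply: contraT => /existsPn h; case/eqP: F0.
  by apply: (homog_vanish hF sq') => v; apply/eqP/negbNE/h.
have dK : s.+1%:R = 1 :> K by apply: d_natr1 sq erefl.
have qE : q.-1 = (s.+1 * s.-1)%N by rewrite -sq; case: s s1 {sq hF cst sq' dK} => // k _; rewrite /=; clear; lia.
have G0 : G != 0.
  apply: contraTneq isT => z; have := ev_cofactor_off hF FG FQ; rewrite z ev0 dK => /eqP.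
  by rewrite eq_sym oner_eq0.
have hG : G \is q.-1.-homog by apply: dhomog_cofactor F0 G0 hF FG.
pose k := ev F Q; have k0 : k != 0 := FQ.
have s10 : (0 < s.-1)%N by move: s1; clear; lia.
(* At a rational point of [F], smoothness gives G = d - 1 = 0; off [F], G = d = 1 while F^(s-1) is
   constant. Both sides have degree q - 1 = (s + 1)(s - 1). *)
have eG : G = (k ^+ s.-1)^-1 *: F ^+ s.-1.
  apply/eqP; rewrite -subr_eq0; apply/eqP.
  have hD : G - (k ^+ s.-1)^-1 *: F ^+ s.-1 \is q.-1.-homog.
    by apply: rpredB => //; apply: rpredZ; rewrite qE; apply: dhomogMn.
  apply: (homog_vanish hD (leq_pred _)) => v.
  have [->|v0] := eqVneq v 0.
    by rewrite (ev_homog0 _ hD) // qE muln_gt0.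
  rewrite evB evZ evXn; have [Fv|Fv] := eqVneq (ev F v) 0.
    rewrite Fv expr0n gtn_eqF // mulr0 subr0.
    have /eqP := ev_cofactor_on hF FG Fv (sm v v0 Fv); rewrite dK -{2}[1]add0r.
    by rewrite (inj_eq (addIr 1)) => /eqP.
  by rewrite (ev_cofactor_off hF FG Fv) dK (cst v Q) // mulVf ?subrr // expf_neq0.
pose E := k^-1 *: F.
have hE : E \is s.+1.-homog by apply: rpredZ.
have fE : frob E = E ^+ s.
  have -> : frob E = k^-1 *: frob F.
    rewrite /frob scaler_sumr; apply: eq_bigr => i _; by rewrite mderivZ scalerAr.
  rewrite FG eG -scalerAr -exprS prednK ?(ltnW s1) // scalerA exprZn; congr (_ *: _).
  by rewrite -exprVn -exprS prednK ?(ltnW s1).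
have Es v : ev E v ^+ s = ev E v.
  rewrite evZ; have [->|Fv] := eqVneq (ev F v) 0; first by rewrite mulr0 expr0n gtn_eqF // ltnW.
  rewrite -{1}(prednK (ltnW s1)) exprSr exprMn (cst v Q) // exprVn mulVf ?mul1r //.
  exact: expf_neq0.
have [m [B [Bu mn hB]]] := hermitian_normal_form sq hE fE Es.
have m0 : (0 < m)%N.
  rewrite lt0n; apply: contraNneq FQ => mz.
  have := hB (Q *m invmx B); rewrite mulmxKV // mz big_pred0 // evZ => /eqP.
  by rewrite mulf_eq0 invr_eq0 (negPf k0).
(* The standard form sums over i <= r, so m squares of norms correspond to r = m - 1; the transpose
   appears because [lsub] acts on row vectors. *)
exists B^T, k, m.-1; split; rewrite ?unitmx_tr //; first by rewrite -ltnS prednK.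
rewrite comp_lin_subst trmxK; apply/eqP; rewrite -subr_eq0; apply/eqP.
have hh : hermitian_std K n s m.-1 \is s.+1.-homog.
  apply: rpred_sum => i _.
  have hX : 'X_i \is [in K[n.+1], 1.-homog] by rewrite dhomogX /= mdeg1.
  by have := dhomogMn s.+1 hX; rewrite mul1n.
have hD : lsub B F - k *: hermitian_std K n s m.-1 \is s.+1.-homog.
  by apply: rpredB; [apply: lsub_homog|apply: rpredZ].
apply: (homog_vanish hD sq') => v; rewrite evB evZ ev_lsub.
have := hB v; rewrite evZ => /(congr1 ( *%R k)); rewrite mulVKf // => ->.
apply/eqP; rewrite subr_eq0; apply/eqP; congr (_ * _); rewrite /hermitian_std ev_sum.
by apply: eq_big => [i|i _]; [rewrite -[X in (_ < X)%N](prednK m0) ltnS|rewrite evXn evX].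
Qed.

End Conclusion.
Theorem theorem1p5
  (K : finFieldType) (p k q n d : nat) (F : {mpoly K[n.+1]}) :
  prime p -> (0 < k)%N -> q = (p ^ k)%N -> #|K| = q ->
  (2 <= n)%N -> (2 <= d)%N ->
  F != 0 -> F \is d.-homog ->
  frobenius_nonclassical q F ->
  smooth_at_rational_points F ->
  [/\ (p + 1 <= d)%N,
      (reduced F -> (q <= (d - 1) * (d - 1))%N) &
      (forall s : nat, (s * s)%N = q -> d = s.+1 ->
         ((n = 2%N /\ reduced F) \/ (n = 3%N /\ smooth_hypersurface F)) ->
         is_hermitian_hypersurface s F)].
Proof.
move=> pp k0 qE Kq n2 d2 F0 hF FN smF.
have pK : p \in [pchar K] by apply: card_finPcharP pp; rewrite Kq; exact: qE.
rewrite -{}Kq {qE} in FN *; case: FN => G FG; rewrite -[F10 _ _]/(frob F) in FG.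
have sm : smooth_rational F.
  move=> v /row_neq0P v0 /(smF (v 0) v0)[i gi].
  by apply/row_neq0P; exists i; rewrite mxE.
split; first by rewrite addn1; apply: degree_gt_char hF FG sm.
  by move=> red; rewrite subn1; apply: squarefree_degree_bound hF d2 FG red sm.
move=> s sq ds; rewrite {}ds in hF d2 *.
case=> [[en red]|[en smX]]; subst n; apply: (hermitian_of_const sq F0 hF FG sm).
  exact: plane_const sq F0 hF FG red sm.
exact: surface_const sq F0 hF FG sm smX.
Qed.
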